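(* Let $n\ge 2$ and $k,m\ge 0$ be integers. There is an isomorphism of $\mathfrak{sl}_n$-modules $$A^m_{[2]}(k)\simeq\frac{\displaystyle\bigoplus_{\substack{\lambda:\ k\ge \lambda_1,\ \lambda_n\ge 0\\ \lambda_1+\dots + \lambda_n=m}} V(\lambda)\otimes V(\lambda)^*}{\displaystyle\bigoplus_{\substack{\lambda:\ k-1\ge \lambda_1,\ \lambda_n\ge 0\\ \lambda_1+\dots + \lambda_n=m-1}} V(\lambda)\otimes V(\lambda)^*},$$ where the sums run over integer sequences $\lambda=(\lambda_1\ge\dots\ge\lambda_n)$ and the $\mathfrak{gl}_n$-module $V(\lambda)$ is regarded as the $\mathfrak{sl}_n$-module with highest weight $(\lambda_1-\lambda_n,\dots,\lambda_{n-1}-\lambda_n)$.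
   Context: The ground field is $\mathbb{C}$. Let $e_\theta=E_{1,n}\in\mathfrak{sl}_n$ and let $V_{k+1}=U(\mathfrak{sl}_n)\circ e_\theta^{k+1}\subset S^{k+1}(\mathfrak{sl}_n)$, where $\circ$ is the adjoint action of $\mathfrak{sl}_n$ on its symmetric algebra (by derivations). The $C_2$-algebra is $A_{[2]}(k)=S(\mathfrak{sl}_n)/\langle V_{k+1}\rangle$, with the induced adjoint $\mathfrak{sl}_n$-action; the degree grading of $S(\mathfrak{sl}_n)$ induces the grading $A_{[2]}(k)=\bigoplus_{m\ge 0}A^m_{[2]}(k)$ by $\mathfrak{sl}_n$-submodules. For a partition $\lambda=(\lambda_1\ge\dots\ge\lambda_n\ge0)$, $V(\lambda)$ is the irreducible $\mathfrak{gl}_n$-module of highest weight $\lambda$. The highest weight $(\beta_1,\dots,\beta_{n-1})$ of $\mathfrak{sl}_n$ means $(\beta_1-\beta_2)\omega_1+\dots+(\beta_{n-2}-\beta_{n-1})\omega_{n-2}+\beta_{n-1}\omega_{n-1}$, with $\omega_i$ the fundamental weights. The tensor products $V(\lambda)\otimes V(\lambda)^*$ carry the diagonal $\mathfrak{sl}_n$-action. The quotient $M/N$ of finite-dimensional $\mathfrak{sl}_n$-modules means: $N$ is isomorphic to a submodule of $M$, and $M/N$ is the quotient, which by complete reducibility is well defined up to isomorphism; i.e. $A\simeq M/N$ means $A\oplus N\simeq M$. Empty direct sums are $0$. *)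

(* Defs.v *)
From HB Require Import structures.
From mathcomp Require Import all_boot all_order all_algebra.
From mathcomp Require Import boolp reals.
From mathcomp Require Import complex.
From mathcomp Require Import mpoly.

Set Implicit Arguments.
Unset Strict Implicit.
Unset Printing Implicit Defensive.

Import GRing.Theory passmx.
Local Open Scope ring_scope.

Section LieAlgebras.
Variable F : fieldType.

Record lieAlgebra := LieAlgebra {
  lie_sort :> vectType F;
  bracket : lie_sort -> lie_sort -> lie_sort;
  bracket_linl : forall y, linear (bracket^~ y);
  bracket_linr : forall x, linear (bracket x);
  bracketxx : forall x, bracket x x = 0;
  bracket_jacobi : forall x y z,
    bracket x (bracket y z) + bracket y (bracket z x) + bracket z (bracket x y)
    = 0
}.

Record lie_action (L : lieAlgebra) (M : lmodType F) := LieAction {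
  act :> L -> M -> M;
  act_linl : forall v, linear (act^~ v);
  act_linr : forall x, linear (act x);
  act_bracket : forall x y v,
    act (bracket x y) v = act x (act y v) - act y (act x v)
}.

HB.instance Definition _ L M (rho : lie_action L M) x :=
  GRing.isLinear.Build F M M _ (rho x) (act_linr rho x).

Record lieModule (L : lieAlgebra) := LieModule {
  mod_sort :> lmodType F;
  mod_act : lie_action L mod_sort
}.

Definition lie_iso (L : lieAlgebra) (M N : lieModule L) : Prop :=
  exists f : {linear M -> N},
    bijective f /\ forall x v, f (mod_act M x v) = mod_act N x (f v).

Section Gl.
Variable n : nat.
Implicit Types x y z : 'M[F]_n.

Definition mxbracket x y := x *m y - y *m x.

Lemma mxbracket_linl y : linear (mxbracket^~ y).
Proof.
move=> a u v; rewrite /mxbracket mulmxDl mulmxDr -scalemxAl -scalemxAr.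
by rewrite scalerBr opprD addrACA.
Qed.

Lemma mxbracket_linr x : linear (mxbracket x).
Proof.
move=> a u v; rewrite /mxbracket mulmxDl mulmxDr -scalemxAl -scalemxAr.
by rewrite scalerBr opprD addrACA.
Qed.

Lemma mxbracketxx x : mxbracket x x = 0.
Proof. exact: subrr. Qed.

Lemma mxbracket_jacobi x y z :
  mxbracket x (mxbracket y z) + mxbracket y (mxbracket z x)
    + mxbracket z (mxbracket x y) = 0.
Proof.
rewrite /mxbracket !(mulmxBl, mulmxBr) !mulmxA.
set a := x *m y *m z; set b := x *m z *m y; set c := y *m z *m x.
set d := z *m y *m x; set e := y *m x *m z; set f := z *m x *m y.
rewrite !opprB.
have -> : a - b + (d - c) = (a + d) - (b + c) by rewrite addrACA opprD.
have -> : c - e + (b - f) = (b + c) - (e + f).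
  by rewrite addrACA opprD [c + b]addrC.
have -> : f - d + (e - a) = (e + f) - (a + d).
  by rewrite addrACA -opprD [f + e]addrC [d + a]addrC.
by rewrite !subrKA subrr.
Qed.

Lemma mxtrace_bracket x y : \tr (mxbracket x y) = 0.
Proof. by rewrite /mxbracket raddfB /= mxtrace_mulC subrr. Qed.

Definition gl : lieAlgebra :=
  LieAlgebra mxbracket_linl mxbracket_linr mxbracketxx mxbracket_jacobi.

End Gl.

Section Sl.
Variable n : nat.

Definition sl_space : {vspace 'M[F]_n} :=
  lker (linfun (@mxtrace F n : _ -> F^o)).

Lemma mem_sl (x : 'M[F]_n) : (x \in sl_space) = (\tr x == 0).
Proof. by rewrite memv_ker lfunE. Qed.

Definition sl_bracket (x y : subvs_of sl_space) : subvs_of sl_space :=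
  vsproj sl_space (mxbracket (vsval x) (vsval y)).

Lemma sl_bracketE x y :
  vsval (sl_bracket x y) = mxbracket (vsval x) (vsval y).
Proof. by rewrite vsprojK // mem_sl mxtrace_bracket. Qed.

Lemma sl_bracket_linl y : linear (sl_bracket^~ y).
Proof.
by move=> a u v; rewrite /sl_bracket !linearP /= mxbracket_linl linearP.
Qed.

Lemma sl_bracket_linr x : linear (sl_bracket x).
Proof.
by move=> a u v; rewrite /sl_bracket !linearP /= mxbracket_linr linearP.
Qed.

Lemma sl_bracketxx x : sl_bracket x x = 0.
Proof. by rewrite /sl_bracket mxbracketxx linear0. Qed.

Lemma sl_bracket_jacobi x y z :
  sl_bracket x (sl_bracket y z) + sl_bracket y (sl_bracket z x)
    + sl_bracket z (sl_bracket x y) = 0.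
Proof.
by apply: val_inj; rewrite !linearD /= !sl_bracketE mxbracket_jacobi.
Qed.

Definition sl : lieAlgebra :=
  LieAlgebra sl_bracket_linl sl_bracket_linr sl_bracketxx sl_bracket_jacobi.

End Sl.


Section Actions.
Variable L : lieAlgebra.

Definition adjoint_action : lie_action L L.
Proof.
refine (LieAction (@bracket_linl L) (@bracket_linr L) _) => x y v.
have anti a b : bracket a b = - bracket b a :> L.
  apply/eqP; rewrite -addr_eq0 -(bracketxx (a + b)).
  have Dl u w z : bracket (u + w) z = bracket u z + bracket w z :> L.
    by have := bracket_linl z 1 u w; rewrite !scale1r.
  have Dr u w z : bracket u (w + z) = bracket u w + bracket u z :> L.
    by have := bracket_linr u 1 w z; rewrite !scale1r.
  by rewrite Dl !Dr !bracketxx add0r addr0.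
have N u w : bracket u (- w) = - bracket u w :> L.
  have := bracket_linr u (-1) w 0; rewrite !scaleN1r !addr0 => ->.
  have := bracket_linr u 1 0 0; rewrite !scale1r addr0.
  by move/eqP; rewrite eq_sym -subr_eq0 addrK => /eqP ->; rewrite addr0.
have /eqP := bracket_jacobi x y v.
rewrite addrC addr_eq0 => /eqP E.
by rewrite anti E opprK [bracket v x]anti N.
Defined.

Section Submodules.
Variables (M : lmodType F) (rho : lie_action L M).

Record submodule := Submodule {
  sub_mem :> pred M;
  sub_closed : submod_closed sub_mem;
  sub_act : forall x v, v \in sub_mem -> rho x v \in sub_mem
}.

HB.instance Definition _ (N : submodule) :=
  GRing.isSubmodClosed.Build F M (sub_mem N) (sub_closed N).

(* Submodules are arbitrary stable subspaces: pred M is classically the type of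
   all subsets of M, through asbool. *)
Definition irreducible : Prop :=
  (exists v : M, v != 0) /\
  forall N : submodule,
    (forall v, v \in sub_mem N -> v = 0) \/ (forall v, v \in sub_mem N).

Variable N : submodule.

Record sub_sort := SubElt { sub_val :> M; _ : sub_val \in sub_mem N }.
HB.instance Definition _ := [isSub for sub_val].
HB.instance Definition _ := [Choice of sub_sort by <:].
HB.instance Definition _ := [SubChoice_isSubLmodule of sub_sort by <:].

Definition sub_fun x (v : sub_sort) : sub_sort :=
  SubElt (sub_act x (valP v)).

Definition sub_action : lie_action L sub_sort.
Proof.
refine (@LieAction L _ sub_fun _ _ _) => [v a x y|x a u v|x y v];
  apply: val_inj; rewrite ?linearP ?linearB /=.
- exact: act_linl.
- exact: linearP.
- exact: act_bracket.
Defined.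

Definition sub_module : lieModule L := LieModule sub_action.

Definition sub_zmod : zmodClosed M := GRing.ZmodClosed.clone M (sub_mem N) _.
Definition quot_sort : Type := Quotient.quot sub_zmod.
HB.instance Definition _ := GRing.Zmodule.on quot_sort.

Definition quot_pi (v : M) : quot_sort := (\pi_(Quotient.quot sub_zmod) v)%qT.
Definition quot_repr (q : quot_sort) : M := repr (q : Quotient.quot sub_zmod).

Lemma quot_reprK : cancel quot_repr quot_pi.
Proof. exact: reprK. Qed.

Lemma quot_piP u v : quot_pi u = quot_pi v <-> u - v \in sub_mem N.
Proof.
by rewrite (Quotient.idealrBE sub_zmod); split=> [E|/eqP //]; apply/eqP.
Qed.

Lemma quot_piD u v : quot_pi (u + v) = quot_pi u + quot_pi v.
Proof. exact: Quotient.pi_add. Qed.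

Definition quot_scale a q := quot_pi (a *: quot_repr q).

Lemma quot_piZ a v : quot_pi (a *: v) = quot_scale a (quot_pi v).
Proof.
apply/quot_piP; rewrite -scalerBr rpredZ //.
by apply/quot_piP; rewrite quot_reprK.
Qed.

Fact quot_scalerA a b q :
  quot_scale a (quot_scale b q) = quot_scale (a * b) q.
Proof. by rewrite -[q]quot_reprK -!quot_piZ scalerA. Qed.

Fact quot_scale1r : left_id 1 quot_scale.
Proof. by move=> q; rewrite -[q]quot_reprK -!quot_piZ scale1r. Qed.

Fact quot_scalerDr : right_distributive quot_scale +%R.
Proof.
move=> a q r; rewrite -[q]quot_reprK -[r]quot_reprK.
by rewrite -!(quot_piD, quot_piZ) scalerDr.
Qed.

Fact quot_scalerDl q : {morph quot_scale^~ q : a b / a + b}.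
Proof.
move=> a b; rewrite -[q]quot_reprK.
by rewrite -!(quot_piD, quot_piZ) scalerDl.
Qed.

HB.instance Definition _ := GRing.Zmodule_isLmodule.Build F quot_sort
  quot_scalerA quot_scale1r quot_scalerDr quot_scalerDl.

Fact quot_pi_linear : linear quot_pi.
Proof. by move=> a u v; rewrite quot_piD quot_piZ. Qed.
HB.instance Definition _ :=
  GRing.isLinear.Build F M quot_sort _ quot_pi quot_pi_linear.

Definition quot_fun x (q : quot_sort) : quot_sort :=
  quot_pi (rho x (quot_repr q)).

Lemma quot_funE x v : quot_fun x (quot_pi v) = quot_pi (rho x v).
Proof.
apply/quot_piP; rewrite -linearB sub_act //.
by apply/quot_piP; rewrite quot_reprK.
Qed.

Definition quot_action : lie_action L quot_sort.
Proof.
refine (@LieAction L _ quot_fun _ _ _) => [q a x y|x a q r|x y q].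
- by rewrite -[q]quot_reprK !quot_funE act_linl linearP.
- rewrite -[q]quot_reprK -[r]quot_reprK -linearP !quot_funE.
  by rewrite -linearP -linearP.
- by rewrite -[q]quot_reprK !quot_funE act_bracket linearB.
Defined.

End Submodules.

Definition span_words (M : lmodType F) (rho : lie_action L M) (v : M) :
    pred M :=
  fun u => `[< exists s : seq (F * seq L),
    u = \sum_(c <- s) c.1 *: foldr rho v c.2 >].

(* U(L) is spanned by the products x_1 ... x_r of elements of L, and such a
   product acts on v as x_1 (... (x_r v)). *)
Definition U_submodule (M : lmodType F) (rho : lie_action L M) (v : M) :
  submodule rho.
Proof.
refine (@Submodule M rho (span_words rho v) _ _).
- split=> [|a u w]; first by apply/asboolP; exists [::]; rewrite big_nil.
  move=> /asboolP[s ->] /asboolP[t ->]; apply/asboolP.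
  exists ([seq (a * c.1, c.2) | c <- s] ++ t).
  rewrite big_cat big_map scaler_sumr; congr (_ + _).
  by apply: eq_bigr => c _; rewrite scalerA.
- move=> x u /asboolP[s ->]; apply/asboolP.
  exists [seq (c.1, x :: c.2) | c <- s].
  by rewrite big_map linear_sum; apply: eq_bigr => c _; rewrite linearZ.
Defined.

Section DirectSum.

Definition prod_action (M N : lieModule L) : lie_action L (M * N)%type.
Proof.
refine (@LieAction L (M * N)%type
  (fun x v => (mod_act M x v.1, mod_act N x v.2)) _ _ _)
  => [v a x y|x a u v|x y v].
- by rewrite /= !act_linl.
- by rewrite /= !linearP.
- by rewrite /= !act_bracket.
Defined.

Definition zero_action : lie_action L 'rV[F]_0.
Proof.
refine (@LieAction L 'rV[F]_0 (fun _ _ => 0) _ _ _) => [v a x y|x a u v|x y v].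
- by rewrite scaler0 addr0.
- by rewrite scaler0 addr0.
- by rewrite subr0.
Defined.

Definition dsum (M N : lieModule L) : lieModule L :=
  LieModule (prod_action M N).
Definition zero_module : lieModule L := LieModule zero_action.

End DirectSum.

Section Dual.
Variables (V : vectType F) (rho : lie_action L V).

(* (x . f)(v) = - f (x . v) *)
Definition dual_fun x (f : 'Hom(V, F^o)) : 'Hom(V, F^o) :=
  (- (f \o linfun (rho x)))%VF.

Lemma dual_funE x f v : dual_fun x f v = - f (rho x v).
Proof. by rewrite opp_lfunE comp_lfunE lfunE. Qed.

Definition dual_action : lie_action L 'Hom(V, F^o).
Proof.
refine (@LieAction L _ dual_fun _ _ _) => [f a x y|x a f g|x y f];
  apply/lfunP => v; rewrite /dual_fun.
- rewrite !(add_lfunE, opp_lfunE, scale_lfunE, comp_lfunE) !lfunE /=.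
  by rewrite act_linl linearP opprD scalerN.
- rewrite !(add_lfunE, opp_lfunE, scale_lfunE, comp_lfunE) !lfunE /=.
  by rewrite opprD scalerN.
- rewrite !(add_lfunE, opp_lfunE, scale_lfunE, comp_lfunE) !lfunE /=.
  by rewrite act_bracket linearB !opprK opprB addrC.
Defined.

End Dual.

Section Tensor.

Section ActionMatrix.
Variables (V : vectType F) (rho : lie_action L V).

Definition action_mx x : 'M[F]_(\dim {:V}) :=
  mxof (vbasis {:V}) (vbasis {:V}) (linfun (rho x)).

Lemma action_mxE x v :
  rVof (vbasis {:V}) (rho x v) = rVof (vbasis {:V}) v *m action_mx x.
Proof. by rewrite -rVof_app ?lfunE //; exact: vbasisP. Qed.

Lemma action_mx_linear : linear action_mx.
Proof.
move=> a x y; rewrite /action_mx -linearP; congr mxof.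
by apply/lfunP => u; rewrite add_lfunE scale_lfunE !lfunE /= act_linl.
Qed.

Lemma action_mx_bracket x y :
  action_mx (bracket x y)
  = action_mx y *m action_mx x - action_mx x *m action_mx y.
Proof.
have bP : basis_of {:V} (vbasis {:V}) by exact: vbasisP.
rewrite /action_mx -!(mxof_comp _ _ bP) -linearB; congr mxof.
apply/lfunP => u; rewrite add_lfunE opp_lfunE !comp_lfunE !lfunE /=.
exact: act_bracket.
Qed.

End ActionMatrix.

Variables V W : vectType F.
Local Notation bV := (vbasis {:V}).
Local Notation bW := (vbasis {:W}).

(* V (x) W is modelled by the matrices of coordinates in the basis
   bV`_i (x) bW`_j. *)
Definition tensor_sort : lmodType F := 'M[F]_(\dim {:V}, \dim {:W}).

Definition tensor (v : V) (w : W) : tensor_sort :=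
  (rVof bV v)^T *m rVof bW w.

Variables (rho : lie_action L V) (sigma : lie_action L W).

Definition tensor_fun x (T : tensor_sort) : tensor_sort :=
  (action_mx rho x)^T *m T + T *m action_mx sigma x.

Lemma tensor_funE x v w :
  tensor_fun x (tensor v w) = tensor (rho x v) w + tensor v (sigma x w).
Proof.
by rewrite /tensor_fun /tensor mulmxA -trmx_mul -mulmxA -!action_mxE.
Qed.

Definition tensor_action : lie_action L tensor_sort.
Proof.
refine (@LieAction L _ tensor_fun _ _ _) => [T a x y|x a T T'|x y T];
  rewrite /tensor_fun.
- rewrite !action_mx_linear linearP /= mulmxDl mulmxDr.
  by rewrite -scalemxAl -scalemxAr scalerDr addrACA.
- rewrite mulmxDl mulmxDr -scalemxAl -scalemxAr.
  by rewrite scalerDr addrACA.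
- rewrite !action_mx_bracket linearB /= !trmx_mul mulmxBl mulmxBr.
  rewrite !mulmxDr !mulmxDl !mulmxA.
  set p := _ *m (action_mx rho y)^T *m T.
  set q := _ *m (action_mx rho x)^T *m T.
  set r := T *m _ *m action_mx sigma x; set s := T *m _ *m action_mx sigma y.
  set e := _ *m T *m action_mx sigma y; set f := _ *m T *m action_mx sigma x.
  have -> : p + e + (f + r) = p + r + (e + f).
    by rewrite [f + r]addrC addrACA.
  have -> : q + f + (e + s) = q + s + (e + f).
    by rewrite [e + s]addrC addrACA [f + e]addrC.
  by rewrite opprD [RHS]addrACA subrr addr0 opprD addrACA.
Defined.

End Tensor.

Section Symmetric.
Variables (V : vectType F) (rho : lie_action L V).
Local Notation d := (\dim {:V}).
Local Notation b := (vbasis {:V}).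

(* S(V) is modelled by the polynomials {mpoly F[d]}, the variable 'X_i standing
   for the basis vector b`_i; sym_inj is the inclusion of V in S(V). *)
Definition sym_inj (v : V) : {mpoly F[d]} := \sum_i coord b i v *: 'X_i.

Fact sym_inj_linear : linear sym_inj.
Proof.
move=> a u v; rewrite /sym_inj scaler_sumr -big_split; apply: eq_bigr => i _.
by rewrite linearP scalerDl scalerA.
Qed.
HB.instance Definition _ :=
  GRing.isLinear.Build F V {mpoly F[d]} _ sym_inj sym_inj_linear.

(* The derivation of S(V) extending rho x, see sym_funM and sym_fun_inj. *)
Definition sym_fun x (p : {mpoly F[d]}) : {mpoly F[d]} :=
  \sum_(i < d) sym_inj (rho x b`_i) * p^`M(i).

Lemma sym_fun_linr x : linear (sym_fun x).
Proof.
move=> a u v; rewrite /sym_fun scaler_sumr -big_split; apply: eq_bigr => i _.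
by rewrite mderivD mderivZ mulrDr -scalerAr.
Qed.

Lemma sym_funM x p q : sym_fun x (p * q) = sym_fun x p * q + p * sym_fun x q.
Proof.
rewrite /sym_fun mulr_suml mulr_sumr -big_split; apply: eq_bigr => i _.
by rewrite /= mderivM mulrDr !mulrA [p * _]mulrC.
Qed.

Lemma sym_inj_mderiv i v : (sym_inj v)^`M(i) = (coord b i v)%:MP.
Proof.
rewrite /sym_inj linear_sum (bigD1 i) //= big1 ?addr0 => [|j ji].
  rewrite mderivZ mderivX mnmE eqxx scale1r.
  by rewrite -[X in (X - _)%MM]add0m addmK mpolyX0 alg_mpolyC.
by rewrite mderivZ mderivX mnmE (negPf ji) scale0r scaler0.
Qed.

Lemma sym_fun_inj x v : sym_fun x (sym_inj v) = sym_inj (rho x v).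
Proof.
rewrite {2}(coord_vbasis (memvf v)) !linear_sum; apply: eq_bigr => i _.
by rewrite sym_inj_mderiv !linearZ mulrC mul_mpolyC.
Qed.

Definition sym_action : lie_action L {mpoly F[d]}.
Proof.
refine (@LieAction L _ sym_fun _ sym_fun_linr _) => [p a x y|x y p].
- rewrite /sym_fun scaler_sumr -big_split; apply: eq_bigr => i _.
  by rewrite act_linl linearP mulrDl scalerAl.
have E u v : sym_fun u (sym_fun v p) =
    \sum_(i < d) sym_inj (rho u (rho v b`_i)) * p^`M(i)
    + \sum_(i < d) \sum_(j < d)
        sym_inj (rho u b`_j) * sym_inj (rho v b`_i) * p^`M(i)^`M(j).
  have S (I : finType) (G : I -> {mpoly F[d]}) :
      sym_fun u (\sum_i G i) = \sum_i sym_fun u (G i).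
    rewrite /sym_fun exchange_big; apply: eq_bigr => i _.
    by rewrite linear_sum mulr_sumr.
  rewrite [sym_fun v p]/sym_fun S -big_split; apply: eq_bigr => i _.
  rewrite sym_funM sym_fun_inj; congr (_ + _).
  by rewrite /sym_fun mulr_sumr; apply: eq_bigr => j _; rewrite mulrCA mulrA.
rewrite !E opprD addrACA [X in _ = _ + X](_ : _ = 0) ?addr0.
  rewrite -sumrB; apply: eq_bigr => i _.
  by rewrite -mulrBl -linearB act_bracket.
apply/eqP; rewrite subr_eq0 exchange_big; apply/eqP.
apply: eq_bigr => i _; apply: eq_bigr => j _.
by rewrite mderiv_comm [X in X * _]mulrC.
Defined.

Lemma sym_inj_homog v : sym_inj v \is 1.-homog.
Proof.
by apply: rpred_sum => i _; apply: rpredZ; rewrite dhomogX /= mdeg1.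
Qed.

Lemma sym_fun_homog x m p : p \is m.-homog -> sym_fun x p \is m.-homog.
Proof.
move=> /dhomogP hp; apply: rpred_sum => i _.
rewrite [p]mpolyE linear_sum mulr_sumr big_seq; apply: rpred_sum => u pu.
rewrite linearZ /= mderivX -!scalerAr; apply: rpredZ.
have [->|ui] := eqVneq (u i) 0%N; first by rewrite scale0r rpred0.
apply: rpredZ; have -> : m = (1 + mdeg (u - U_(i)))%N.
  rewrite -(hp _ pu) /= -[u in LHS](submK (m := U_(i))) ?lep1mP //.
  by rewrite mdegD mdeg1 addnC.
by apply: dhomogM; rewrite ?sym_inj_homog ?dhomogX.
Qed.

Definition in_ideal (W : pred {mpoly F[d]}) : pred {mpoly F[d]} :=
  fun p => `[< exists2 s : seq ({mpoly F[d]} * {mpoly F[d]}),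
    {in s, forall c, c.2 \in W} & p = \sum_(c <- s) c.1 * c.2 >].

Definition ideal_submodule (W : submodule sym_action) : submodule sym_action.
Proof.
refine (@Submodule _ sym_action (in_ideal W) _ _).
- split=> [|a u w].
    by apply/asboolP; exists [::]; rewrite ?big_nil.
  move=> /asboolP[s sW ->] /asboolP[t tW ->]; apply/asboolP.
  exists ([seq (a *: c.1, c.2) | c <- s] ++ t).
    move=> c; rewrite mem_cat => /orP[/mapP[e es ->]|]; last exact: tW.
    exact: (sW e es).
  rewrite big_cat big_map scaler_sumr; congr (_ + _).
  by apply: eq_bigr => c _; rewrite scalerAl.
- move=> x u /asboolP[s sW ->]; apply/asboolP.
  exists ([seq (sym_fun x c.1, c.2) | c <- s]
          ++ [seq (c.1, sym_fun x c.2) | c <- s]).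
    move=> c; rewrite mem_cat => /orP[] /mapP[e es ->]; first exact: (sW e es).
    exact: (@sub_act _ sym_action W x e.2 (sW e es)).
  rewrite big_cat !big_map linear_sum /= -big_split; apply: eq_bigr => c _.
  exact: sym_funM.
Defined.

(* The image of S^m(V) in S(V)/N. *)
Definition in_degree (N : submodule sym_action) (m : nat) :
    pred (quot_sort N) :=
  fun q => `[< exists2 p, p \is m.-homog & q = quot_pi N p >].

Definition degree_submodule (N : submodule sym_action) (m : nat) :
  submodule (quot_action N).
Proof.
refine (@Submodule _ (quot_action N) (@in_degree N m) _ _).
- split=> [|a u w].
    by apply/asboolP; exists 0; rewrite ?linear0 ?rpred0.
  move=> /asboolP[p hp ->] /asboolP[q hq ->]; apply/asboolP.
  by exists (a *: p + q); rewrite ?linearP // rpredD ?rpredZ.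
- move=> x u /asboolP[p hp ->]; apply/asboolP.
  exists (sym_fun x p); first exact: sym_fun_homog.
  exact: quot_funE.
Defined.

End Symmetric.

End Actions.

Section SlModules.
Variable n : nat.

Definition restrict_action (V : lmodType F) (rho : lie_action (gl n) V) :
  lie_action (sl n) V.
Proof.
refine (@LieAction (sl n) V (fun x => rho (vsval x)) _ _ _)
  => [v a x y|x|x y v].
- by rewrite linearP; exact: (@act_linl _ _ rho).
- exact: act_linr.
- by rewrite (sl_bracketE x y); exact: (@act_bracket _ _ rho).
Defined.

Definition is_partition (lam : {ffun 'I_n -> nat}) : bool :=
  [forall i : 'I_n, forall j : 'I_n, (i <= j)%N ==> (lam j <= lam i)%N].

(* The parts of lam : {ffun 'I_n -> 'I_K} are at most K - 1; there is no such
   lam when K = 0 < n. *)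
Definition weight (K : nat) (lam : {ffun 'I_n -> 'I_K}) : {ffun 'I_n -> nat} :=
  [ffun i => lam i : nat].

(* A nonzero vector of weight lam killed by the strictly upper triangular
   matrices generates V as soon as V is irreducible. *)
Definition irreducible_highest_weight (V : lmodType F)
    (rho : lie_action (gl n) V) (lam : {ffun 'I_n -> nat}) : Prop :=
  irreducible rho /\
  exists v : V, [/\ v != 0,
    forall i j : 'I_n, (i < j)%N -> rho (delta_mx i j) v = 0 &
    forall i : 'I_n, rho (delta_mx i i) v = (lam i)%:R *: v].

Definition tensor_dual (V : vectType F) (rho : lie_action (gl n) V) :
    lieModule (sl n) :=
  LieModule (tensor_action (restrict_action rho)
                           (dual_action (restrict_action rho))).

(* The matrix unit E_{1,n}, with indices starting from 0. *)
Definition mx_theta : 'M[F]_n :=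
  \matrix_(i, j) ((i == 0%N :> nat) && (j == n.-1 :> nat))%:R.

Definition e_theta : sl n := vsproj (sl_space n) mx_theta.

Lemma e_thetaE : (1 < n)%N -> vsval e_theta = mx_theta.
Proof.
move=> n1; rewrite vsprojK // mem_sl /mxtrace big1 // => i _.
by rewrite mxE; case: eqP => //= ->; case: (n) n1 => [|[]].
Qed.

Definition V_submodule (k : nat) :
    submodule (sym_action (adjoint_action (sl n))) :=
  U_submodule (sym_action (adjoint_action (sl n))) (sym_inj e_theta ^+ k.+1).

Definition C2_ideal (k : nat) := ideal_submodule (V_submodule k).

Definition C2_algebra (k : nat) : lieModule (sl n) :=
  LieModule (quot_action (C2_ideal k)).

Definition C2_part (k m : nat) : lieModule (sl n) :=
  sub_module (degree_submodule (C2_ideal k) m).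

End SlModules.

End LieAlgebras.

(* Main.v *)
(* Let gl_n x gl_n act by left and right multiplication on the polynomials in
   the entries of an n x n matrix x, with the Fischer inner product, for which
   E_ab and E_ba are adjoint.  The product Delta_lam of powers of leading minors
   generates a copy M_lam of V(lam) (x) V(lam)^*, and distinct M_lam are
   orthogonal.  The operator Theta = \sum v_i w_j d/dx_ij differentiates along
   all rank one matrices v w at once.  A singular vector in the image of a power
   of Theta is determined by its value at a single point, so that the space
   H_K^m of forms p of degree m with Theta^K p = 0 is the sum of the M_lam with
   lam_1 < K and |lam| = m.

   V_{k+1} contains the powers e^{k+1} of all rank one nilpotent e in general
   position, so dually A^m consists of the forms f of degree m on traceless
   matrices whose (k+1)-st derivatives along rank one nilpotent matrices vanish.
   Removing the top power of Theta step by step shows that such an f has a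
   correction F = f + tr E in H_{k+1}^m, and F is unique up to tr H_k^{m-1}.
   Hence A^m is the orthogonal complement of tr H_k^{m-1} in H_{k+1}^m. *)
From HB Require Import structures.
From mathcomp Require Import all_boot all_order all_algebra.
From mathcomp Require Import reals complex.
From mathcomp Require Import boolp mpoly.
From mathcomp Require Import ssrcomplements.
From mathcomp Require Import ring zify.
Require Import Defs.

Set Implicit Arguments.
Unset Strict Implicit.
Unset Printing Implicit Defensive.

Import Order.TTheory GRing.Theory Num.Theory.
Local Open Scope ring_scope.

(** A point is brought to normal form by row and column operations, with v and w adjoined to the
    matrix x as an extra column and an extra row: this is why one value determines a singular
    vector. A monomial that survives at the normal form then gives the whole weight, so neither
    characters nor multiplicity counts enter.

    The descent rests on [Th] tr = q and [Th] q = 0, where q = \sum v_i w_i. Traceless rank one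
    directions are the points of the quadric q = 0. There the top power of [Th] on F vanishes, so it
    is divisible by q, and the quotient is again a top power, taken on some G of one degree less; a
    multiple of tr G then cancels it. Each factor tr costs one power of [Th], whence the pair of
    bounds k and k - 1.

    Irreducible modules are given abstractly, through a highest weight vector. The isomorphism of
    V(lam) (x) V(lam)^* with M_lam is therefore obtained as a graph: the submodule of their direct
    sum generated by the pair of highest weight vectors. All other isomorphisms come from equalities
    between subspaces of one polynomial ring. *)

(** * Polynomials in characteristic zero: induction, chain rule, vanishing *)

Lemma mpoly_ring_ind (F : comNzRingType) N (P : {mpoly F[N]} -> Prop) :
  (forall c, P c%:MP) -> (forall i, P 'X_i) ->
  (forall p q, P p -> P q -> P (p + q)) ->
  (forall p q, P p -> P q -> P (p * q)) -> forall p, P p.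
Proof.
move=> PC PX PD PM; elim/mpolyind=> [|c m p _ _ Pp]; first by rewrite -mpolyC0.
apply: PD => //; rewrite -mul_mpolyC; apply: (PM) => //.
rewrite mpolyXE_id; elim/big_rec: _ => [|i q _ Pq]; first by rewrite -mpolyC1.
apply: (PM) => //; elim: (m i) => [|k IH]; first by rewrite expr0 -mpolyC1.
by rewrite exprS; apply: PM.
Qed.

(** The chain rule for a substitution into a ring with a derivation that kills the scalars. It
    serves for the restriction to a line, with the derivative of univariate polynomials, and for the
    embedding of S(sl), with the operators [der g]. *)
Lemma mmap_chain (F S : comNzRingType) N (f : {rmorphism F -> S})
    (h : 'I_N -> S) (D : {additive S -> S}) :
  (forall a b, D (a * b) = D a * b + a * D b) -> (forall c, D (f c) = 0) ->
  forall p, D (mmap f h p) = \sum_i mmap f h p^`M(i) * D (h i).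
Proof.
move=> DM Df; elim/mpoly_ring_ind=> [c|i|p q IHp IHq|p q IHp IHq].
- by rewrite mmapC Df big1 // => i _; rewrite mderivC mmap0 mul0r.
- rewrite mmapX mmap1U (bigD1 i) //= big1 ?addr0 => [|j ji].
    rewrite mderivX mnm1E eqxx scale1r.
    by rewrite -[X in (X - _)%MM]add0m addmK mpolyX0 rmorph1 mul1r.
  by rewrite mderivX mnm1E eq_sym (negPf ji) scale0r mmap0 mul0r.
- rewrite !raddfD /= IHp IHq -big_split; apply: eq_bigr => i _.
  by rewrite mderivD raddfD mulrDl.
- rewrite rmorphM DM IHp IHq mulr_suml mulr_sumr -big_split.
  apply: eq_bigr => i _; rewrite mderivM rmorphD !rmorphM /= mulrDl.
  by rewrite mulrAC mulrA.
Qed.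

Lemma mpoly_der_ext (F : comNzRingType) N (D E : {mpoly F[N]} -> {mpoly F[N]}) :
  {morph D : p q / p + q} -> {morph E : p q / p + q} ->
  (forall p q, D (p * q) = D p * q + p * D q) ->
  (forall p q, E (p * q) = E p * q + p * E q) ->
  (forall c, D c%:MP = E c%:MP) -> (forall i, D 'X_i = E 'X_i) -> D =1 E.
Proof.
move=> DD ED DM EM DC DX; elim/mpoly_ring_ind=> // p q Hp Hq.
  by rewrite DD ED Hp Hq.
by rewrite DM EM Hp Hq.
Qed.

Section Infinite.
Variable C : numDomainType.

Lemma poly_eq0_off (p : {poly C}) s0 : (forall s, s != s0 -> p.[s] = 0) -> p = 0.
Proof.
move=> p0; apply/eqP; apply: contraT => pn0.
(* These are [size p] distinct roots, one more than the degree, and none of them is [s0]. *)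
pose rs := [seq s0 + i.+1%:R | i <- iota 0 (size p)].
have := @max_poly_roots _ p rs pn0; rewrite size_map size_iota ltnn; apply.
  apply/allP => _ /mapP[i _ ->]; apply/eqP/p0.
  by rewrite -subr_eq0 addrAC subrr add0r pnatr_eq0.
rewrite map_inj_uniq ?iota_uniq // => i j /addrI /eqP.
by rewrite eqr_nat eqSS => /eqP.
Qed.

End Infinite.

Lemma mderivs_eq0 (C : numDomainType) N (p : {mpoly C[N]}) :
  (forall i, p^`M(i) = 0) -> p = (p@_0%MM)%:MP.
Proof.
move=> dp; apply/mpolyP => m; rewrite mcoeffC eq_sym.
have [<-|m0] := eqVneq 0%MM m; first by rewrite mulr1.
rewrite mulr0.
have [i mi] : exists i, m i != 0%N.
  apply/existsP; rewrite -[X in is_true X]negbK negb_exists.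
  apply: contra m0 => /forallP h; apply/eqP/mnmP => i.
  by rewrite mnm0E; apply/esym/eqP; have := h i; rewrite negbK.
have := mcoeff_deriv i (m - U_(i))%MM p; rewrite dp mcoeff0 submK ?lep1mP //.
by move/esym/eqP; rewrite mulrn_eq0 => /eqP.
Qed.

Lemma msize_mderiv (F : nzRingType) N i (p : {mpoly F[N]}) :
  (msize p^`M(i) <= (msize p).-1)%N.
Proof.
rewrite msizeE; apply/bigmax_leqP_seq => m hm _.
have : (m + U_(i))%MM \in msupp p.
  move: hm; rewrite !mcoeff_msupp mcoeff_deriv; apply: contra => /eqP->.
  by rewrite mul0rn.
by move/msize_mdeg_lt; rewrite mdegD mdeg1 addn1; case: (msize p).
Qed.

Section Eval.
Variables (C : numDomainType) (N : nat).
Implicit Types (p : {mpoly C[N]}) (z c : 'I_N -> C).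

Definition mline z c p : {poly C} :=
  mmap (@polyC C) (fun i => (z i)%:P + (c i)%:P * 'X) p.

Lemma mlineE z c p s : (mline z c p).[s] = p.@[fun i => z i + s * c i].
Proof.
elim/mpoly_ring_ind: p => [a|i|p q Hp Hq|p q Hp Hq].
- by rewrite /mline mmapC hornerC mevalC.
- by rewrite /mline mmapX mmap1U mevalXU !hornerE mulrC.
- by rewrite /mline rmorphD mevalD -Hp -Hq hornerD.
- by rewrite /mline rmorphM mevalM -Hp -Hq hornerM.
Qed.

Lemma deriv_mline z c p :
  (mline z c p)^`() = \sum_i (mline z c p^`M(i)) * (c i)%:P.
Proof.
rewrite /mline (@mmap_chain _ _ _ _ _ (@deriv C)).
- apply: eq_bigr => i _; congr (_ * _).
  by rewrite /= derivD derivC add0r derivM derivC mul0r derivX mulr1 add0r.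
- exact: derivM.
- exact: derivC.
Qed.

Lemma mpoly_eval_eq0 p : (forall z, p.@[z] = 0) -> p = 0.
Proof.
have [k] := ubnP (msize p); elim: k p => // k IH p sp p0.
have dp i : p^`M(i) = 0.
  have [pz|pn0] := eqVneq p 0; first by rewrite pz mderiv0.
  apply: IH.
    have : (0 < msize p)%N by rewrite lt0n msize_poly_eq0.
    have := msize_mderiv i p; case: (msize p) sp => //= s ss le _.
    exact: leq_ltn_trans le _.
  move=> z; pose c j : C := (j == i)%:R.
  have l0 : mline z c p = 0.
    by apply: (@poly_eq0_off _ _ 0) => s _; rewrite mlineE p0.
  have := congr1 (fun q => q.[0]) (deriv_mline z c p).
  rewrite l0 deriv0 horner0 horner_sum (bigD1 i) //= big1 => [|j ji].
    rewrite /c eqxx mulr1 addr0 mlineE => /esym; congr (_ = _).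
    by apply: meval_eq => j; rewrite mul0r addr0.
  by rewrite /c (negPf ji) mulr0 horner0.
have := mderivs_eq0 dp; set a := p@_ _ => pa.
by have := p0 (fun=> 0); rewrite pa mevalC => ->; rewrite mpolyC0.
Qed.

End Eval.

(** Subspaces are predicates in [Prop], because those below are given by equations, by generation or
    by existential conditions, in spaces of infinite dimension. *)
Definition subsp (F : fieldType) (M : lmodType F) (W : M -> Prop) :=
  W 0 /\ forall a u v, W u -> W v -> W (a *: u + v).

(** * The Fischer inner product *)

Section Fischer.
Variables (C : numClosedFieldType) (N : nat).
Implicit Types (p q : {mpoly C[N]}) (m : 'X_{1..N}).

Definition mfact m : C := \prod_i (m i)`!%:R.

Lemma mfact_gt0 m : 0 < mfact m.
Proof. by apply: prodr_gt0 => i _; rewrite ltr0n fact_gt0. Qed.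

Lemma mfactS m i : mfact (m + U_(i)) = (m i).+1%:R * mfact m.
Proof.
rewrite /mfact (bigD1 i) // [in RHS](bigD1 i) //= mnmDE mnm1E eqxx addn1 factS.
rewrite natrM -mulrA; congr (_ * (_ * _)); apply: eq_bigr => j ji.
by rewrite mnmDE mnm1E eq_sym (negPf ji) addn0.
Qed.

(* The Fischer inner product: multiplication by 'X_i is adjoint to the i-th
   partial derivative. *)
Definition fis p q : C := \sum_(m <- msupp p) p@_m * (q@_m)^* * mfact m.

Lemma fisE k p q : (msize p <= k)%N ->
  fis p q = \sum_(m : 'X_{1..N < k}) p@_m * (q@_m)^* * mfact m.
Proof.
move=> le_pk; set I : subFinType _ := 'X_{1..N < k}.
rewrite /fis (big_mksub I) ?msupp_uniq //=; first last.
  by move=> x /msize_mdeg_lt /leq_trans; apply.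
rewrite big_rmcond //= => j /memN_msupp_eq0 ->.
by rewrite !mul0r.
Qed.

Lemma fis_is_linear q : linear_for *%R (fis^~ q).
Proof.
move=> a p1 p2.
set k := maxn (msize (a *: p1 + p2)) (maxn (msize p1) (msize p2)).
rewrite !(@fisE k) ?leq_max ?leqnn ?orbT // mulr_sumr -big_split.
apply: eq_bigr => m _; rewrite mcoeffD mcoeffZ !mulrDl; congr (_ + _).
by rewrite !mulrA.
Qed.

Lemma fis_conj p q : (fis p q)^* = fis q p.
Proof.
set k := maxn (msize p) (msize q).
rewrite !(@fisE k) ?leq_max ?leqnn ?orbT // rmorph_sum; apply: eq_bigr => m _.
rewrite !rmorphM /= conjCK [X in X * mfact m]mulrC; congr (_ * _).
by rewrite conj_Creal // realE ltW // mfact_gt0.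
Qed.

Lemma fisDl p1 p2 q : fis (p1 + p2) q = fis p1 q + fis p2 q.
Proof. by have := fis_is_linear q 1 p1 p2; rewrite scale1r mul1r. Qed.

Lemma fis0l q : fis 0 q = 0.
Proof. by rewrite /fis msupp0 big_nil. Qed.

Lemma fisZl a p q : fis (a *: p) q = a * fis p q.
Proof. by have := fis_is_linear q a p 0; rewrite fis0l !addr0. Qed.

Lemma fisNl p q : fis (- p) q = - fis p q.
Proof. by rewrite -scaleN1r fisZl mulN1r. Qed.

Lemma fis_suml (I : Type) (r : seq I) (P : pred I) (G : I -> {mpoly C[N]}) q :
  fis (\sum_(i <- r | P i) G i) q = \sum_(i <- r | P i) fis (G i) q.
Proof.
by elim/big_rec2: _ => [|i x y _ <-]; rewrite ?fis0l ?fisDl.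
Qed.

Lemma fis_sym0 p q : fis p q = 0 -> fis q p = 0.
Proof. by rewrite -(fis_conj p) => ->; rewrite conjC0. Qed.

Lemma fisZr a p q : fis p (a *: q) = a^* * fis p q.
Proof. by rewrite -fis_conj fisZl rmorphM /= fis_conj. Qed.

Lemma fisDr p q1 q2 : fis p (q1 + q2) = fis p q1 + fis p q2.
Proof. by rewrite -fis_conj fisDl rmorphD /= !fis_conj. Qed.

Lemma fis0r p : fis p 0 = 0.
Proof. by rewrite -fis_conj fis0l conjC0. Qed.

Lemma fisNr p q : fis p (- q) = - fis p q.
Proof. by rewrite -fis_conj fisNl rmorphN /= fis_conj. Qed.

Lemma fisBr p q1 q2 : fis p (q1 - q2) = fis p q1 - fis p q2.
Proof. by rewrite fisDr fisNr. Qed.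

Lemma fis_sumr (I : Type) (r : seq I) (P : pred I) (G : I -> {mpoly C[N]}) q :
  fis q (\sum_(i <- r | P i) G i) = \sum_(i <- r | P i) fis q (G i).
Proof.
by elim/big_rec2: _ => [|i x y _ <-]; rewrite ?fis0r ?fisDr.
Qed.

Lemma fis_ge0 p : 0 <= fis p p.
Proof.
by apply: sumr_ge0 => m _; rewrite mulr_ge0 ?mul_conjC_ge0 ?ltW ?mfact_gt0.
Qed.

Lemma fis_eq0 p : fis p p = 0 -> p = 0.
Proof.
move=> /eqP; rewrite /fis psumr_eq0 => [|m _]; last first.
  by rewrite mulr_ge0 ?mul_conjC_ge0 ?ltW ?mfact_gt0.
move=> /allP h; apply/eqP; rewrite -msupp_eq0; case E : msupp => [//|m s].
have /h : m \in msupp p by rewrite E mem_head.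
rewrite /= !mulf_eq0 conjC_eq0 orbb (gt_eqF (mfact_gt0 m)) orbF => /eqP pm.
by have := mcoeff_msupp p m; rewrite E mem_head pm eqxx.
Qed.

Lemma fisX p m : fis 'X_[m] p = (p@_m)^* * mfact m.
Proof. by rewrite /fis msuppX big_seq1 mcoeffX eqxx mul1r. Qed.

Lemma fis_mulX i p q : fis ('X_i * p) q = fis p q^`M(i).
Proof.
rewrite [p]mpolyE mulr_sumr !fis_suml; apply: eq_bigr => m _.
rewrite -scalerAr !fisZl -mpolyXD addmC !fisX mcoeff_deriv mfactS.
by rewrite rmorphMn /= mulrA mulr_natr.
Qed.

(** Gram-Schmidt along a finite list of monomials. The elements of W without the monomial m form a
    subspace W' of codimension at most one in W; an element g with a nonzero coefficient at m,
    corrected by its projection to W', spans the orthogonal complement of W' in W. *)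
Lemma fis_proj_supp (ms : seq 'X_{1..N}) (W : {mpoly C[N]} -> Prop) :
  subsp W -> (forall p, W p -> {subset msupp p <= ms}) ->
  forall p, exists2 w, W w & forall x, W x -> fis x (p - w) = 0.
Proof.
elim: ms W => [|m ms IH] W sW Wms p.
  exists 0; first by case: sW.
  move=> x /Wms; case E : (msupp x) => [|a s] h; last by have := h a (mem_head _ _).
  by rewrite (msuppnil0 E) fis0l.
have [W0 WP] := sW.
pose W' x := W x /\ x@_m = 0.
have sW' : subsp W'.
  split=> [|a x y [Wx x0] [Wy y0]]; first by rewrite /W' mcoeff0.
  by split; [exact: WP | rewrite mcoeffD mcoeffZ x0 y0 mulr0 addr0].
have W's x : W' x -> {subset msupp x <= ms}.
  move=> [Wx x0] m' hm'; have := Wms x Wx m' hm'; rewrite inE => /orP[/eqP E|//].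
  by move: hm'; rewrite mcoeff_msupp E x0 eqxx.
have {}IH := IH W' sW' W's.
case: (pselect (exists2 g, W g & g@_m != 0)) => [[g Wg gm]|noG]; last first.
  have [w [Ww _] hw] := IH p; exists w => // x Wx; apply: hw; split=> //.
  by apply/eqP; apply: contra_notT noG => xm; exists x.
have [w [Ww wm] hw] := IH g; set g' := g - w in hw.
have Wg' : W g' by rewrite /g' addrC -scaleN1r; exact: WP.
have g'm : g'@_m != 0 by rewrite mcoeffB wm subr0.
have g'0 : fis g' g' != 0.
  by apply: contraNneq g'm => /fis_eq0->; rewrite mcoeff0.
have [u [Wu um] hu] := IH p; set p' := p - u in hu.
clearbody g'.
pose c := fis p' g' / fis g' g'.
exists (c *: g' + u); first exact: WP.
have -> : p - (c *: g' + u) = p' - c *: g' by rewrite opprD addrA addrAC.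
clearbody p'; move=> x Wx; set d := x@_m / g'@_m.
have W'x : W' (- d *: g' + x).
  split; first exact: WP.
  by rewrite mcoeffD mcoeffZ mulNr divfK // addrC subrr.
have {1}-> : x = d *: g' + (- d *: g' + x).
  by rewrite scaleNr addrA subrr add0r.
rewrite fisDl fisZl !fisBr !fisZr (hu _ W'x) (hw _ W'x) mulr0 subr0.
by rewrite /c rmorphM fmorphV /= !fis_conj divfK // subrr mulr0 addr0.
Qed.

Lemma fis_proj k (W : {mpoly C[N]} -> Prop) :
  subsp W -> (forall p, W p -> (msize p <= k)%N) ->
  forall p, exists2 w, W w & forall x, W x -> fis x (p - w) = 0.
Proof.
move=> sW Wk; apply: (@fis_proj_supp [seq val m | m : 'X_{1..N < k}]) => //.
move=> p /Wk pk m mp; have mk := leq_trans (msize_mdeg_lt mp) pk.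
by apply/mapP; exists (BMultinom mk) => //; rewrite mem_enum.
Qed.

End Fischer.

Lemma homog_msize (F : nzRingType) N M (p : {mpoly F[N]}) :
  p \is M.-homog -> (msize p <= M.+1)%N.
Proof.
move=> /dhomogP pM; rewrite msizeE; apply/bigmax_leqP_seq => mm /pM /= -> _.
exact: leqnn.
Qed.


Lemma big_option (M : nmodType) (I : finType) (f : option I -> M) :
  \sum_o f o = f None + \sum_i f (Some i).
Proof.
rewrite (bigD1 None) //=; congr (_ + _).
rewrite (reindex_omap Some id) //=; first by apply: eq_bigl => i; rewrite eqxx.
by case.
Qed.

(** * Derivations *)

Section Derivations.
Variables (C : numClosedFieldType) (T : finType).
Local Notation P := {mpoly C[#|T|]}.
Implicit Types (p q : P) (g h : T -> P) (z w : T -> C) (t s : T).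

Definition zv t : P := 'X_(enum_rank t).
Definition dv t p : P := p^`M(enum_rank t).
Definition der g p : P := \sum_t g t * dv t p.
Definition ev z p : C := p.@[fun i => z (enum_val i)].

Lemma poly_ind_zv (S : P -> Prop) :
  (forall c, S c%:MP) -> (forall t, S (zv t)) ->
  (forall p q, S p -> S q -> S (p + q)) ->
  (forall p q, S p -> S q -> S (p * q)) -> forall p, S p.
Proof.
move=> SC SX SD SM; apply: mpoly_ring_ind => // i.
by have := SX (enum_val i); rewrite /zv enum_valK.
Qed.

Lemma dv_z s t : dv s (zv t) = (s == t)%:R.
Proof.
rewrite /dv /zv mderivX mnm1E (inj_eq enum_rank_inj) eq_sym.
case: eqP => [->|_]; last by rewrite scale0r.
by rewrite scale1r -[X in (X - _)%MM]add0m addmK mpolyX0.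
Qed.

Lemma dvC s c : dv s c%:MP = 0. Proof. exact: mderivC. Qed.
Lemma dv1 s : dv s 1 = 0. Proof. by rewrite -mpolyC1 dvC. Qed.
Lemma dvM s p q : dv s (p * q) = dv s p * q + p * dv s q.
Proof. exact: mderivM. Qed.

Fact dv_is_linear t : linear (dv t).
Proof. by move=> a p q; rewrite /dv linearP. Qed.
HB.instance Definition _ t := GRing.isLinear.Build C P P _ (dv t) (dv_is_linear t).

Fact der_is_linear g : linear (der g).
Proof.
move=> a p q; rewrite /der scaler_sumr -big_split; apply: eq_bigr => t _.
by rewrite linearP mulrDr scalerAr.
Qed.
HB.instance Definition _ g := GRing.isLinear.Build C P P _ (der g) (der_is_linear g).

Lemma derD g p q : der g (p + q) = der g p + der g q.
Proof. exact: linearD. Qed.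

Lemma derN g p : der g (- p) = - der g p.
Proof. exact: linearN. Qed.

Lemma derZ g a p : der g (a *: p) = a *: der g p.
Proof. exact: linearZ. Qed.

Lemma der0 g : der g 0 = 0.
Proof. exact: linear0. Qed.

Lemma der_sum g (I : Type) (r : seq I) (S : pred I) (F : I -> P) :
  der g (\sum_(i <- r | S i) F i) = \sum_(i <- r | S i) der g (F i).
Proof. exact: linear_sum. Qed.

Lemma derM g p q : der g (p * q) = der g p * q + p * der g q.
Proof.
rewrite /der mulr_suml mulr_sumr -big_split; apply: eq_bigr => t _.
by rewrite dvM mulrDr !mulrA [p * _]mulrC.
Qed.

Lemma derC g c : der g c%:MP = 0.
Proof. by rewrite /der big1 // => t _; rewrite dvC mulr0. Qed.

Lemma der1 g : der g 1 = 0. Proof. by rewrite -mpolyC1 derC. Qed.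

Lemma der_z g t : der g (zv t) = g t.
Proof.
rewrite /der (bigD1 t) //= big1 ?addr0 => [|s st].
  by rewrite dv_z eqxx mulr1.
by rewrite dv_z (negPf st) mulr0.
Qed.

Lemma derX g p k : der g (p ^+ k.+1) = k.+1%:R * (p ^+ k * der g p).
Proof.
elim: k => [|k IH]; first by rewrite expr0 expr1 !mul1r.
rewrite exprS derM IH exprS -[k.+2%:R]natr1.
by set d := der g p; set X := p ^+ k; ring.
Qed.

Lemma iter_derP g k a p q :
  iter k (der g) (a *: p + q) = a *: iter k (der g) p + iter k (der g) q.
Proof. by elim: k => //= k ->; rewrite derD derZ. Qed.

Lemma iter_der0 g k : iter k (der g) 0 = 0.
Proof. by elim: k => //= k ->; rewrite der0. Qed.

Lemma iter_derD g k p q :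
  iter k (der g) (p + q) = iter k (der g) p + iter k (der g) q.
Proof. by have := iter_derP g k 1 p q; rewrite !scale1r. Qed.

Lemma dvE s : dv s =1 der (fun t => (t == s)%:R).
Proof.
move=> p; rewrite /der (bigD1 s) //= big1 ?addr0 => [|t /negPf->].
  by rewrite eqxx mul1r.
by rewrite mul0r.
Qed.

Lemma eq_der g h : g =1 h -> der g =1 der h.
Proof. by move=> gh p; apply: eq_bigr => t _; rewrite gh. Qed.

Lemma der_ext (D E : P -> P) :
  {morph D : p q / p + q} -> {morph E : p q / p + q} ->
  (forall p q, D (p * q) = D p * q + p * D q) ->
  (forall p q, E (p * q) = E p * q + p * E q) ->
  (forall c, D c%:MP = E c%:MP) -> (forall t, D (zv t) = E (zv t)) -> D =1 E.
Proof.
move=> DD ED DM EM DC DX; apply: mpoly_der_ext => // i.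
by have := DX (enum_val i); rewrite /zv enum_valK.
Qed.

(** A commutator of derivations is a derivation, hence is determined on the variables. The
    commutation relations below reduce to this check. *)
Lemma der_bracket g h k :
  (forall t, der g (h t) - der h (g t) = k t) ->
  forall p, der g (der h p) - der h (der g p) = der k p.
Proof.
move=> ghk; apply: der_ext => [p q|p q|p q|p q|c|t].
- by rewrite !linearD /= addrACA.
- by rewrite linearD.
- by rewrite !(derM, derD); ring.
- exact: derM.
- by rewrite !derC subrr.
- by rewrite !der_z ghk.
Qed.

Lemma der_commute g h : (forall t, der g (h t) = der h (g t)) ->
  forall p, der g (der h p) = der h (der g p).
Proof.
move=> gh p; apply/eqP; rewrite -subr_eq0 (@der_bracket g h (fun=> 0)).
  by rewrite /der big1 // => t _; rewrite mul0r.
by move=> t; rewrite gh subrr.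
Qed.

Lemma iter_comm (A B : P -> P) : (forall p, A (B p) = B (A p)) ->
  forall k p, A (iter k B p) = iter k B (A p).
Proof. by move=> AB; elim=> //= k IH p; rewrite AB IH. Qed.

Lemma ev_z z t : ev z (zv t) = z t.
Proof. by rewrite /ev mevalXU enum_rankK. Qed.
Lemma evM z p q : ev z (p * q) = ev z p * ev z q. Proof. exact: mevalM. Qed.
Lemma evD z p q : ev z (p + q) = ev z p + ev z q. Proof. exact: mevalD. Qed.
Lemma evN z p : ev z (- p) = - ev z p. Proof. exact: mevalN. Qed.
Lemma evZ z a p : ev z (a *: p) = a * ev z p. Proof. exact: mevalZ. Qed.
Lemma ev0 z : ev z 0 = 0. Proof. exact: meval0. Qed.
Lemma ev1 z : ev z 1 = 1. Proof. exact: meval1. Qed.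
Lemma evC z c : ev z c%:MP = c. Proof. exact: mevalC. Qed.
Lemma evX z p k : ev z (p ^+ k) = ev z p ^+ k.
Proof. by elim: k => [|k IH]; rewrite ?ev1 // !exprS evM IH. Qed.
Lemma ev_sum (I : Type) (r : seq I) (S : pred I) (F : I -> P) z :
  ev z (\sum_(i <- r | S i) F i) = \sum_(i <- r | S i) ev z (F i).
Proof. exact: raddf_sum. Qed.

Lemma eq_ev z z' p : z =1 z' -> ev z p = ev z' p.
Proof. by move=> zz; apply: meval_eq => i; rewrite zz. Qed.

Lemma ev_eq0 p : (forall z, ev z p = 0) -> p = 0.
Proof.
move=> p0; apply: mpoly_eval_eq0 => z.
by rewrite -(p0 (fun t => z (enum_rank t))); apply: meval_eq => i; rewrite enum_valK.
Qed.

Lemma ev_der z g p : ev z (der g p) = \sum_t ev z (g t) * ev z (dv t p).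
Proof. by rewrite ev_sum; apply: eq_bigr => t _; rewrite evM. Qed.

Definition line z w p : {poly C} :=
  mline (fun i => z (enum_val i)) (fun i => w (enum_val i)) p.

Lemma lineE z w p (s : C) : (line z w p).[s] = ev (fun t => z t + s * w t) p.
Proof. by rewrite /line mlineE. Qed.

Lemma deriv_line z w g p :
  (forall (s : C) t, ev (fun t => z t + s * w t) (g t) = w t) ->
  (line z w p)^`() = line z w (der g p).
Proof.
move=> gc; apply/eqP; rewrite -subr_eq0; apply/eqP.
apply: (@poly_eq0_off _ _ 1) => s _.
rewrite !hornerE lineE ev_der deriv_mline horner_sum; apply/eqP.
rewrite subr_eq0; apply/eqP.
rewrite (reindex (@enum_rank T)) /=; last by exists enum_val => i _; rewrite ?enum_rankK ?enum_valK.
apply: eq_bigr => t _; rewrite !hornerE mlineE enum_rankK gc mulrC.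
by [].
Qed.

Lemma deriv0_const (p : {poly C}) : p^`() = 0 -> p = (p`_0)%:P.
Proof.
move=> dp; apply/polyP => -[|i]; rewrite coefC //=.
have /eqP : p^`()`_i = 0 by rewrite dp coef0.
by rewrite coef_deriv mulrn_eq0 => /eqP.
Qed.

(** Passage from infinitesimal to global invariance: the line z + s w is an integral curve of
    [der g]. Row and column operations are linear in the parameter, so they move points along such
    lines. *)
Lemma ev_flow z w g p :
  (forall (s : C) t, ev (fun t => z t + s * w t) (g t) = w t) -> der g p = 0 ->
  ev (fun t => z t + w t) p = ev z p.
Proof.
move=> gc gp; have := @deriv_line z w g p gc.
rewrite gp; have -> : line z w 0 = 0.
  by apply: (@poly_eq0_off _ _ 0) => s _; rewrite lineE ev0.
move/deriv0_const => lc.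
have := congr1 (horner^~ 1) lc; have := congr1 (horner^~ 0) lc.
rewrite /= !lineE !hornerC => <- E.
transitivity (ev (fun t => z t + 1 * w t) p); first by apply: eq_ev => t; rewrite mul1r.
by rewrite E; apply: eq_ev => t; rewrite mul0r addr0.
Qed.

(** As a function of the coordinate t alone, p is a univariate polynomial with infinitely many
    zeros. This allows pivots to be assumed nonzero. *)
Lemma ev_perturb z t (s0 : C) p :
  (forall s : C, s != s0 -> ev (fun t' => if t' == t then s else z t') p = 0) ->
  ev z p = 0.
Proof.
move=> p0.
pose l := line (fun t' => if t' == t then 0 else z t') (fun t' => (t' == t)%:R) p.
have lE (s : C) : l.[s] = ev (fun t' => if t' == t then s else z t') p.
  rewrite lineE; apply: eq_ev => t'; case: eqP => _.
    by rewrite add0r mulr1.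
  by rewrite mulr0 addr0.
have l0 : l = 0 by apply: (@poly_eq0_off _ _ s0) => s ss; rewrite lE p0.
transitivity l.[z t]; last by rewrite l0 horner0.
by rewrite lE; apply: eq_ev => t'; case: eqP => // ->.
Qed.

Lemma ev_indep z z' t p : dv t p = 0 -> (forall t', t' != t -> z t' = z' t') ->
  ev z p = ev z' p.
Proof.
move=> dp zz; pose c t' := if t' == t then z' t - z t else 0.
have <- := @ev_flow z c (fun t' => (c t')%:MP) p.
- by apply: eq_ev => t'; rewrite /c; case: eqP => [->|/eqP/zz->]; rewrite ?addr0 // addrC subrK.
- by move=> s t'; rewrite evC.
rewrite /der big1 // => t' _; rewrite /c; case: eqP => [->|_]; first by rewrite dp mulr0.
by rewrite mpolyC0 mul0r.
Qed.

Section Weights.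
Implicit Types S : pred T.

(* The Euler operator of the variables in S: its eigenvalues are the degrees in
   these variables. *)
Definition eulg S t : P := if S t then zv t else 0.
Notation eul S := (der (eulg S)).

Definition wdeg S k p : Prop := eul S p = k%:R *: p.

Lemma mcoeff_zdv t p m : (zv t * dv t p)@_m = (m (enum_rank t))%:R * p@_m.
Proof.
have [m0|m0] := eqVneq (m (enum_rank t)) 0%N.
  rewrite m0 mul0r; apply/eqP; rewrite mcoeff_eq0 /zv mulrC.
  apply/negP => h; have := msuppMX (dv t p) U_(enum_rank t).
  move/perm_mem/(_ m); rewrite h => /esym /mapP[m' _ E].
  by have := m0; rewrite E mnmDE mnm1E eqxx.
rewrite -{1}[m](submK (m := U_(enum_rank t))) ?lep1mP //.
rewrite addmC mulrC mcoeffMX /dv mcoeff_deriv submK ?lep1mP //.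
by rewrite mnmBE mnm1E eqxx subn1 prednK ?lt0n // mulr_natl.
Qed.

Lemma mcoeff_eul S p m :
  (eul S p)@_m = (\sum_(t | S t) m (enum_rank t))%N%:R * p@_m.
Proof.
rewrite /der raddf_sum /= natr_sum mulr_suml [RHS]big_mkcond /=.
apply: eq_bigr => t _; rewrite /eulg; case: (S t); first exact: mcoeff_zdv.
by rewrite mul0r mcoeff0.
Qed.

Lemma wdegP S k p : wdeg S k p <->
  (forall m, m \in msupp p -> (\sum_(t | S t) m (enum_rank t))%N = k).
Proof.
split=> [w m mp|h].
  have := congr1 (mcoeff m) w; rewrite mcoeff_eul mcoeffZ => /mulIf E.
  by apply/eqP; rewrite -(eqr_nat C) E // -mcoeff_msupp.
apply/mpolyP => m; rewrite mcoeff_eul mcoeffZ.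
case: (boolP (m \in msupp p)) => [/h->//|/memN_msupp_eq0->].
by rewrite !mulr0.
Qed.

(** The integrated form of the eigenvalue equation of an Euler operator: every monomial of p has
    degree k in the variables of S. *)
Lemma ev_scale S k z a p : wdeg S k p ->
  ev (fun t => if S t then a * z t else z t) p = a ^+ k * ev z p.
Proof.
move=> /wdegP pk; rewrite /ev !mevalE mulr_sumr big_seq [RHS]big_seq.
apply: eq_bigr => m mp; rewrite [RHS]mulrCA; congr (_ * _).
have -> : a ^+ k = \prod_i (if S (enum_val i) then a ^+ m i else 1).
  rewrite -(pk m mp) -prodrXr big_mkcond (reindex (@enum_val T T)) /=.
    by apply: eq_bigr => i _; rewrite enum_valK.
  by exists (@enum_rank T) => i _; rewrite ?enum_rankK ?enum_valK.
rewrite -big_split; apply: eq_bigr => i _ /=.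
by case: (S _); rewrite ?mul1r // exprMn.
Qed.

Lemma wdeg_subsp S k : subsp (wdeg S k).
Proof.
split=> [|a p q Hp Hq]; first by rewrite /wdeg der0 scaler0.
by rewrite /wdeg derD derZ Hp Hq scalerDr !scalerA mulrC.
Qed.

Lemma wdegM S k l p q : wdeg S k p -> wdeg S l q -> wdeg S (k + l) (p * q).
Proof.
move=> Hp Hq; rewrite /wdeg derM Hp Hq natrD scalerDl.
by rewrite -scalerAl -scalerAr.
Qed.

Lemma wdegT_homog k p : wdeg predT k p <-> p \is k.-homog.
Proof.
have E (m : 'X_{1..#|T|}) :
    (\sum_(t | predT t) m (enum_rank t))%N = mdeg m.
  rewrite mdegE (reindex (@enum_rank T)) //=.
  by exists enum_val => i _; rewrite ?enum_rankK ?enum_valK.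
by rewrite wdegP; split=> [h|/dhomogP h];
  [apply/dhomogP => m /h; rewrite E | move=> m /h; rewrite E].
Qed.

End Weights.

Lemma fis_zv t p q : fis (zv t * p) q = fis p (dv t q).
Proof. exact: fis_mulX. Qed.

Definition ling (A : T -> T -> C) t : P := \sum_s A s t *: zv s.
Definition adjA (A : T -> T -> C) s t := (A t s)^*.

Lemma fis_ling A p q : fis (der (ling A) p) q = fis p (der (ling (adjA A)) q).
Proof.
rewrite /der fis_suml fis_sumr.
have -> : \sum_t fis (ling A t * dv t p) q
          = \sum_t \sum_s A s t * fis (dv t p) (dv s q).
  apply: eq_bigr => t _; rewrite /ling mulr_suml fis_suml.
  by apply: eq_bigr => s _; rewrite -scalerAl fisZl fis_zv.
rewrite exchange_big; apply: eq_bigr => s _.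
rewrite mulr_suml fis_sumr; apply: eq_bigr => t _.
by rewrite -scalerAl fisZr conjCK -[fis p _]fis_conj fis_zv fis_conj.
Qed.

End Derivations.
Notation eul S := (der (eulg _ S)).

(** * The action of gl x gl *)

Section Operators.
Variables (C : numClosedFieldType) (n : nat).

(* The variables x_ij = (Some i, Some j), v_i = (Some i, None) and
   w_j = (None, Some j); the variable (None, None) never occurs. *)
Definition var : finType := (option 'I_n * option 'I_n)%type.
Notation P := {mpoly C[#|var|]}.
Implicit Types (p q : P) (x y : 'M[C]_n) (a b i j : 'I_n) (t : var).

Definition X i j : var := (Some i, Some j).
Definition Vv i : var := (Some i, None).
Definition Ww j : var := (None, Some j).
Definition O0 : var := (None, None).

Lemma varP (Q : var -> Prop) :
  (forall i j, Q (X i j)) -> (forall i, Q (Vv i)) -> (forall j, Q (Ww j)) ->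
  Q O0 -> forall t, Q t.
Proof. by move=> QX QV QW Q0 [[i|] [j|]]; [apply: QX|apply: QV|apply: QW|]. Qed.

Lemma var_sum (M : nmodType) (f : var -> M) :
  \sum_t f t = f O0 + \sum_j f (Ww j) + \sum_i (f (Vv i) + \sum_j f (X i j)).
Proof.
rewrite (eq_bigr (fun t => f (t.1, t.2))) => [|[] //].
rewrite -(pair_bigA _ (fun u v => f (u, v))) big_option /= big_option.
by congr (_ + _); apply: eq_bigr => i _; rewrite big_option.
Qed.

(* The left gl acts on first indices, the right gl acts dually on second ones. *)
Definition LA x (s t : var) : C :=
  if s.2 == t.2 then
    if s.1 is Some a then if t.1 is Some b then x a b else 0 else 0
  else 0.
Definition RA y (s t : var) : C :=
  if s.1 == t.1 then
    if s.2 is Some b then if t.2 is Some a then - y a b else 0 else 0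
  else 0.
Definition Lg x := @ling C var (LA x).
Definition Rg y := @ling C var (RA y).

Lemma sum_fstE (F : option 'I_n -> P) (j : option 'I_n) :
  \sum_(s : var) (if s.2 == j then F s.1 else 0) = \sum_o F o.
Proof.
rewrite (eq_bigr (fun t : var => (fun u v => if v == j then F u else 0) t.1 t.2)) //.
rewrite -(pair_bigA _ (fun u v => if v == j then F u else 0)).
apply: eq_bigr => o _; rewrite (bigD1 j) //= eqxx big1 ?addr0 // => v.
by move/negPf->.
Qed.

Lemma sum_sndE (F : option 'I_n -> P) (i : option 'I_n) :
  \sum_(s : var) (if s.1 == i then F s.2 else 0) = \sum_o F o.
Proof.
rewrite (eq_bigr (fun t : var => (fun u v => if u == i then F v else 0) t.1 t.2)) //.
rewrite -(pair_bigA _ (fun u v => if u == i then F v else 0)).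
rewrite (bigD1 i) //= [X in _ + X]big1 ?addr0 => [|v /negPf vi].
  by apply: eq_bigr => v _; rewrite eqxx.
by apply: big1 => w _; rewrite vi.
Qed.

Lemma Lg_some x b (j : option 'I_n) : Lg x (Some b, j) = \sum_a x a b *: zv C ((Some a, j) : var).
Proof.
rewrite /Lg /ling -[RHS]add0r.
rewrite -(big_option (fun o : option 'I_n => if o is Some a then x a b *: zv C ((o, j) : var) else 0)).
rewrite -(sum_fstE _ j); apply: eq_bigr => -[s1 s2] _ /=; rewrite /LA /=.
by case: eqP => [->|_]; [case: s1 => [a|]|]; rewrite ?scale0r.
Qed.

Lemma Lg_none x (j : option 'I_n) : Lg x (None, j) = 0.
Proof.
rewrite /Lg /ling big1 // => -[s1 s2] _; rewrite /LA /=.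
by case: eqP => [->|_]; [case: s1 => [a|]|]; rewrite ?scale0r.
Qed.

Lemma Rg_some y a (i : option 'I_n) : Rg y (i, Some a) = - \sum_b y a b *: zv C ((i, Some b) : var).
Proof.
rewrite /Rg /ling -[X in - X]add0r.
rewrite -(big_option (fun o : option 'I_n => if o is Some b then y a b *: zv C ((i, o) : var) else 0)).
rewrite -(sum_sndE _ i) -sumrN; apply: eq_bigr => -[s1 s2] _ /=; rewrite /RA /=.
by case: eqP => [->|_]; [case: s2 => [b|]|]; rewrite ?scale0r ?scaleNr ?oppr0.
Qed.

Lemma Rg_none y (i : option 'I_n) : Rg y (i, None) = 0.
Proof.
rewrite /Rg /ling big1 // => -[s1 s2] _; rewrite /RA /=.
by case: eqP => [->|_]; [case: s2 => [a|]|]; rewrite ?scale0r.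
Qed.

Definition mxadj x : 'M[C]_n := map_mx Num.conj x^T.

Lemma fis_L x p q : fis (der (Lg x) p) q = fis p (der (Lg (mxadj x)) q).
Proof.
rewrite fis_ling; congr fis; apply: eq_der => t; apply: eq_bigr => s _.
congr (_ *: _); rewrite /adjA /LA eq_sym; case: eqP => _; last exact: conjC0.
by case: s.1 t.1 => [a|] [b|]; rewrite ?conjC0 // !mxE.
Qed.

Lemma fis_R y p q : fis (der (Rg y) p) q = fis p (der (Rg (mxadj y)) q).
Proof.
rewrite fis_ling; congr fis; apply: eq_der => t; apply: eq_bigr => s _.
congr (_ *: _); rewrite /adjA /RA eq_sym; case: eqP => _; last exact: conjC0.
by case: s.2 t.2 => [a|] [b|]; rewrite ?conjC0 // rmorphN !mxE.
Qed.

Lemma der_lincomb (A B D : var -> var -> C) c p :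
  (forall s t, D s t = c * A s t + B s t) ->
  der (ling D) p = c *: der (ling A) p + der (ling B) p.
Proof.
move=> E; rewrite /der scaler_sumr -big_split; apply: eq_bigr => t _ /=.
rewrite scalerAl -mulrDl; congr (_ * _); rewrite /ling scaler_sumr -big_split.
by apply: eq_bigr => s _ /=; rewrite E scalerDl scalerA.
Qed.

Lemma L_linear c x y p :
  der (Lg (c *: x + y)) p = c *: der (Lg x) p + der (Lg y) p.
Proof.
apply: der_lincomb => -[s1 s2] [t1 t2]; rewrite /LA /=.
case: eqP => _; last by rewrite mulr0 addr0.
by case: s1 t1 => [a|] [b|]; rewrite ?mulr0 ?addr0 // !mxE.
Qed.

Lemma R_linear c x y p :
  der (Rg (c *: x + y)) p = c *: der (Rg x) p + der (Rg y) p.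
Proof.
apply: der_lincomb => -[s1 s2] [t1 t2]; rewrite /RA /=.
case: eqP => _; last by rewrite mulr0 addr0.
by case: s2 t2 => [a|] [b|]; rewrite ?mulr0 ?addr0 // !mxE opprD mulrN.
Qed.

Lemma der_ling_z (g : var -> P) c s : der g (c *: zv C s) = c *: g s.
Proof. by rewrite derZ der_z. Qed.

Lemma L_bracket x y p :
  der (Lg (mxbracket x y)) p
  = der (Lg x) (der (Lg y) p) - der (Lg y) (der (Lg x) p).
Proof.
rewrite (@der_bracket _ _ _ _ (Lg (mxbracket x y))) // => -[[b|] j]; last first.
  by rewrite !Lg_none !der0 subrr.
rewrite !Lg_some !der_sum.
have E (u v : 'M[C]_n) : \sum_a der (Lg u) (v a b *: zv C ((Some a, j) : var))
    = \sum_a (u *m v) a b *: zv C ((Some a, j) : var).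
  under eq_bigr => a _ do rewrite der_ling_z Lg_some scaler_sumr.
  rewrite exchange_big; apply: eq_bigr => c _; rewrite mxE scaler_suml.
  by apply: eq_bigr => a _; rewrite scalerA mulrC.
rewrite !E -sumrB; apply: eq_bigr => a _.
by rewrite -scalerBl !mxE.
Qed.

Lemma R_bracket x y p :
  der (Rg (mxbracket x y)) p
  = der (Rg x) (der (Rg y) p) - der (Rg y) (der (Rg x) p).
Proof.
rewrite (@der_bracket _ _ _ _ (Rg (mxbracket x y))) // => -[i [a|]]; last first.
  by rewrite !Rg_none !der0 subrr.
rewrite !Rg_some !derN !der_sum.
have E (u v : 'M[C]_n) : \sum_b der (Rg u) (v a b *: zv C ((i, Some b) : var))
    = - \sum_b (v *m u) a b *: zv C ((i, Some b) : var).
  under eq_bigr => b _ do rewrite der_ling_z Rg_some scalerN scaler_sumr.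
  rewrite sumrN exchange_big; congr (- _); apply: eq_bigr => c _; rewrite mxE scaler_suml.
  by apply: eq_bigr => b _; rewrite scalerA.
rewrite !E !opprK -sumrB -sumrN; apply: eq_bigr => b _.
by rewrite -scalerBl -scaleNr !mxE opprB.
Qed.

Lemma LR_comm x y p : der (Lg x) (der (Rg y) p) = der (Rg y) (der (Lg x) p).
Proof.
apply: der_commute => -[[b|] [a|]]; rewrite ?Lg_none ?Rg_none ?der0 //.
- rewrite Lg_some Rg_some derN !der_sum.
  under eq_bigr => c _ do rewrite der_ling_z Lg_some scaler_sumr.
  rewrite exchange_big /= -sumrN; apply: eq_bigr => c _.
  rewrite der_ling_z Rg_some scalerN scaler_sumr; congr (- _).
  by apply: eq_bigr => d _; rewrite !scalerA mulrC.
- rewrite Lg_some der_sum big1 // => c _; by rewrite der_ling_z Rg_none scaler0.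
- rewrite Rg_some derN der_sum big1 ?oppr0 // => c _.
  by rewrite der_ling_z Lg_none scaler0.
Qed.

(* Th = \sum v_i w_j d/dx_ij; specializing v and w, its N-th power computes
   the N-th derivatives along rank one matrices. *)
Definition thg t : P :=
  if t is (Some i, Some j) then zv C (Vv i) * zv C (Ww j) else 0.
(** [der (ag j)] is the commutator of d/dw_j with [Th], and [der (bg i)] that of d/dv_i. Their flows
    add multiples of v to column j of x, and of w to row i. *)
Definition ag j t : P :=
  if t is (Some i, Some j') then (j' == j)%:R *: zv C (Vv i) else 0.
Definition bg i t : P :=
  if t is (Some i', Some j) then (i' == i)%:R *: zv C (Ww j) else 0.
Definition cg (c : 'M[C]_n) t : P :=
  if t is (Some i, Some j) then (c i j)%:MP else 0.
Notation Th := (der thg).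

Lemma L_Th x p : der (Lg x) (Th p) = Th (der (Lg x) p).
Proof.
apply: der_commute => -[[b|] [a|]]; rewrite /= ?Lg_none ?der0 //.
- rewrite derM !der_z /Vv /Ww Lg_none mulr0 addr0 !Lg_some der_sum mulr_suml.
  by apply: eq_bigr => c _; rewrite der_ling_z scalerAl.
- by rewrite Lg_some der_sum big1 // => c _; rewrite der_ling_z scaler0.
Qed.

Lemma R_Th y p : der (Rg y) (Th p) = Th (der (Rg y) p).
Proof.
apply: der_commute => -[[b|] [a|]]; rewrite /= ?Rg_none ?der0 //.
- rewrite derM !der_z /Vv /Ww Rg_none mul0r add0r !Rg_some.
  rewrite -![- \sum_b _]scaleN1r derZ -scalerAr; congr (_ *: _).
  rewrite der_sum mulr_sumr.
  by apply: eq_bigr => c _; rewrite der_ling_z scalerAr.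
- rewrite Rg_some derN der_sum big1 ?oppr0 // => c _.
  by rewrite der_ling_z scaler0.
Qed.

Lemma cg_Th c p : der (cg c) (Th p) = Th (der (cg c) p).
Proof.
apply: der_commute => -[[b|] [a|]]; rewrite /= ?der0 //.
by rewrite derM !der_z /= mul0r mulr0 addr0 derC.
Qed.

Lemma a_Th j p : der (ag j) (Th p) = Th (der (ag j) p).
Proof.
apply: der_commute => -[[b|] [a|]]; rewrite /= ?der0 //.
by rewrite derM !der_z /= mul0r mulr0 addr0 der_ling_z scaler0.
Qed.

Lemma b_Th i p : der (bg i) (Th p) = Th (der (bg i) p).
Proof.
apply: der_commute => -[[b|] [a|]]; rewrite /= ?der0 //.
by rewrite derM !der_z /= mul0r mulr0 addr0 der_ling_z scaler0.
Qed.

Lemma der_nat (g : var -> P) k : der g k%:R = 0.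
Proof. by rewrite -mpolyC_nat derC. Qed.

Lemma dw_Th j p : dv (Ww j) (Th p) = Th (dv (Ww j) p) + der (ag j) p.
Proof.
apply/eqP; rewrite addrC -subr_eq; apply/eqP.
rewrite !dvE; apply: der_bracket => -[[b|] [a|]];
  rewrite /= ?der0 ?der_nat ?subr0 //.
rewrite derM !der_z !xpair_eqE /= mul0r add0r mulrC.
by rewrite -mpolyC_nat mul_mpolyC.
Qed.

Lemma dv_Th i p : dv (Vv i) (Th p) = Th (dv (Vv i) p) + der (bg i) p.
Proof.
apply/eqP; rewrite addrC -subr_eq; apply/eqP.
rewrite !dvE; apply: der_bracket => -[[b|] [a|]];
  rewrite /= ?der0 ?der_nat ?subr0 //.
rewrite derM !der_z !xpair_eqE /= mulr0 addr0 andbT.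
by rewrite -mpolyC_nat mul_mpolyC.
Qed.

Lemma d0_Th p : dv O0 (Th p) = Th (dv O0 p).
Proof.
rewrite !dvE; apply: der_commute => -[[b|] [a|]]; rewrite /= ?der0 ?der_nat //.
by rewrite derM !der_z !xpair_eqE /= mul0r mulr0 addr0.
Qed.

Lemma L_a x j p : der (Lg x) (der (ag j) p) = der (ag j) (der (Lg x) p).
Proof.
apply: der_commute => -[[b|] [a|]]; rewrite /= ?Lg_none ?der0 //.
- rewrite der_ling_z !Lg_some der_sum scaler_sumr.
  by apply: eq_bigr => c _; rewrite der_ling_z /= !scalerA mulrC.
- by rewrite Lg_some der_sum big1 // => c _; rewrite der_ling_z scaler0.
Qed.

Lemma R_b y i p : der (Rg y) (der (bg i) p) = der (bg i) (der (Rg y) p).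
Proof.
apply: der_commute => -[[b|] [a|]]; rewrite /= ?Rg_none ?der0 //.
- rewrite der_ling_z !Rg_some -![- \sum_b _]scaleN1r derZ scalerA mulrC -scalerA.
  congr (_ *: _); rewrite der_sum scaler_sumr.
  by apply: eq_bigr => c _; rewrite der_ling_z /= !scalerA mulrC.
- rewrite Rg_some derN der_sum big1 ?oppr0 // => c _.
  by rewrite der_ling_z scaler0.
Qed.

Lemma der_sumg (I : finType) (k : I -> C) (G : I -> var -> P) p :
  \sum_i k i *: der (G i) p = der (fun t => \sum_i k i *: G i t) p.
Proof.
rewrite /der; under eq_bigr => i _ do rewrite scaler_sumr.
rewrite exchange_big; apply: eq_bigr => t _; rewrite mulr_suml.
by apply: eq_bigr => i _; rewrite scalerAl.
Qed.

Lemma R_a y j p : der (Rg y) (der (ag j) p)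
  = der (ag j) (der (Rg y) p) + \sum_j' y j' j *: der (ag j') p.
Proof.
apply/eqP; rewrite addrC -subr_eq; apply/eqP; rewrite der_sumg.
apply: der_bracket => -[[b|] [a|]]; rewrite /= ?Rg_none ?der0 ?sub0r.
- rewrite der_ling_z Rg_none scaler0 sub0r Rg_some derN opprK.
  rewrite der_sum (bigD1 j) //= [RHS](bigD1 a) //=.
  rewrite der_ling_z /= !eqxx !scale1r !big1 ?addr0 // => c /negPf nc.
    by rewrite eq_sym nc scale0r scaler0.
  by rewrite der_ling_z /= nc scale0r scaler0.
- by rewrite oppr0 big1 // => c _; rewrite scaler0.
- rewrite Rg_some derN opprK der_sum !big1 // => c _.
    by rewrite scaler0.
  by rewrite der_ling_z scaler0.
- by rewrite oppr0 big1 // => c _; rewrite scaler0.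
Qed.

Lemma L_b x i p : der (Lg x) (der (bg i) p)
  = der (bg i) (der (Lg x) p) - \sum_i' x i i' *: der (bg i') p.
Proof.
apply/eqP; rewrite addrC -subr_eq; apply/eqP; rewrite der_sumg.
have -> : - der (fun t => \sum_i0 x i i0 *: bg i0 t) p
    = der (fun t => - \sum_i0 x i i0 *: bg i0 t) p.
  by rewrite /der -sumrN; apply: eq_bigr => t _; rewrite mulNr.
apply: der_bracket => -[[b|] [a|]]; rewrite /= ?Lg_none ?der0 ?sub0r.
- rewrite der_ling_z Lg_none scaler0 sub0r Lg_some.
  rewrite der_sum (bigD1 i) //= [in RHS](bigD1 b) //=.
  rewrite der_ling_z /= !eqxx !scale1r !big1 ?addr0 // => c /negPf nc.
    by rewrite eq_sym nc scale0r scaler0.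
  by rewrite der_ling_z /= nc scale0r scaler0.
- rewrite Lg_some der_sum !big1 // => c _; first by rewrite scaler0.
  by rewrite der_ling_z scaler0.
- by rewrite big1 // => c _; rewrite scaler0.
- by rewrite big1 // => c _; rewrite scaler0.
Qed.

Lemma d0_L x p : dv O0 (der (Lg x) p) = der (Lg x) (dv O0 p).
Proof.
rewrite !dvE; apply: der_commute => -[[b|] a]; rewrite ?Lg_none /= ?der_nat ?der0 //.
rewrite Lg_some der_sum big1 // => c _.
by rewrite der_ling_z xpair_eqE scaler0.
Qed.

Lemma d0_R y p : dv O0 (der (Rg y) p) = der (Rg y) (dv O0 p).
Proof.
rewrite !dvE; apply: der_commute => -[b [a|]]; rewrite ?Rg_none /= ?der_nat ?der0 //.
rewrite Rg_some derN der_sum big1 ?oppr0 // => c _.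
by rewrite der_ling_z xpair_eqE andbF scaler0.
Qed.

Lemma eul_ling (S : pred var) (A : var -> var -> C) p :
  (forall s t, A s t != 0 -> S s = S t) ->
  eul S (der (ling A) p) = der (ling A) (eul S p).
Proof.
move=> AS; apply: der_commute => t; rewrite /ling der_sum /eulg.
have [St|St] := boolP (S t).
  rewrite der_z; apply: eq_bigr => s _; rewrite der_ling_z.
  by have [->|/AS->] := eqVneq (A s t) 0; rewrite ?scale0r // St.
rewrite der0 big1 // => s _; rewrite der_ling_z.
by have [->|/AS->] := eqVneq (A s t) 0; rewrite ?scale0r // (negPf St) scaler0.
Qed.

Lemma eul_L (S : pred var) x p :
  (forall a b o, S (Some a, o) = S (Some b, o)) ->
  eul S (der (Lg x) p) = der (Lg x) (eul S p).
Proof.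
move=> SS; apply: eul_ling => -[s1 s2] [t1 t2]; rewrite /LA /=.
by case: (s2 =P t2) => [->|_]; [case: s1 t1 => [a|] [b|]|]; rewrite ?eqxx.
Qed.

Lemma eul_R (S : pred var) x p :
  (forall a b o, S (o, Some a) = S (o, Some b)) ->
  eul S (der (Rg x) p) = der (Rg x) (eul S p).
Proof.
move=> SS; apply: eul_ling => -[s1 s2] [t1 t2]; rewrite /RA /=.
by case: (s1 =P t1) => [->|_]; [case: s2 t2 => [a|] [b|]|]; rewrite ?eqxx.
Qed.

Lemma eulgE (S : pred var) t : eulg C S t = (S t)%:R *: zv C t.
Proof. by rewrite /eulg; case: (S t); rewrite ?scale1r ?scale0r. Qed.

Lemma wdeg_Th (S : pred var) c k p :
  (forall i j, (S (Vv i) + S (Ww j) = S (X i j) + c)%N) ->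
  wdeg S k p -> wdeg S (k + c) (Th p).
Proof.
move=> Sc pk; rewrite /wdeg natrD scalerDl -derZ -pk.
apply/eqP; rewrite addrC -subr_eq; apply/eqP.
have -> : c%:R *: Th p = der (fun t => c%:R *: thg t) p.
  by rewrite /der scaler_sumr; apply: eq_bigr => t _; rewrite scalerAl.
apply: der_bracket => -[[i|] [j|]]; rewrite eulgE derZ /= ?der0 ?der_z /= ?scaler0 ?subr0 //.
rewrite derM !der_z !eulgE -scalerAr -scalerAl -scalerDl -natrD Sc natrD scalerDl.
by rewrite addrAC subrr add0r.
Qed.

Definition vS : pred var := [pred t | (t.1 != None) && (t.2 == None)].
Definition wS : pred var := [pred t | (t.1 == None) && (t.2 != None)].
Definition rS a : pred var := [pred t | t.1 == Some a].
Definition cS b : pred var := [pred t | t.2 == Some b].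

Lemma rSE a p : eul (rS a) p = der (Lg (delta_mx a a)) p.
Proof.
apply: eq_der => -[[b|] j]; rewrite eulgE /= ?Lg_none ?scale0r //.
rewrite Lg_some (bigD1 a) //= big1 ?addr0 => [|c /negPf ca].
  rewrite !mxE eqxx (_ : rS a _ = (b == a)) //=.
  by case: eqP => [->|_] //; rewrite !scale0r.
by rewrite !mxE ca scale0r.
Qed.

Lemma cSE a p : eul (cS a) p = - der (Rg (delta_mx a a)) p.
Proof.
rewrite /der -sumrN; apply: eq_bigr => -[i [b|]] _; rewrite eulgE -mulNr /= ?Rg_none ?oppr0 ?scale0r //.
rewrite Rg_some opprK (bigD1 a) //= big1 ?addr0 => [|c /negPf ca].
  rewrite !mxE eqxx andbT (_ : cS a _ = (b == a)) //=.
  by case: eqP => [->|_] //; rewrite !scale0r.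
by rewrite !mxE ca andbF scale0r.
Qed.

(** These equations hold for [iter N Th p] when p involves x only and [iter N.+1 Th p] is zero.
    Conversely, by [Dn_generated], a homogeneous solution of degree at least N has this shape. *)
Definition Dn N p := [/\ dv O0 p = 0, forall j, der (ag j) p = 0,
  forall i, der (bg i) p = 0, wdeg vS N p & wdeg wS N p].

Lemma Dn_subsp N : subsp (Dn N).
Proof.
split=> [|c p q [p1 p2 p3 p4 p5] [q1 q2 q3 q4 q5]].
  by split=> *; rewrite /wdeg ?linear0 ?scaler0 ?der0.
split=> [|j|i||]; rewrite ?linearP /= ?p1 ?q1 ?p2 ?q2 ?p3 ?q3 ?scaler0 ?addr0 //.
  by case: (wdeg_subsp C vS N) => _ h; apply: h.
by case: (wdeg_subsp C wS N) => _ h; apply: h.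
Qed.

Lemma Dn_L N x p : Dn N p -> Dn N (der (Lg x) p).
Proof.
case=> p1 p2 p3 p4 p5; split=> [|j|i||].
- by rewrite d0_L p1 der0.
- by rewrite -L_a p2 der0.
- have /esym/eqP := L_b x i p; rewrite p3 der0 subr_eq0 => /eqP ->.
  by rewrite big1 // => c _; rewrite p3 scaler0.
- by rewrite /wdeg eul_L // p4 derZ.
- by rewrite /wdeg eul_L // p5 derZ.
Qed.

Lemma Dn_R N x p : Dn N p -> Dn N (der (Rg x) p).
Proof.
case=> p1 p2 p3 p4 p5; split=> [|j|i||].
- by rewrite d0_R p1 der0.
- have /esym/eqP := R_a x j p; rewrite p2 der0 addr_eq0 => /eqP ->.
  by rewrite big1 ?oppr0 // => c _; rewrite p2 scaler0.
- by rewrite -R_b p3 der0.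
- by rewrite /wdeg eul_R // p4 derZ.
- by rewrite /wdeg eul_R // p5 derZ.
Qed.

Definition XO p := [/\ dv O0 p = 0, forall i, dv (Vv i) p = 0
  & forall j, dv (Ww j) p = 0].

(** The commutator of d/dw_j with [Th] commutes with [Th], so the N.+1 places at which it can occur
    contribute equally. *)
Lemma dw_iterTh N j p : dv (Ww j) p = 0 ->
  dv (Ww j) (iter N.+1 Th p) = N.+1%:R *: iter N Th (der (ag j) p).
Proof.
move=> pj; elim: N => [|N IH]; first by rewrite /= dw_Th pj der0 add0r scale1r.
rewrite iterS dw_Th IH derZ (iter_comm (@a_Th j)) -iterS.
by rewrite -[N.+2%:R]natr1 scalerDl scale1r.
Qed.

Lemma dv_iterTh N i p : dv (Vv i) p = 0 ->
  dv (Vv i) (iter N.+1 Th p) = N.+1%:R *: iter N Th (der (bg i) p).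
Proof.
move=> pj; elim: N => [|N IH]; first by rewrite /= dv_Th pj der0 add0r scale1r.
rewrite iterS dv_Th IH derZ (iter_comm (@b_Th i)) -iterS.
by rewrite -[N.+2%:R]natr1 scalerDl scale1r.
Qed.

Lemma wdeg_iterTh (S : pred var) c k N p :
  (forall i j, (S (Vv i) + S (Ww j) = S (X i j) + c)%N) ->
  wdeg S k p -> wdeg S (k + N * c) (iter N Th p).
Proof.
move=> Sc pk; elim: N => [|N IH]; first by rewrite addn0.
by rewrite iterS mulSn addnCA addnC; apply: wdeg_Th.
Qed.

Lemma XO_wdeg (S : pred var) p : (forall i j, ~~ S (X i j)) -> XO p -> wdeg S 0 p.
Proof.
move=> SX [p0 pv pw]; rewrite /wdeg scale0r /der big1 // => t _; rewrite /eulg.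
elim/varP: t => [i j|i|j|]; rewrite ?p0 ?pv ?pw ?mulr0 //.
by rewrite (negPf (SX i j)) mul0r.
Qed.

(** Differentiating [iter N.+1 Th p = 0] in w_j leaves N.+1 times [iter N Th (der (ag j) p)], and
    likewise for v_i. The degrees in v and in w are N because each [Th] contributes one to
    either. *)
Lemma Th_Dn N p : XO p -> iter N.+1 Th p = 0 -> Dn N (iter N Th p).
Proof.
move=> Xp ThN; have [p0 pv pw] := Xp; split=> [|j|i||].
- by rewrite (iter_comm d0_Th) p0 iter_der0.
- have /eqP := dw_iterTh N (pw j); rewrite ThN linear0 eq_sym scaler_eq0 pnatr_eq0 /=.
  by rewrite -(iter_comm (@a_Th j)) => /eqP.
- have /eqP := dv_iterTh N (pv i); rewrite ThN linear0 eq_sym scaler_eq0 pnatr_eq0 /=.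
  by rewrite -(iter_comm (@b_Th i)) => /eqP.
- rewrite -[N in wdeg _ N]muln1 -[(N * 1)%N]add0n; apply: wdeg_iterTh => //.
  exact: XO_wdeg.
- rewrite -[N in wdeg _ N]muln1 -[(N * 1)%N]add0n; apply: wdeg_iterTh => //.
  exact: XO_wdeg.
Qed.

(** At the point z the coefficients of [Th] take the values of the constant direction c = v w. Since
    [der (cg c)] commutes with [Th], the factors can be exchanged one at a time. *)
Lemma ev_iterTh z (c : 'M[C]_n) k p : (forall i j, c i j = z (Vv i) * z (Ww j)) ->
  ev z (iter k Th p) = ev z (iter k (der (cg c)) p).
Proof.
move=> zc; have one q : ev z (Th q) = ev z (der (cg c) q).
  rewrite !ev_der; apply: eq_bigr => -[[i|] [j|]] _ //=.
  by rewrite evM !ev_z evC zc.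
elim: k p => //= k IH p; rewrite one (iter_comm (@cg_Th c)) IH -iterSr //.
Qed.

End Operators.
Notation Th := (der (@thg _ _)).

(** * Singular vectors *)

Section Points.
Variables (C : numClosedFieldType) (n : nat).
Notation P := {mpoly C[#|var n|]}.
Notation var := (var n).
Implicit Types (p q d : P) (a b i j r : 'I_n) (z : var -> C) (c : 'I_n -> C).
Notation L a b := (der (Lg (@delta_mx C n n a b))).
Notation R a b := (der (Rg (@delta_mx C n n a b))).

Lemma Lg_delta a b (t : var) : Lg (@delta_mx C n n a b) t =
  if t.1 is Some b' then (b' == b)%:R *: zv C ((Some a, t.2) : var) else 0.
Proof.
case: t => [[b'|] o]; last exact: Lg_none.
rewrite Lg_some (bigD1 a) //= big1 ?addr0 => [|e /negPf ea].
  by rewrite mxE eqxx.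
by rewrite mxE ea scale0r.
Qed.

Lemma Rg_delta a b (t : var) : Rg (@delta_mx C n n a b) t =
  if t.2 is Some a' then - ((a' == a)%:R *: zv C ((t.1, Some b) : var)) else 0.
Proof.
case: t => [o [a'|]]; last exact: Rg_none.
rewrite Rg_some (bigD1 b) //= big1 ?addr0 => [|e /negPf ea].
  by rewrite mxE eqxx andbT.
by rewrite mxE ea andbF scale0r.
Qed.

Lemma ev_row r c z d : (forall b, (r < b)%N -> L r b d = 0) ->
  ev (fun t => if t.1 is Some b then
        z t + (if (r < b)%N then c b * z (Some r, t.2) else 0) else z t) d
  = ev z d.
Proof.
move=> Ld; pose k b := if (r < b)%N then c b else 0.
pose w (t : var) := if t.1 is Some b then k b * z (Some r, t.2) else 0.
rewrite -(@ev_flow _ _ z w (fun t => \sum_b k b *: Lg (@delta_mx C n n r b) t)).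
- apply: eq_ev => -[[b|] o]; rewrite /w ?addr0 //= /k.
  by case: ifP; rewrite // mul0r.
- move=> s [[b|] o]; rewrite /w /=; last first.
    by rewrite ev_sum big1 // => b _; rewrite evZ Lg_delta ev0 mulr0.
  rewrite ev_sum (bigD1 b) //= big1 => [|b' /negPf bb].
    by rewrite evZ Lg_delta /= eqxx scale1r ev_z /= {2}/k ltnn !mul0r mulr0 !addr0.
  by rewrite evZ Lg_delta /= eq_sym bb scale0r ev0 mulr0.
- rewrite -der_sumg big1 // => b _; rewrite /k; case: ifP => [/Ld->|_].
    by rewrite scaler0.
  by rewrite scale0r.
Qed.

Lemma ev_col r c z d : (forall a, (r < a)%N -> R a r d = 0) ->
  ev (fun t => if t.2 is Some a then
        z t + (if (r < a)%N then c a * z (t.1, Some r) else 0) else z t) d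
  = ev z d.
Proof.
move=> Rd; pose k b := if (r < b)%N then c b else 0.
pose w (t : var) := if t.2 is Some b then k b * z (t.1, Some r) else 0.
rewrite -(@ev_flow _ _ z w (fun t => \sum_b - k b *: Rg (@delta_mx C n n b r) t)).
- apply: eq_ev => -[o [b|]]; rewrite /w ?addr0 //= /k.
  by case: ifP; rewrite // mul0r.
- move=> s [o [b|]]; rewrite /w /=; last first.
    by rewrite ev_sum big1 // => b _; rewrite evZ Rg_delta ev0 mulr0.
  rewrite ev_sum (bigD1 b) //= big1 => [|b' /negPf bb].
    rewrite evZ Rg_delta /= eqxx scale1r evN ev_z /= {2}/k ltnn !mul0r mulr0 !addr0.
    by rewrite mulrNN.
  by rewrite evZ Rg_delta /= eq_sym bb scale0r oppr0 ev0 mulr0.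
- rewrite -der_sumg big1 // => b _; rewrite /k; case: ifP => [/Rd->|_].
    by rewrite scaler0.
  by rewrite oppr0 scale0r.
Qed.

Lemma ev_ag c z d : (forall j, der (ag C j) d = 0) ->
  ev (fun t => if t is (Some i, Some j) then z t + c j * z (Vv i) else z t) d
  = ev z d.
Proof.
move=> Ad.
pose w (t : var) := if t is (Some i, Some j) then c j * z (Vv i) else 0.
rewrite -(@ev_flow _ _ z w (fun t => \sum_j c j *: ag C j t)).
- by apply: eq_ev => -[[i|] [j|]]; rewrite /w ?addr0.
- move=> s [[i|] [j|]]; rewrite /w ev_sum;
    try by rewrite big1 // => e _; rewrite evZ ev0 mulr0.
  rewrite (bigD1 j) //= big1 => [|e /negPf ej].
    by rewrite !evZ eqxx ev_z /= mulr0 !addr0 mul1r.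
  by rewrite !evZ eq_sym ej mul0r mulr0.
- by rewrite -der_sumg big1 // => b _; rewrite Ad scaler0.
Qed.

Lemma ev_bg c z d : (forall i, der (bg C i) d = 0) ->
  ev (fun t => if t is (Some i, Some j) then z t + c i * z (Ww j) else z t) d
  = ev z d.
Proof.
move=> Ad.
pose w (t : var) := if t is (Some i, Some j) then c i * z (Ww j) else 0.
rewrite -(@ev_flow _ _ z w (fun t => \sum_j c j *: bg C j t)).
- by apply: eq_ev => -[[i|] [j|]]; rewrite /w ?addr0.
- move=> s [[i|] [j|]]; rewrite /w ev_sum;
    try by rewrite big1 // => e _; rewrite evZ ev0 mulr0.
  rewrite (bigD1 i) //= big1 => [|e /negPf ej].
    by rewrite !evZ eqxx ev_z /= mulr0 !addr0 mul1r.
  by rewrite !evZ eq_sym ej mul0r mulr0.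
- by rewrite -der_sumg big1 // => b _; rewrite Ad scaler0.
Qed.

(* Killed by the raising operators of gl x gl for the Borel subalgebra
   "upper triangular on the left, lower triangular on the right". *)
Definition sing d := (forall a b, (a < b)%N -> L a b d = 0) /\
  (forall a b, (b < a)%N -> R a b d = 0).

Definition wt (f g : 'I_n -> nat) d :=
  (forall a, wdeg (rS a) (f a) d) /\ (forall a, wdeg (cS a) (g a) d).

End Points.

(** * A singular vector is determined by its value at [zst] *)

Section Uniqueness.
Variables (C : numClosedFieldType) (m : nat).
Notation n := m.+1.
Notation P := {mpoly C[#|var n|]}.
Implicit Types (p q d : P) (z : var n -> C).

(* At zst the matrix x is diag(0, 1, ..., 1) and v, w are the first basis
   vectors. *)
Definition zst (t : var n) : C :=
  match t with
  | (Some i, Some j) => ((i == j) && (i != ord0))%:R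
  | (Some i, None) | (None, Some i) => (i == ord0)%:R
  | _ => 0
  end.

(** The value 0 at [None] puts the entries of v and w into [low r] as soon as r is positive. *)
Definition oi (o : option 'I_n) : nat := if o is Some i then i else 0.
Definition low r (t : var n) := (oi t.1 < r)%N || (oi t.2 < r)%N.

Lemma zst_row r (i : 'I_n) o : (0 < r)%N -> i = r :> nat -> (oi o < r)%N ->
  zst (Some i, o) = 0.
Proof.
move=> r0 ir; case: o => [j|] /= jr.
  have /negPf-> // : i != j by apply: contraTneq jr => <-; rewrite ir ltnn.
have /negPf-> // : i != ord0 by rewrite -val_eqE /= ir -lt0n.
Qed.

Lemma zst_col r (i : 'I_n) o : (0 < r)%N -> i = r :> nat -> (oi o < r)%N ->
  zst (o, Some i) = 0.
Proof.
move=> r0 ir; case: o => [j|] /= jr.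
  have /negPf-> // : j != i by apply: contraTneq jr => ->; rewrite ir ltnn.
have /negPf-> // : i != ord0 by rewrite -val_eqE /= ir -lt0n.
Qed.

(** One step of Gaussian elimination with pivot x_rr, the earlier rows and columns being already
    those of [zst]. Row operations clear the column below the pivot, column operations clear its
    row, and rescaling the row makes the pivot 1. The value of d changes at most by a nonzero
    factor, in the rescaling. *)
Lemma sing_step f g d r : sing d -> wt f g d -> (0 < r < n)%N ->
  (forall z, (forall t, low r.+1 t -> z t = zst t) -> ev z d = 0) ->
  forall z, (forall t, low r t -> z t = zst t) -> ev z d = 0.
Proof.
move=> [Ld Rd] [fd gd] /andP[r0 rn] IH z zr; pose i := Ordinal rn.
have lowii : ~~ low r (X i i) by rewrite /low /= ltnn.
apply: (@ev_perturb _ _ z (X i i) 0) => x x0.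
set z0 := fun t => _.
have z0r t : low r t -> z0 t = zst t.
  by rewrite /z0; case: eqP => [->|_]; [rewrite (negPf lowii)|exact: zr].
have z0i : z0 (X i i) = x by rewrite /z0 eqxx.
clearbody z0; clear z zr lowii; rename z0 into z; rename z0r into zr.
(* Row r is already zero to the left of the pivot and in v, so adding it to other rows does not
   disturb the normalized entries. *)
have rowr o : (oi o < r)%N -> z (Some i, o) = 0.
  by move=> h; rewrite zr ?(zst_row r0) // /low /= h orbT.
rewrite -(@ev_row _ _ i (fun b => - z (X b i) / x)); last by move=> b; exact: Ld.
set z1 := fun t => _.
have z1r t : low r t -> z1 t = zst t.
  rewrite /z1; case: t => [[b|] o] /= h; last exact: zr.
  rewrite zr //; case: ifP => ib; rewrite ?addr0 //.
  have : low r (Some b, o) by []; rewrite /low /= ltnNge (ltnW ib) /= => ho.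
  by rewrite rowr // mulr0 addr0.
have z1i o : z1 (Some i, o) = z (Some i, o) by rewrite /z1 /= ltnn addr0.
have z1c (b : 'I_n) : (i < b)%N -> z1 (X b i) = 0.
  by move=> ib; rewrite /z1 /= ib -/(X i i) z0i divfK // -/(X b i) subrr.
have {z0i} z1x : z1 (X i i) = x by rewrite z1i.
clearbody z1; clear z zr rowr z1i.
have colr o : (oi o < r)%N -> z1 (o, Some i) = 0.
  by move=> h; rewrite z1r ?(zst_col r0) // /low /= h.
rewrite -(@ev_col _ _ i (fun b => - z1 (X i b) / x)); last by move=> b; exact: Rd.
set z2 := fun t => _.
have z2r t : low r t -> z2 t = zst t.
  rewrite /z2; case: t => [o [b|]] /= h; last exact: z1r.
  rewrite z1r //; case: ifP => ib; rewrite ?addr0 //.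
  have : low r (o, Some b) by [].
  rewrite /low /= orbC ltnNge (ltnW ib) /= => ho.
  by rewrite colr // mulr0 addr0.
have z2i o : z2 (o, Some i) = z1 (o, Some i) by rewrite /z2 /= ltnn addr0.
have z2c (b : 'I_n) : (i < b)%N -> z2 (X i b) = 0.
  by move=> ib; rewrite /z2 /= ib -/(X i i) z1x divfK // -/(X i b) subrr.
have {z1c} z2b (b : 'I_n) : (i < b)%N -> z2 (X b i) = 0 by move=> ib; rewrite z2i z1c.
have {z1x} z2x : z2 (X i i) = x by rewrite z2i.
clearbody z2; clear z1 z1r colr z2i.
(* Row r is now zero outside the pivot, so the rescaling affects the pivot alone. *)
have := @ev_scale _ _ (rS i) (f i) z2 x^-1 d (fd i).
rewrite IH => [/esym/eqP|].
  by rewrite mulf_eq0 expf_eq0 invr_eq0 (negPf x0) andbF => /eqP.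
have row0 o : (oi o < r)%N -> z2 (Some i, o) = 0.
  by move=> h; rewrite z2r ?(zst_row r0) // /low /= h orbT.
case=> t1 t2 ht.
have {ht} : [|| oi t1 == r, (oi t1 < r)%N, oi t2 == r | (oi t2 < r)%N].
  by move: ht; rewrite /low /= !ltnS (leq_eqVlt (oi t1)) (leq_eqVlt (oi t2)) -orbA.
have [lt _|/norP[]] := boolP (low r (t1, t2)).
  case: ifP => [/eqP ti|_]; last exact: z2r.
  rewrite -(z2r _ lt) [t1]ti /= row0 ?mulr0 //.
  by move: lt; rewrite /low /= [t1]ti /= ltnn.
move=> /= /negPf -> /negPf ->; rewrite !orbF.
have i0 : i != ord0 by rewrite -val_eqE /= -lt0n.
have some o : oi o = r -> o = Some i.
  case: o => [j|] /= E; first by congr Some; apply: val_inj.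
  by rewrite -E in r0.
case/orP => /eqP/some->.
  rewrite /rS /= eqxx; case: t2 => [j|]; last by rewrite row0 // mulr0 (negPf i0).
  have [ij|ij] := eqVneq i j.
    by rewrite -ij -/(X i i) z2x mulVf //= ?eqxx i0.
  case: (ltngtP i j) => h; last by rewrite (val_inj h) eqxx in ij.
    by rewrite -/(X i j) z2c // mulr0.
  by rewrite row0 ?mulr0.
have col0 o : (oi o < r)%N -> z2 (o, Some i) = 0.
  by move=> h; rewrite z2r ?(zst_col r0) // /low /= h.
case: t1 => [j|]; last by rewrite /= col0 // (negPf i0).
rewrite /rS /=; have [ij|ij] := eqVneq j i.
  by rewrite ij eqxx -/(X i i) z2x mulVf // i0.
rewrite (_ : (Some j == Some i) = (j == i)) // (negPf ij) /=.
case: (ltngtP i j) => h; last by rewrite (val_inj h) eqxx in ij.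
  by rewrite -/(X j i) z2b.
by rewrite col0.
Qed.

End Uniqueness.

Section Uniqueness2.
Variables (C : numClosedFieldType) (m : nat).
Notation n := m.+1.
Notation P := {mpoly C[#|var n|]}.
Notation zst := (@zst C m).
Implicit Types (p q d : P) (z : var n -> C).

(** The first elimination step takes v_0 and w_0 as pivots instead of a matrix entry. Row and column
    operations clear the rest of v and w; the flows of [ag] and [bg] then clear row 0 and column 0
    of x, which is why x_00 is 0 in [zst] and not 1. *)
Lemma sing_first N f g d : sing d -> wt f g d -> Dn N d ->
  (forall z, (forall t, low 1 t -> z t = zst t) -> ev z d = 0) ->
  forall z, ev z d = 0.
Proof.
move=> [Ld Rd] [fd gd] [d0 da db _ _] IH z.
pose v0 : var n := Vv ord0; pose w0 : var n := Ww ord0.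
apply: (@ev_perturb _ _ z v0 0) => x x0.
apply: (@ev_perturb _ _ _ w0 0) => y y0.
set z0 := fun t => _.
have z0v : z0 v0 = x by [].
have z0w : z0 w0 = y by [].
clearbody z0; clear z; rename z0 into z.
rewrite -(@ev_row _ _ ord0 (fun b => - z (Vv b) / x)); last by move=> b; exact: Ld.
set z1 := fun t => _.
have z1v : z1 v0 = x by rewrite /z1 /= ?ltnn addr0.
have z1w : z1 w0 = y by [].
have z1b (b : 'I_n) : b != ord0 -> z1 (Vv b) = 0.
  rewrite -lt0n => ib; rewrite /z1 /= ib.
  by rewrite -[z (Some ord0, None)]/(z v0) z0v divfK // -/(Vv b) subrr.
clearbody z1; clear z z0v z0w.
rewrite -(@ev_col _ _ ord0 (fun b => - z1 (Ww b) / y)); last by move=> b; exact: Rd.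
set z2 := fun t => _.
have z2w : z2 w0 = y by rewrite /z2 /= ?ltnn addr0.
have z2v : z2 v0 = x by [].
have z2b (b : 'I_n) : b != ord0 -> z2 (Vv b) = 0 by exact: z1b.
have z2c (b : 'I_n) : b != ord0 -> z2 (Ww b) = 0.
  rewrite -lt0n => ib; rewrite /z2 /= ib.
  by rewrite -[z1 (None, Some ord0)]/(z1 w0) z1w divfK // -/(Ww b) subrr.
clearbody z2; clear z1 z1v z1w z1b.
rewrite -(@ev_ag _ _ (fun j => - z2 (X ord0 j) / x)) //.
set z3 := fun t => _.
have z3w : z3 w0 = y by [].
have z3v : z3 v0 = x by [].
have z3b (b : 'I_n) : b != ord0 -> z3 (Vv b) = 0 by exact: z2b.
have z3c (b : 'I_n) : b != ord0 -> z3 (Ww b) = 0 by exact: z2c.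
have z3x (j : 'I_n) : z3 (X ord0 j) = 0.
  by rewrite /z3 /= -/v0 z2v divfK // subrr.
clearbody z3; clear z2 z2v z2w z2b z2c.
rewrite -(@ev_bg _ _ (fun j => - z3 (X j ord0) / y)) //.
set z4 := fun t => _.
have z4w : z4 w0 = y by [].
have z4v : z4 v0 = x by [].
have z4b (b : 'I_n) : b != ord0 -> z4 (Vv b) = 0 by exact: z3b.
have z4c (b : 'I_n) : b != ord0 -> z4 (Ww b) = 0 by exact: z3c.
have z4x (j : 'I_n) : z4 (X ord0 j) = 0.
  by rewrite /z4 /= -/(X ord0 j) !z3x oppr0 mul0r mul0r addr0.
have z4y (j : 'I_n) : z4 (X j ord0) = 0.
  by rewrite /z4 /= -/w0 z3w divfK // subrr.
clearbody z4; clear z3 z3v z3w z3b z3c z3x.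
rewrite (@ev_indep _ _ z4 (fun t => if t == O0 n then 0 else z4 t) (O0 n)) //;
  last by move=> t /negPf->.
set z5 := fun t => _.
have z5w : z5 w0 = y by [].
have z5v : z5 v0 = x by [].
have z5b (b : 'I_n) : b != ord0 -> z5 (Vv b) = 0 by exact: z4b.
have z5c (b : 'I_n) : b != ord0 -> z5 (Ww b) = 0 by exact: z4c.
have z5x (j : 'I_n) : z5 (X ord0 j) = 0 by exact: z4x.
have z5y (j : 'I_n) : z5 (X j ord0) = 0 by exact: z4y.
have z50 : z5 (O0 n) = 0 by rewrite /z5 eqxx.
clearbody z5; clear z4 z4v z4w z4b z4c z4x z4y.
have E1 := @ev_scale _ _ (rS ord0) (f ord0) z5 x^-1 d (fd ord0).
have := @ev_scale _ _ (cS ord0) (g ord0) _ y^-1 d (gd ord0).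
move=> /(_ (fun t => if rS ord0 t then x^-1 * z5 t else z5 t)).
rewrite E1 IH => [/esym/eqP|].
  by rewrite !mulf_eq0 !expf_eq0 !invr_eq0 (negPf x0) (negPf y0) !andbF => /eqP.
move=> t lt.
case: t lt => [[i|] [j|]] lt; rewrite /rS /cS /=.
- have [->|i0] := eqVneq i ord0.
    rewrite eqxx -/(X ord0 j) z5x !mulr0 andbF.
    by case: ifP.
  have j0 : j = ord0.
    apply: val_inj; move: lt; rewrite /low /= !ltnS !leqn0 => /orP[|/eqP//].
    by move=> h; rewrite -val_eqE /= h in i0.
  rewrite j0 (_ : (Some i == Some ord0) = (i == ord0)) // (negPf i0) /=.
  by rewrite -/(X i ord0) z5y ?mulr0 ?if_same.
- have [->|i0] := eqVneq i ord0; first by rewrite eqxx -/v0 z5v mulVf.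
  rewrite (_ : (Some i == Some ord0) = (i == ord0)) // (negPf i0) /=.
  by rewrite -/(Vv i) z5b.
- have [->|i0] := eqVneq j ord0; first by rewrite eqxx -/w0 z5w mulVf.
  rewrite (_ : (Some j == Some ord0) = (j == ord0)) // (negPf i0) /=.
  by rewrite -/(Ww j) z5c.
- exact: z50.
Qed.

Lemma sing_unique N f g d : sing d -> wt f g d -> Dn N d ->
  ev zst d = 0 -> d = 0.
Proof.
move=> sd wd Dd d0; apply: ev_eq0; apply: (sing_first sd wd Dd).
have H k r : (0 < r)%N -> (r + k = n)%N ->
    forall z, (forall t, low r t -> z t = zst t) -> ev z d = 0.
  elim: k r => [|k IH] r r0 rk.
    move=> z zr; rewrite -d0; apply: eq_ev => t; apply: zr.
    rewrite addn0 in rk; rewrite /low rk; case: t => -[i|] o //=.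
    by rewrite ltn_ord.
  apply: (sing_step sd wd); first by rewrite r0 -rk addnS ltnS leq_addr.
  by apply: IH => //; rewrite -rk addSnnS.
by apply: (H m).
Qed.

End Uniqueness2.

(** * Existence and weights of singular vectors *)

Section Singular.
Variables (C : numClosedFieldType).

(** The D_i are diagonal on monomials. If x is not an eigenvector of D_i, subtracting from D_i x the
    multiple of x that cancels a monomial m0 gives a nonzero element of W with smaller support. *)
Lemma min_support (N : nat) (W : {mpoly C[N]} -> Prop) (I : Type)
    (D : I -> {mpoly C[N]} -> {mpoly C[N]}) (e : I -> 'X_{1..N} -> nat) x0 :
  subsp W -> (forall i p m, (D i p)@_m = (e i m)%:R * p@_m) ->
  (forall i p, W p -> W (D i p)) -> W x0 -> x0 != 0 ->
  exists x, [/\ W x, x != 0 & forall i, exists k : nat, D i x = k%:R *: x].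
Proof.
move=> [_ WP] De WD; have [s] := ubnP (size (msupp x0)).
elim: s x0 => // s IH x0 ss Wx x0n.
have [h|] := pselect (forall i, exists k : nat, D i x0 = k%:R *: x0).
  by exists x0.
move/existsNP=> [i /forallNP h].
case E : (msupp x0) => [|m0 ms]; first by move: x0n; rewrite -msupp_eq0 E.
have m0s : m0 \in msupp x0 by rewrite E mem_head.
pose y := - (e i m0)%:R *: x0 + D i x0.
have ym m : y@_m = ((e i m)%:R - (e i m0)%:R) * x0@_m.
  by rewrite mcoeffD mcoeffZ De mulrBl mulNr addrC.
apply: (IH y).
- suff : (size (msupp y) < size (msupp x0))%N by move=> lt; exact: leq_trans lt ss.
  have : {subset m0 :: msupp y <= msupp x0}.
    move=> m; rewrite inE => /orP[/eqP->//|]; rewrite !mcoeff_msupp ym mulf_eq0.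
    by case/norP.
  apply: uniq_leq_size; rewrite /= msupp_uniq andbT mcoeff_msupp ym subrr mul0r.
  by rewrite eqxx.
- by apply: WP => //; exact: WD.
- apply/eqP => y0; apply: (h (e i m0)); apply/eqP; rewrite -subr_eq0.
  by rewrite addrC -scaleNr -/y y0.
Qed.

Variable m : nat.
Notation n := m.+1.
Notation var := (var n).
Notation P := {mpoly C[#|var|]}.
Implicit Types (p q x : P) (a b i j : 'I_n) (t : var).
Notation L a b := (der (Lg (@delta_mx C n n a b))).
Notation R a b := (der (Rg (@delta_mx C n n a b))).
Notation zst := (@zst C m).

Definition gstable (W : P -> Prop) :=
  (forall a b p, W p -> W (L a b p)) /\ (forall a b p, W p -> W (R a b p)).

(** The height of an index decreases with the index, so each raising operator in [sing] increases
    the total height, L_ab by b - a and R_ab by a - b. An eigenvector of maximal height in a stable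
    space is therefore singular. *)
Definition ho (o : option 'I_n) : nat := if o is Some i then m - i else 0.
Definition ht t : nat := ho t.1 + ho t.2.
Definition htg t : P := (ht t)%:R *: zv C t.

Lemma mcoeff_ht p mm :
  (der htg p)@_mm = (\sum_t ht t * mm (enum_rank t))%N%:R * p@_mm.
Proof.
rewrite /der raddf_sum natr_sum mulr_suml /=; apply: eq_bigr => t _.
by rewrite -scalerAl mcoeffZ mcoeff_zdv mulrA natrM.
Qed.

Lemma ht_L a b p : (a < b)%N ->
  der htg (L a b p) = L a b (der htg p) + (b - a)%:R *: L a b p.
Proof.
move=> ab; apply/eqP; rewrite addrC -subr_eq; apply/eqP.
have -> : (b - a)%:R *: L a b p = der (fun t => (b - a)%:R *: Lg (@delta_mx C n n a b) t) p.
  by rewrite /der scaler_sumr; apply: eq_bigr => t _; rewrite scalerAl.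
apply: der_bracket => t; rewrite derZ der_z Lg_delta.
case: t => [[b'|] o] /=; last by rewrite der0 !scaler0 subr0.
rewrite derZ der_z /htg !scalerA -scalerBl; congr (_ *: _).
have [->|_] := eqVneq b' b; last by rewrite mul0r !mulr0 subrr.
rewrite mul1r !mulr1 /ht /= -natrB ?leq_add2r ?leq_sub2l 1?ltnW //.
have := ltn_ord b; rewrite ltnS => bm; congr (_%:R); lia.
Qed.

Lemma ht_R a b p : (b < a)%N ->
  der htg (R a b p) = R a b (der htg p) + (a - b)%:R *: R a b p.
Proof.
move=> ab; apply/eqP; rewrite addrC -subr_eq; apply/eqP.
have -> : (a - b)%:R *: R a b p = der (fun t => (a - b)%:R *: Rg (@delta_mx C n n a b) t) p.
  by rewrite /der scaler_sumr; apply: eq_bigr => t _; rewrite scalerAl.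
apply: der_bracket => t; rewrite derZ der_z Rg_delta.
case: t => [o [b'|]] /=; last by rewrite der0 !scaler0 subr0.
rewrite derN derZ der_z /htg !scalerN opprK !scalerA -!scaleNr -scalerDl.
congr (_ *: _); rewrite addrC -[LHS]opprB; congr (- _).
have [->|_] := eqVneq b' a; last by rewrite mul0r !mulr0 subrr.
rewrite mul1r !mulr1 /ht /= -natrB ?leq_add2l ?leq_sub2l 1?ltnW //.
have := ltn_ord a; rewrite ltnS => bm; congr (_%:R); lia.
Qed.

Lemma gstable_eul W : subsp W -> gstable W ->
  forall (i : 'I_n + 'I_n) p, W p ->
    W (eul (match i with inl a => rS a | inr a => cS a end) p).
Proof.
move=> [W0 WP] [WL WR] [a|a] p Wp; first by rewrite rSE; exact: WL.
rewrite cSE -scaleN1r -[X in W X]addr0; apply: WP => //; exact: WR.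
Qed.

Lemma eul_comm (S : pred var) p : eul S (der htg p) = der htg (eul S p).
Proof.
by apply: der_commute => t; rewrite /htg derZ eulgE derZ !der_z eulgE !scalerA mulrC.
Qed.

Lemma subsp_sum (W : P -> Prop) (I : finType) (k : I -> C) (G : I -> P) :
  subsp W -> (forall i : I, W (G i)) -> W (\sum_(i : I) k i *: G i).
Proof. by move=> [W0 WP] WG; elim/big_rec: _ => // i x _ Wx; apply: WP. Qed.

Lemma subspD (W : P -> Prop) p q : subsp W -> W p -> W q -> W (p + q).
Proof. by move=> [_ WP] Wp Wq; rewrite -[p]scale1r; apply: WP. Qed.

Lemma htE p : der htg p = \sum_(a < n) (m - a)%N%:R *: eul (rS a) p
  + \sum_(a < n) (m - a)%N%:R *: eul (cS a) p.
Proof.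
rewrite !der_sumg /der -big_split; apply: eq_bigr => t _ /=; rewrite -mulrDl.
congr (_ * _).
have H (S : 'I_n -> pred var) o : (forall a, S a t = (o == Some a)) ->
    \sum_(a < n) (m - a)%N%:R *: eulg C (S a) t = (ho o)%:R *: zv C t.
  move=> So; under eq_bigr => a _ do rewrite eulgE So scalerA.
  case: o {So} => [a|]; last by rewrite big1 ?scale0r // => a _; rewrite mulr0 scale0r.
  rewrite (bigD1 a) //= eqxx mulr1 big1 ?addr0 // => b /negPf ba.
  by rewrite (_ : (Some a == Some b) = (b == a)) ?ba ?mulr0 ?scale0r // eq_sym.
by rewrite (H _ t.1) // (H _ t.2) // /htg /ht natrD scalerDl.
Qed.

Lemma sing_exists (W : P -> Prop) M : subsp W -> gstable W ->
  (forall p, W p -> p \is M.-homog) -> (exists2 x, W x & x != 0) ->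
  exists x, [/\ W x, x != 0, sing x & exists f g, wt f g x].
Proof.
move=> sW gW WM [x0 Wx0 x0n]; have [W0 WP] := sW; have [WL WR] := gW.
have Wht p : W p -> W (der htg p).
  move=> Wp; rewrite htE; apply: subspD => //; apply: subsp_sum => // a.
    exact: (gstable_eul sW gW (inl a)).
  exact: (gstable_eul sW gW (inr a)).
pose Q k := `[< exists x, [/\ W x, x != 0 & der htg x = k%:R *: x] >].
have exQ : exists k, Q k.
  have [x [Wx xn /(_ tt)[k kx]]] := @min_support _ W unit (fun _ => der htg) _ x0
    sW (fun _ => mcoeff_ht) (fun _ => Wht) Wx0 x0n.
  by exists k; apply/asboolP; exists x.
have Qmax k : Q k -> (k <= 2 * m * M)%N.
  move=> /asboolP[x [Wx xn kx]]; case E : (msupp x) => [|mm ms].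
    by move: xn; rewrite -msupp_eq0 E.
  have mms : mm \in msupp x by rewrite E mem_head.
  have := congr1 (mcoeff mm) kx; rewrite mcoeff_ht mcoeffZ => /mulIf H.
  have /eqP : (\sum_t ht t * mm (enum_rank t))%N%:R = k%:R :> C.
    by apply: H; rewrite -mcoeff_msupp.
  rewrite eqr_nat => /eqP <-; have /dhomogP/(_ mm mms) /= <- := WM x Wx.
  rewrite mdegE big_distrr /= [leqRHS](reindex (@enum_rank var)) /=; last first.
    by exists enum_val => i _; rewrite ?enum_rankK ?enum_valK.
  apply: leq_sum => t _; rewrite leq_mul2r mul2n -addnn leq_add ?orbT //.
    by rewrite /ho; case: t.1 => // a; rewrite leq_subr.
  by rewrite /ho; case: t.2 => // a; rewrite leq_subr.
case: (ex_maxnP exQ Qmax) => k /asboolP[x1 [Wx1 x1n kx1]] kmax.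
pose W' p := W p /\ der htg p = k%:R *: p.
have sW' : subsp W'.
  split=> [|c p q [Wp kp] [Wq kq]]; first by split; rewrite ?der0 ?scaler0.
  split; first exact: WP.
  by rewrite derD derZ kp kq scalerDr !scalerA mulrC.
pose D (i : 'I_n + 'I_n) : P -> P :=
  eul (match i with inl a => rS a | inr a => cS a end).
have D'e u p mm : (D u p)@_mm = (\sum_(t | (match u with inl a => rS a | inr a => cS a end) t)
    mm (enum_rank t))%N%:R * p@_mm by exact: mcoeff_eul.
have D'W u p : W' p -> W' (D u p).
  move=> [Wp kp]; split; first exact: (gstable_eul sW gW).
  by rewrite /D -eul_comm kp derZ.
have [x [[Wx kx] xn wx]] := min_support sW' D'e D'W (conj Wx1 kx1) x1n.
exists x; split=> //.
- split=> a b ab; apply/eqP; apply: contraT => Ln.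
    suff /kmax : Q (k + (b - a))%N by rewrite -subn_gt0 in ab; lia.
    apply/asboolP; exists (L a b x); split=> //; first exact: WL.
    by rewrite ht_L // kx derZ natrD scalerDl.
  suff /kmax : Q (k + (a - b))%N by rewrite -subn_gt0 in ab; lia.
  apply/asboolP; exists (R a b x); split=> //; first exact: WR.
  by rewrite ht_R // kx derZ natrD scalerDl.
have [f fx] := choice (fun a : 'I_n => wx (inl a)).
have [g gx] := choice (fun a : 'I_n => wx (inr a)).
by exists f, g.
Qed.

Lemma L_bracket_delta a b p : a != b ->
  L a b (L b a p) = L b a (L a b p) + (L a a p - L b b p).
Proof.
move=> ab; apply/eqP; rewrite addrC -subr_eq -L_bracket; apply/eqP.
have -> : mxbracket (delta_mx a b) (delta_mx b a)
   = -1 *: delta_mx b b + delta_mx a a :> 'M[C]_n.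
  by rewrite /mxbracket !mul_delta_mx scaleN1r addrC.
by rewrite L_linear scaleN1r addrC.
Qed.

Lemma mxadj_delta a b : mxadj (delta_mx a b) = delta_mx b a :> 'M[C]_n.
Proof.
by apply/matrixP => i j; rewrite !mxE andbC; case: (_ && _); rewrite ?conjC1 ?conjC0.
Qed.

(** The square norm of E_ba x is f a - f b times that of x, because E_ab is adjoint to E_ba and
    kills x; it cannot be negative. *)
Lemma sing_dominant x f g : sing x -> wt f g x -> x != 0 ->
  forall a b, (a < b)%N -> (f b <= f a)%N.
Proof.
move=> [Lx _] [fx _] xn a b ab.
have nab : a != b by rewrite neq_ltn ab.
have E : L a b (L b a x) = ((f a)%:R - (f b)%:R) *: x.
  by rewrite L_bracket_delta // Lx // der0 add0r -!rSE !fx scalerBl.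
have := fis_ge0 (L b a x); rewrite {1}fis_L mxadj_delta E fisZr.
rewrite rmorphB /= !conjC_nat; have xx : 0 < fis x x.
  by rewrite lt_def fis_ge0 andbT; apply: contra xn => /eqP/fis_eq0->.
by rewrite pmulr_lge0 // subr_ge0 ler_nat.
Qed.

Lemma var_sum_nat (f : var -> nat) :
  (\sum_t f t = f (O0 n) + \sum_j f (Ww j)
    + \sum_i (f (Vv i) + \sum_j f (X i j)))%N.
Proof. exact: (@var_sum n nat f). Qed.

(** By [sing_unique] x is nonzero at [zst], so some monomial of x is. It involves only v_0, w_0 and
    the x_ii with i > 0, and all degrees of x can be read off from it: N is the exponent of v_0 and
    of w_0, and f i = g i is that of x_ii. *)
Lemma sing_weight N M x f g : sing x -> wt f g x -> x != 0 -> Dn N x ->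
  x \is M.-homog ->
  [/\ f ord0 = N, g =1 f & (\sum_a f a + N)%N = M].
Proof.
move=> sx wx xn Dx Mx; have [fx gx] := wx; have [_ _ _ vx wwx] := Dx.
have : ev zst x != 0 by apply: contra xn => /eqP /(sing_unique sx wx Dx) ->.
rewrite /ev mevalE => /eqP h.
have [mm mms] : exists2 mm, mm \in msupp x &
    \prod_i zst (enum_val i) ^+ mm i != 0.
  apply: contra_notP h => h; rewrite big_seq big1 // => mm mms; apply/eqP.
  rewrite mulf_eq0; apply/orP; right; apply: contraT => hh.
  by case: h; exists mm.
rewrite prodf_seq_neq0 => /allP hz.
have z0 t : zst t == 0 -> mm (enum_rank t) = 0%N.
  move=> zt; apply/eqP; apply: contraT => mt.
  have := hz (enum_rank t); rewrite mem_index_enum => /(_ isT) /=.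
  by rewrite enum_rankK expf_eq0 zt andbT lt0n mt.
have zX i j : (i != j) || (i == ord0) -> mm (enum_rank (X i j)) = 0%N.
  by move=> ij; apply: z0; rewrite /zst /=; case: eqP ij => //= _ ->.
have zV i : i != ord0 -> mm (enum_rank (Vv i)) = 0%N.
  by move=> ij; apply: z0; rewrite /zst /= (negPf ij).
have zW i : i != ord0 -> mm (enum_rank (Ww i)) = 0%N.
  by move=> ij; apply: z0; rewrite /zst /= (negPf ij).
have zO : mm (enum_rank (O0 n)) = 0%N by apply: z0; rewrite /zst.
have S (F : pred var) k : wdeg F k x -> (\sum_t F t * mm (enum_rank t))%N = k.
  move=> /wdegP/(_ mm mms) <-; rewrite [RHS]big_mkcond; apply: eq_bigr => t _.
  by case: (F t); rewrite ?mul1n.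
have SE (F : pred var) k : wdeg F k x -> 
   (F (Ww ord0) * mm (enum_rank (Ww ord0)) + F (Vv ord0) * mm (enum_rank (Vv ord0))
    + \sum_(i | i != ord0) F (X i i) * mm (enum_rank (X i i)))%N = k.
  move=> /S <-; rewrite var_sum_nat zO muln0 add0n big_split /= -addnA.
  congr (_ + (_ + _))%N.
  - by rewrite (bigD1 ord0) //= big1 ?addn0 // => i i0; rewrite zW ?muln0.
  - by rewrite [RHS](bigD1 ord0) //= big1 ?addn0 // => i i0; rewrite zV ?muln0.
  rewrite [RHS](bigD1 ord0) //= [X in _ = (X + _)%N]big1 ?add0n => [|j _]; last first.
    by rewrite zX ?muln0 ?eqxx ?orbT.
  apply: eq_bigr => i i0; rewrite (bigD1 i) //= big1 ?addn0 // => j ji.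
  by rewrite zX ?muln0 // eq_sym ji.
have f0 := SE _ _ (fx ord0); have g0 := SE _ _ (gx ord0).
have v0 := SE _ _ vx; have w0 := SE _ _ wwx.
have MM := SE _ _ ((wdegT_homog _ _).2 Mx).
have NV : mm (enum_rank (Vv ord0)) = N.
  by rewrite -v0 /= mul0n add0n mul1n big1 ?addn0.
have NW : mm (enum_rank (Ww ord0)) = N.
  by rewrite -w0 /= mul0n addn0 mul1n big1 ?addn0.
have fi i : f i = if i == ord0 then N else mm (enum_rank (X i i)).
  rewrite -(SE _ _ (fx i)) /rS /=.
  have E (u v : 'I_n) : (Some u == Some v) = (u == v) by [].
  rewrite !E mul0n add0n; have [->|i0] := eqVneq i ord0.
    by rewrite ?eqxx mul1n big1 ?addn0 // => j /negPf j0; rewrite E j0.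
  rewrite mul0n add0n (bigD1 i) //= E eqxx mul1n big1 ?addn0 //.
  by move=> j /andP[_ /negPf ji]; rewrite E ji.
have gi i : g i = if i == ord0 then N else mm (enum_rank (X i i)).
  rewrite -(SE _ _ (gx i)) /cS /=.
  have E (u v : 'I_n) : (Some u == Some v) = (u == v) by [].
  rewrite !E mul0n addn0; have [->|i0] := eqVneq i ord0.
    by rewrite ?eqxx mul1n big1 ?addn0 // => j /negPf j0; rewrite E j0.
  rewrite mul0n add0n (bigD1 i) //= E eqxx mul1n big1 ?addn0 //.
  by move=> j /andP[_ /negPf ji]; rewrite E ji.
split.
- by rewrite fi eqxx.
- by move=> i; rewrite fi gi.
(* Both v_0 and w_0 contribute N to the degree, but f 0 accounts for one of them only. *)
rewrite -MM /= !mul1n NV NW (bigD1 ord0) //= fi eqxx.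
rewrite [LHS]addnAC; congr (_ + _ + _)%N.
by apply: eq_bigr => i /negPf i0; rewrite fi i0 mul1n.
Qed.

End Singular.

(** * Derivatives of determinants and leading minors *)

Section DerDet.
Variables (C : numClosedFieldType) (T : finType).
Local Notation P := {mpoly C[#|T|]}.

Lemma der_prod (g : T -> P) (I : finType) (F : I -> P) :
  der g (\prod_i F i)
  = \sum_i \prod_j (if j == i then der g (F j) else F j).
Proof.
pose G (r : seq I) := uniq r -> der g (\prod_(i <- r) F i)
  = \sum_(i <- r) \prod_(j <- r) (if j == i then der g (F j) else F j).
suff : G (index_enum I) by apply; exact: index_enum_uniq.
rewrite /G; elim: (index_enum I) => [|i r IH] /=; first by rewrite !big_nil der1.
case/andP => ir ur; rewrite !big_cons derM IH // eqxx; congr (_ * _ + _).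
  apply: eq_big_seq => j jr; case: eqP => // E.
  by move: ir; rewrite -E jr.
rewrite mulr_sumr; apply: eq_big_seq => j jr; rewrite big_cons.
by case: eqP => // E; move: ir; rewrite E jr.
Qed.

Lemma der_det (g : T -> P) n (A : 'M[P]_n) :
  der g (\det A)
  = \sum_i \det (\matrix_(j, k) (if j == i then der g (A j k) else A j k)).
Proof.
rewrite /determinant der_sum [RHS]exchange_big /=; apply: eq_bigr => s _.
rewrite derM (_ : der g (_ ^+ _) = 0) ?mul0r ?add0r; last first.
  by case: perm.odd_perm; rewrite ?expr1 ?derN ?expr0 der1 ?oppr0.
rewrite der_prod mulr_sumr; apply: eq_bigr => i _.
by congr (_ * _); apply: eq_bigr => j _; rewrite mxE.
Qed.

Lemma der_det_row (g : T -> P) n (A : 'M[P]_n) (b : 'I_n) :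
  (forall i j, i != b -> der g (A i j) = 0) ->
  der g (\det A) = \det (\matrix_(j, k) (if j == b then der g (A j k) else A j k)).
Proof.
move=> A0; rewrite der_det (bigD1 b) //= big1 ?addr0 // => i ib.
rewrite (expand_det_row _ i) big1 // => j _.
by rewrite mxE eqxx A0 // mul0r.
Qed.

Lemma der_det0 (g : T -> P) n (A : 'M[P]_n) :
  (forall i j, der g (A i j) = 0) -> der g (\det A) = 0.
Proof.
move=> A0; rewrite der_det big1 // => i _.
rewrite (expand_det_row _ i) big1 // => j _.
by rewrite mxE eqxx A0 mul0r.
Qed.

End DerDet.

Section HighestWeight.
Variables (C : numClosedFieldType) (m : nat).
Notation n := m.+1.
Notation var := (var n).
Notation P := {mpoly C[#|var|]}.
Implicit Types (p q x : P) (a b i j k : 'I_n) (t : var) (lam : {ffun 'I_n -> nat}).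
Notation L a b := (der (Lg (@delta_mx C n n a b))).
Notation R a b := (der (Rg (@delta_mx C n n a b))).

(** Padding by the identity keeps all leading minors of the same size n; [minor k] is the one of
    order k.+1. *)
Definition minor_mx k : 'M[P]_n :=
  \matrix_(i, j) (if (i <= k)%N && (j <= k)%N then zv C (X i j) else (i == j)%:R).
Definition minor k : P := \det (minor_mx k).

Lemma der_minor_mx g k i j : der g (minor_mx k i j)
  = if (i <= k)%N && (j <= k)%N then g (X i j) else 0.
Proof. by rewrite mxE; case: ifP; rewrite ?der_z ?der_nat. Qed.

(** E_ab replaces row b by row a. The result has two equal rows if b <= k; otherwise row b belongs
    to the padding and becomes zero. *)
Lemma L_minor a b k : (a < b)%N -> L a b (minor k) = 0.
Proof.
move=> ab; rewrite /minor (@der_det_row _ _ _ _ _ b) => [|i j /negPf ib].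
  have [bk|kb] := leqP b k; last first.
    rewrite (expand_det_row _ b) big1 // => j _.
    by rewrite mxE eqxx der_minor_mx leqNgt kb mul0r.
  have nab : a != b by rewrite neq_ltn ab.
  apply: (determinant_alternate nab) => j.
  rewrite mxE (negPf nab) [RHS]mxE eqxx der_minor_mx mxE Lg_delta /= eqxx scale1r bk.
  rewrite (leq_trans (ltnW ab) bk) /=; case: ifP => // jk.
  by rewrite (_ : (a == j) = false) //; apply: contraFF jk => /eqP<-; rewrite (leq_trans (ltnW ab) bk).
by rewrite der_minor_mx Lg_delta /= ib scale0r if_same.
Qed.

Lemma minor_tr k : minor k = \det (minor_mx k)^T. Proof. by rewrite det_tr. Qed.

Lemma R_minor a b k : (b < a)%N -> R a b (minor k) = 0.
Proof.
move=> ba; apply/eqP; rewrite -oppr_eq0; apply/eqP.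
have -> : - R a b (minor k) = der (fun t => - Rg (@delta_mx C n n a b) t) (minor k).
  by rewrite /der -sumrN; apply: eq_bigr => t _; rewrite mulNr.
rewrite minor_tr (@der_det_row _ _ _ _ _ a) => [|i j /negPf ia].
  have [ak|ka] := leqP a k; last first.
    rewrite (expand_det_row _ a) big1 // => j _.
    by rewrite mxE eqxx mxE der_minor_mx andbC leqNgt ka mul0r.
  have nab : b != a by rewrite neq_ltn ba.
  apply: (determinant_alternate nab) => j.
  rewrite mxE (negPf nab) [RHS]mxE eqxx ![(minor_mx k)^T _ _]mxE der_minor_mx.
  rewrite mxE Rg_delta /= eqxx scale1r opprK ak andbT.
  rewrite (leq_trans (ltnW ba) ak) andbT; case: ifP => // jk.
  rewrite (_ : (j == b) = false) //; apply: contraFF jk => /eqP->.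
  exact: leq_trans (ltnW ba) ak.
by rewrite mxE der_minor_mx Rg_delta /= ia scale0r !oppr0 if_same.
Qed.

Lemma wt_minor k :
  wt (fun a => nat_of_bool (a <= k)%N) (fun a => nat_of_bool (a <= k)%N) (minor k).
Proof.
split=> a; rewrite /wdeg.
  rewrite /minor (@der_det_row _ _ _ _ _ a) => [|i j /negPf ia]; last first.
    by rewrite der_minor_mx eulgE (_ : rS a _ = (i == a)) // ia scale0r if_same.
  have [ak|ka] := leqP a k.
    rewrite scale1r; congr (\det _); apply/matrixP => i j; rewrite mxE.
    case: (i =P a) => [->|//]; rewrite der_minor_mx mxE eulgE (_ : rS a _ = true) ?scale1r ?ak; last exact: eqxx.
    rewrite /=.
    case: ifP => // jk; rewrite (_ : (a == j) = false) //.
    by apply: contraFF jk => /eqP<-.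
  rewrite scale0r (expand_det_row _ a) big1 // => j _.
  by rewrite mxE eqxx der_minor_mx leqNgt ka mul0r.
rewrite minor_tr (@der_det_row _ _ _ _ _ a) => [|i j /negPf ia]; last first.
  by rewrite mxE der_minor_mx eulgE (_ : cS a _ = (i == a)) // ia scale0r if_same.
have [ak|ka] := leqP a k.
  rewrite scale1r; congr (\det _); apply/matrixP => i j; rewrite mxE.
  case: (i =P a) => [->|//]; rewrite mxE der_minor_mx mxE eulgE (_ : cS a _ = true) ?scale1r ?ak; last exact: eqxx.
  rewrite andbT.
  case: ifP => // jk; rewrite (_ : (j == a) = false) //.
  by apply: contraFF jk => /eqP->.
rewrite scale0r (expand_det_row _ a) big1 // => j _.
by rewrite mxE eqxx mxE der_minor_mx andbC leqNgt ka mul0r.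
Qed.

End HighestWeight.

(** * Products of leading minors *)

Section Delta.
Variables (C : numClosedFieldType) (m : nat).
Notation n := m.+1.
Notation var := (var n).
Notation P := {mpoly C[#|var|]}.
Implicit Types (p q x : P) (a b i j k : 'I_n) (t : var) (lam : {ffun 'I_n -> nat}).
Notation R a b := (der (Rg (@delta_mx C n n a b))).

(** Extension by zero, so that the exponent of the last minor in [Delta] is the last part of lam. *)
Definition ext lam (j : nat) : nat := oapp lam 0%N (insub j : option 'I_n).

Lemma ext_ord lam i : ext lam i = lam i.
Proof. by rewrite /ext valK. Qed.

Lemma ext_n lam : ext lam n = 0%N.
Proof. by rewrite /ext insubF // ltnn. Qed.

Lemma ext_le lam (j : nat) : is_partition lam -> (ext lam j.+1 <= ext lam j)%N.
Proof.
move=> /forallP lamP; rewrite /ext.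
case: (insubP _ j.+1) => [u ju uj|] //=.
have jn : (j < n)%N by exact: ltn_trans ju.
rewrite insubT /=; have /forallP/(_ u)/implyP := lamP (Ordinal jn).
by apply; rewrite uj /=.
Qed.

Lemma sum_diff_ext lam a : is_partition lam ->
  (\sum_(k < n) (a <= k) * (ext lam k - ext lam k.+1))%N = lam a.
Proof.
move=> lamP; pose G N := (\sum_(k < N) (a <= k) * (ext lam k - ext lam k.+1))%N.
suff H N : (a <= N)%N -> (G N + ext lam N)%N = lam a.
  by have := H n (ltnW (ltn_ord a)); rewrite ext_n addn0.
elim: N => [|N IH] aN.
  by rewrite /G big_ord0 -ext_ord; move: aN; rewrite leqn0 => /eqP->.
rewrite /G big_ord_recr /= -/(G N).
have := ext_le N lamP; move: aN; rewrite leq_eqVlt => /orP[/eqP aN|aN].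
  rewrite [(a <= N)%N]leqNgt aN ltnSn mul0n addn0 /G big1 => [|k _]; last first.
    by rewrite [(a <= k)%N]leqNgt aN (ltn_trans (ltn_ord k)) // mul0n.
  by rewrite -aN ext_ord.
by move=> h; have {}aN : (a <= N)%N := aN; have := IH aN; rewrite aN mul1n; lia.
Qed.

(** The exponent of [minor k] is the number of columns of length k.+1 in the Young diagram of lam;
    this makes lam the weight on either side. *)
Definition Delta lam : P := \prod_(k < n) minor C k ^+ (ext lam k - ext lam k.+1).

Lemma der_exp0 (g : var -> P) p e : der g p = 0 -> der g (p ^+ e) = 0.
Proof. by case: e => [|e] p0; rewrite ?expr0 ?der1 // derX p0 !mulr0. Qed.

Lemma der_Delta0 (g : var -> P) lam :
  (forall k, der g (minor C k) = 0) -> der g (Delta lam) = 0.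
Proof.
move=> g0; rewrite /Delta; elim/big_rec: _ => [|k q _ IH]; first exact: der1.
by rewrite derM IH der_exp0 // mul0r mulr0 addr0.
Qed.

Lemma sing_Delta lam : sing (Delta lam).
Proof. by split=> a b ab; apply: der_Delta0 => k; rewrite ?L_minor ?R_minor. Qed.

Lemma wdeg1 (S : pred var) : wdeg S 0 (1 : P).
Proof. by rewrite /wdeg der1 scale0r. Qed.

Lemma wdeg_exp (S : pred var) (k e : nat) p : wdeg S k p -> wdeg S (k * e) (p ^+ e).
Proof.
move=> pk; elim: e => [|e IH]; first by rewrite muln0; exact: wdeg1.
by rewrite exprS mulnS; exact: wdegM.
Qed.

Lemma wdeg_prod (S : pred var) (I : finType) (f : I -> nat) (F : I -> P) :
  (forall u : I, wdeg S (f u) (F u)) ->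
  wdeg S (\sum_u f u) (\prod_u F u).
Proof.
move=> h; elim/big_rec2: _ => [|i p k _ IH]; first exact: wdeg1.
exact: wdegM.
Qed.

Lemma wt_Delta lam : is_partition lam -> wt lam lam (Delta lam).
Proof.
move=> lamP; split=> a; rewrite -(sum_diff_ext a lamP); apply: wdeg_prod => k.
  by apply: wdeg_exp; have [h _] := wt_minor C k; exact: h.
by apply: wdeg_exp; have [_ h] := wt_minor C k; exact: h.
Qed.

Lemma XO_Delta lam : XO (Delta lam).
Proof.
have D s : (forall i j, s != X i j) -> dv s (Delta lam) = 0.
  move=> sX; rewrite dvE; apply: der_Delta0 => k; apply: der_det0 => i j.
  by rewrite der_minor_mx eq_sym (negPf (sX i j)) if_same.
by split=> [|i|j]; apply: D => i' j'; rewrite xpair_eqE ?andbF.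
Qed.

Lemma Delta_neq0 lam : Delta lam != 0.
Proof.
(* At the identity matrix all leading minors are 1. *)
pose z : var -> C := fun t => if t is (Some i, Some j) then (i == j)%:R else 0.
suff : ev z (Delta lam) != 0 by apply: contraNneq => ->; rewrite ev0.
rewrite /Delta; elim/big_rec: _ => [|k q _ IH]; first by rewrite ev1 oner_neq0.
rewrite evM evX mulf_neq0 // expf_neq0 // /minor /ev -det_map_mx.
rewrite (_ : map_mx _ _ = 1%:M) ?det1 ?oner_neq0 //.
apply/matrixP => i j; rewrite !mxE; case: ifP => _.
  exact: ev_z.
by rewrite rmorph_nat.
Qed.

Lemma rS_sum (f : 'I_n -> nat) p : XO p -> (forall a, wdeg (rS a) (f a) p) ->
  p \is (\sum_a f a).-homog.
Proof.
move=> [p0 _ pw] fp; apply/wdegT_homog; rewrite /wdeg.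
rewrite natr_sum scaler_suml.
under [RHS]eq_bigr => a _ do rewrite -fp.
rewrite /der [RHS]exchange_big /=; apply: eq_bigr => -[[i|] o] _; last first.
  suff -> : dv ((None, o) : var) p = 0 by rewrite mulr0 big1 // => a _; rewrite mulr0.
  by case: o => [j|]; [exact: pw|exact: p0].
rewrite (bigD1 i) //= !eulgE /= big1 ?addr0.
  by rewrite (_ : rS i _ = true) //; exact: eqxx.
move=> j ji; rewrite eulgE (_ : rS j _ = false) ?scale0r ?mul0r //.
by apply/negbTE; move: ji; rewrite eq_sym.
Qed.

Lemma Delta_homog lam : is_partition lam -> Delta lam \is (\sum_a lam a).-homog.
Proof. by move=> lamP; apply: rS_sum; [exact: XO_Delta|case: (wt_Delta lamP)]. Qed.

Lemma Th_homog N M p : p \is M.-homog -> iter N Th p \is (M + N).-homog.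
Proof.
move=> /wdegT_homog pM; apply/wdegT_homog; rewrite -[N in (M + N)%N]muln1.
exact: wdeg_iterTh.
Qed.

(** [iter M.+1 Th p] has degree 2 M + 1, but its degrees in v and in w are both M + 1, which add up
    to more. *)
Lemma Th_nil M p : XO p -> p \is M.-homog -> iter M.+1 Th p = 0.
Proof.
move=> Xp pM; apply/eqP; rewrite -msupp_eq0; case E: msupp => [//|mm s].
have mms : mm \in msupp (iter M.+1 Th p) by rewrite E mem_head.
have vM : wdeg (@vS n) (0 + M.+1 * 1) (iter M.+1 Th p).
  by apply: wdeg_iterTh => //; exact: XO_wdeg.
have wM : wdeg (@wS n) (0 + M.+1 * 1) (iter M.+1 Th p).
  by apply: wdeg_iterTh => //; exact: XO_wdeg.
have /wdegT_homog tM := Th_homog M.+1 pM.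
move: vM wM tM => /wdegP/(_ mm mms) vM /wdegP/(_ mm mms) wM /wdegP/(_ mm mms) tM.
suff : (\sum_(t | vS t) mm (enum_rank t) + \sum_(t | wS t) mm (enum_rank t)
        <= \sum_(t | predT t) mm (enum_rank t))%N by rewrite vM wM tM; lia.
rewrite big_mkcond [X in (_ + X)%N]big_mkcond /= -big_split /=.
by apply: leq_sum => -[[i|] [j|]] _; rewrite /vS /wS /= ?addn0 ?add0n.
Qed.

Lemma sing_Th N p : sing p -> sing (iter N Th p).
Proof.
move=> [Lp Rp]; split=> a b ab.
  by rewrite (iter_comm (@L_Th _ _ _)) Lp // iter_der0.
by rewrite (iter_comm (@R_Th _ _ _)) Rp // iter_der0.
Qed.

Lemma wt_Th f g N p : wt f g p -> wt f g (iter N Th p).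
Proof.
move=> [fp gp]; split=> a; rewrite -[X in wdeg _ X]addn0 -[X in (_ + X)%N](muln0 N);
  apply: wdeg_iterTh => // i j; rewrite !addn0 ?add0n //.
Qed.

(* The order of vanishing of powers of Th on Delta is forced by the weight. *)
Lemma Delta_Th lam : is_partition lam ->
  iter (lam ord0) Th (Delta lam) != 0 /\ iter (lam ord0).+1 Th (Delta lam) = 0.
Proof.
move=> lamP; set M := (\sum_a lam a)%N.
have exN : exists N, iter N Th (Delta lam) == 0.
  by exists M.+1; rewrite Th_nil //; [exact: XO_Delta|exact: Delta_homog].
case: (ex_minnP exN) => -[|N] /eqP N0 Nmin.
  by have := Delta_neq0 lam; rewrite -[Delta lam]/(iter 0 Th (Delta lam)) N0 eqxx.
have Nn0 : iter N Th (Delta lam) != 0.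
  by apply/eqP => h; have := Nmin N; rewrite h eqxx ltnn => /(_ isT).
suff -> : lam ord0 = N by [].
have sw := sing_weight (sing_Th N (sing_Delta lam)) (wt_Th N (wt_Delta lamP)) Nn0.
have [] // := sw N (M + N)%N; first exact: Th_Dn (XO_Delta lam) N0.
by apply: Th_homog; exact: Delta_homog.
Qed.

End Delta.

(** * Generation of the kernels of the powers of [Th] *)

Section Generation.
Variables (C : numClosedFieldType) (m : nat).
Notation n := m.+1.
Notation var := (var n).
Notation P := {mpoly C[#|var|]}.
Implicit Types (p q x : P) (a b i j : 'I_n) (t : var) (lam : {ffun 'I_n -> nat}).
Implicit Types (W : P -> Prop) (B : {ffun 'I_n -> nat} -> Prop).
Notation L a b := (der (Lg (@delta_mx C n n a b))).
Notation R a b := (der (Rg (@delta_mx C n n a b))).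
Notation zst := (@zst C m).

Lemma subsp_and W W' : subsp W -> subsp W' -> subsp (fun p => W p /\ W' p).
Proof.
move=> [W0 WP] [W0' WP']; split=> // a p q [Wp Wp'] [Wq Wq'].
by split; [exact: WP | exact: WP'].
Qed.

Lemma gstable_and W W' : gstable W -> gstable W' -> gstable (fun p => W p /\ W' p).
Proof.
move=> [WL WR] [WL' WR']; split=> a b p [Wp Wp'].
  by split; [exact: WL | exact: WL'].
by split; [exact: WR | exact: WR'].
Qed.

Lemma dv_wdeg0 (S : pred var) t p : S t -> wdeg S 0 p -> dv t p = 0.
Proof.
move=> St /wdegP p0; suff /eqP : zv C t * dv t p = 0.
  rewrite mulf_eq0 => /orP[|/eqP//] /eqP/(congr1 (dv t)).
  by rewrite dv_z eqxx linear0 => /eqP; rewrite oner_eq0.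
apply/mpolyP => mm; rewrite mcoeff_zdv mcoeff0.
have [/p0/eqP|/memN_msupp_eq0->] := boolP (mm \in msupp p); last by rewrite mulr0.
by rewrite sum_nat_eq0 => /forallP/(_ t); rewrite St => /eqP ->; rewrite mul0r.
Qed.

Lemma XOP p : XO p <-> [/\ dv (O0 n) p = 0, wdeg (@vS n) 0 p & wdeg (@wS n) 0 p].
Proof.
split=> [Xp|[p0 pv pw]].
  by split; [case: Xp | exact: XO_wdeg | exact: XO_wdeg].
by split=> // i; [apply: dv_wdeg0 pv | apply: dv_wdeg0 pw].
Qed.

Lemma XO_subsp : subsp (@XO C n).
Proof.
split=> [|a p q [p1 p2 p3] [q1 q2 q3]]; first by split=> *; rewrite linear0.
by split=> [|i|j]; rewrite linearP /= ?p1 ?q1 ?p2 ?q2 ?p3 ?q3 scaler0 addr0.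
Qed.

Lemma XO_L (x : 'M[C]_n) p : XO p -> XO (der (@Lg C n x) p).
Proof.
move=> /XOP[p0 pv pw]; apply/XOP; split.
- by rewrite d0_L p0 der0.
- by rewrite /wdeg eul_L // pv derZ.
- by rewrite /wdeg eul_L // pw derZ.
Qed.

Lemma XO_R (x : 'M[C]_n) p : XO p -> XO (der (@Rg C n x) p).
Proof.
move=> /XOP[p0 pv pw]; apply/XOP; split.
- by rewrite d0_R p0 der0.
- by rewrite /wdeg eul_R // pv derZ.
- by rewrite /wdeg eul_R // pw derZ.
Qed.

Lemma homog_subsp M : subsp (fun p : P => p \is M.-homog).
Proof. by split=> [|a p q Hp Hq]; rewrite ?rpred0 // rpredD ?rpredZ. Qed.

Lemma homog_L M (x : 'M[C]_n) p : p \is M.-homog -> der (@Lg C n x) p \is M.-homog.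
Proof.
by move=> /wdegT_homog pM; apply/wdegT_homog; rewrite /wdeg eul_L // pM derZ.
Qed.

Lemma homog_R M (x : 'M[C]_n) p : p \is M.-homog -> der (@Rg C n x) p \is M.-homog.
Proof.
by move=> /wdegT_homog pM; apply/wdegT_homog; rewrite /wdeg eul_R // pM derZ.
Qed.

(* This is the sum of the M_lam with lam_1 < K and |lam| = M. *)
Definition HH K M p := [/\ XO p, p \is M.-homog & iter K Th p = 0].

Lemma HH_subsp K M : subsp (HH K M).
Proof.
split=> [|a p q [p1 p2 p3] [q1 q2 q3]].
  by split; [case: XO_subsp | exact: rpred0 | exact: iter_der0].
split; first by apply: XO_subsp.2.
  by rewrite rpredD ?rpredZ.
by rewrite iter_derP p3 q3 scaler0 addr0.
Qed.

Lemma HH_L K M (x : 'M[C]_n) p : HH K M p -> HH K M (der (@Lg C n x) p).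
Proof.
move=> [p1 p2 p3]; split; [exact: XO_L|exact: homog_L|].
by rewrite -(iter_comm (@L_Th _ _ _)) p3 der0.
Qed.

Lemma HH_R K M (x : 'M[C]_n) p : HH K M p -> HH K M (der (@Rg C n x) p).
Proof.
move=> [p1 p2 p3]; split; [exact: XO_R|exact: homog_R|].
by rewrite -(iter_comm (@R_Th _ _ _)) p3 der0.
Qed.

Lemma HH_gstable K M : gstable (HH K M).
Proof. by split=> a b p; [exact: HH_L | exact: HH_R]. Qed.

Lemma iterTh_le K K' p : (K <= K')%N -> iter K Th p = 0 -> iter K' Th p = 0.
Proof. by move=> /subnK <- p0; rewrite iterD p0 iter_der0. Qed.

(** The gl x gl-submodule generated by the [Delta] of the partitions in B, as the intersection of
    the stable subspaces containing them. Membership is used by instantiating W. *)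
Definition gspan B p := forall W, subsp W -> gstable W ->
  (forall lam, is_partition lam -> B lam -> W (Delta C lam)) -> W p.

Lemma gspan_subsp B : subsp (gspan B).
Proof.
split=> [W [W0 _] //|a p q Hp Hq W sW gW WB].
by apply: sW.2; [exact: Hp | exact: Hq].
Qed.

Lemma gspan_gstable B : gstable (gspan B).
Proof.
split=> a b p Hp W sW gW WB; first by apply: gW.1; exact: Hp.
by apply: gW.2; exact: Hp.
Qed.

Lemma gspan_Delta B lam : is_partition lam -> B lam -> gspan B (Delta C lam).
Proof. by move=> lamP Bl W sW gW; apply. Qed.

Lemma gspan_mono B B' p : (forall lam, is_partition lam -> B lam -> B' lam) ->
  gspan B p -> gspan B' p.
Proof. by move=> BB Hp W sW gW WB; apply: Hp => // lam lP /BB h; apply: WB => //; exact: h. Qed.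

Lemma Delta_HH K lam : is_partition lam -> (lam ord0 < K)%N ->
  HH K (\sum_a lam a) (Delta C lam).
Proof.
move=> lamP lK; split; [exact: XO_Delta | exact: Delta_homog |].
by apply: (iterTh_le lK); case: (Delta_Th C lamP).
Qed.

Lemma gspan_HH K M p :
  gspan (fun lam => (lam ord0 < K)%N /\ (\sum_a lam a)%N = M) p -> HH K M p.
Proof.
apply; [exact: HH_subsp | exact: HH_gstable |] => lam lamP [lK <-].
exact: Delta_HH.
Qed.

Definition orth W p := forall x, W x -> fis x p = 0.

Lemma orth_subsp W : subsp (orth W).
Proof.
split=> [x _|a p q Hp Hq x Wx]; first by rewrite fis0r.
by rewrite fisDr fisZr Hp // Hq // mulr0 addr0.
Qed.

Lemma orth_gstable W : gstable W -> gstable (orth W).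
Proof.
move=> [WL WR]; split=> a b p Hp x Wx.
  by rewrite -[L a b p](_ : der (Lg (mxadj (delta_mx b a))) p = _) -?fis_L ?mxadj_delta //; apply: Hp; exact: WL.
by rewrite -[R a b p](_ : der (Rg (mxadj (delta_mx b a))) p = _) -?fis_R ?mxadj_delta //; apply: Hp; exact: WR.
Qed.

Lemma orth_proj M W : subsp W -> (forall p, W p -> p \is M.-homog) ->
  forall p, exists2 w, W w & orth W (p - w).
Proof.
move=> sW WM; apply: (fis_proj sW (k := M.+1)) => p /WM; exact: homog_msize.
Qed.

(** Let W be the image under [iter N Th] of what the admissible [Delta] generate. If d is not in W,
    the part of [Dn N] orthogonal to W is nonzero and stable, so it contains a singular x. The
    weight of x is an admissible lam, and W contains the singular vector [iter N Th (Delta C lam)]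
    of the same weight. By uniqueness the two are proportional, so x lies in W and is orthogonal to
    itself. *)
Lemma Dn_generated N M d : Dn N d -> d \is (M + N).-homog ->
  exists2 F, gspan (fun lam => lam ord0 = N /\ (\sum_a lam a)%N = M) F
    & iter N Th F = d.
Proof.
set B := fun lam => _ => Dd dM.
have BH F : gspan B F -> HH N.+1 M F.
  by move=> h; apply: gspan_HH; apply: gspan_mono h => lam _ [-> ->].
pose W p := exists2 F, gspan B F & iter N Th F = p.
have sW : subsp W.
  split=> [|a _ _ [F BF <-] [G BG <-]].
    by exists 0; [case: (gspan_subsp B) | exact: iter_der0].
  by exists (a *: F + G); [exact: (gspan_subsp B).2 | exact: iter_derP].
have gW : gstable W.
  split=> a b _ [F BF <-].
    by exists (L a b F); [exact: (gspan_gstable B).1 | rewrite (iter_comm (@L_Th _ _ _))].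
  by exists (R a b F); [exact: (gspan_gstable B).2 | rewrite (iter_comm (@R_Th _ _ _))].
have WM p : W p -> p \is (M + N).-homog.
  by move=> [F /BH[_ FM _] <-]; exact: Th_homog.
have WD p : W p -> Dn N p.
  by move=> [F /BH[FX _ FN] <-]; exact: Th_Dn.
have [w Ww dw] := orth_proj sW WM d.
pose W' p := orth W p /\ (Dn N p /\ p \is (M + N).-homog).
have sW' : subsp W'.
  apply: subsp_and; first exact: orth_subsp.
  by apply: subsp_and; [exact: Dn_subsp | exact: homog_subsp].
have gW' : gstable W'.
  apply: gstable_and; first exact: orth_gstable.
  apply: gstable_and; first by split=> a b p; [exact: Dn_L | exact: Dn_R].
  by split=> a b p; [exact: homog_L | exact: homog_R].
have W'dw : W' (d - w).
  split=> //; split; last by rewrite rpredB // WM.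
  by rewrite addrC -scaleN1r; apply: (Dn_subsp C n N).2 => //; exact: WD.
have [/eqP|dw0] := eqVneq (d - w) 0.
  by rewrite subr_eq0 => /eqP ->.
have [x [[xo [xD xM]] xn sx [f [g wx]]]] :=
  sing_exists sW' gW' (fun p h => h.2.2) (ex_intro2 _ _ _ W'dw dw0).
have [f0 gf fM] := sing_weight sx wx xn xD xM.
pose lam : {ffun 'I_n -> nat} := [ffun a => f a].
have lamE a : lam a = f a by rewrite ffunE.
have lamP : is_partition lam.
  apply/forallP => i; apply/forallP => j; apply/implyP; rewrite leq_eqVlt.
  move=> /orP[/eqP/val_inj->//|ij]; rewrite !lamE.
  exact: (sing_dominant sx wx xn).
have Bl : B lam.
  split; first by rewrite lamE.
  apply/eqP; rewrite -(eqn_add2r N) -fM; apply/eqP; congr (_ + _)%N.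
  by apply: eq_bigr => a _.
pose y := iter N Th (Delta C lam).
have Wy : W y by exists (Delta C lam) => //; exact: gspan_Delta.
have [y0 _] := Delta_Th C lamP; rewrite Bl.1 -/y in y0.
have sy : sing y by apply: sing_Th; exact: sing_Delta.
have wy : wt f g y.
  have [h1 h2] := wt_Th N (wt_Delta C lamP).
  by split=> a; [rewrite -lamE | rewrite gf -lamE].
have ey : ev zst y != 0.
  by apply: contra y0 => /eqP /(sing_unique sy wy (WD _ Wy)) ->.
(* With this c the combination vanishes at [zst], hence is zero by [sing_unique]. *)
pose c := - (ev zst x / ev zst y).
suff x0 : c *: y + x = 0.
  have Wx : W x.
    have -> : x = (- c) *: y + 0.
      by rewrite addr0 scaleNr; apply/eqP; rewrite -addr_eq0 addrC x0.
    by apply: sW.2 => //; case: sW.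
  by case/eqP: xn; apply: fis_eq0; exact: xo.
apply: (@sing_unique _ _ N f g).
- split=> a b ab; rewrite derD derZ.
    by rewrite (sx.1 _ _ ab) (sy.1 _ _ ab) scaler0 addr0.
  by rewrite (sx.2 _ _ ab) (sy.2 _ _ ab) scaler0 addr0.
- split=> a; apply: (wdeg_subsp C _ _).2; first exact: wy.1.
  - exact: wx.1.
  - exact: wy.2.
  - exact: wx.2.
- by apply: (Dn_subsp C n N).2 => //; exact: WD.
by rewrite evD evZ mulNr divfK // addrC subrr.
Qed.

(** Induction on K: by [Dn_generated], [iter K Th p] equals [iter K Th F] for some F generated by
    the [Delta] with lam_1 = K, and p - F is killed by one power less. *)
Lemma HH_gspan K M p :
  HH K M p -> gspan (fun lam => (lam ord0 < K)%N /\ (\sum_a lam a)%N = M) p.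
Proof.
elim: K p => [|K IH] p [Xp pM pK].
  by move: pK => /= ->; exact: (gspan_subsp _).1.
have [F BF FE] := Dn_generated (Th_Dn Xp pK) (Th_homog K pM).
have BF' : gspan (fun lam => (lam ord0 < K.+1)%N /\ (\sum_a lam a)%N = M) F.
  by apply: gspan_mono BF => lam _ [-> ->].
have [FX FM _] := gspan_HH BF'.
rewrite -[p](subrK F) -[p - F]scale1r; apply: (gspan_subsp _).2 => //.
apply: gspan_mono (IH (p - F) _) => [lam _ [lK ->]|]; first by rewrite ltnS ltnW.
split; last by rewrite -[p - F]addrC -scaleN1r iter_derP FE scaleN1r addNr.
  by rewrite addrC -scaleN1r; apply: XO_subsp.2.
by rewrite rpredB.
Qed.

End Generation.

(** * Extension from the traceless matrices *)

Section Descent.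
Variables (C : numClosedFieldType) (m : nat).
Notation n := m.+2.
Notation var := (var n).
Notation P := {mpoly C[#|var|]}.
Implicit Types (p q d : P) (a b i j : 'I_n) (t : var) (x : 'M[C]_n).

Definition trz : P := \sum_i zv C (X i i).
(** The trace of the rank one matrix v w, and at the same time [Th trz]. *)
Definition qq : P := \sum_i zv C (Vv i) * zv C (Ww i).

Definition XH M p := XO p /\ p \is M.-homog.

Lemma XH_subsp M : subsp (XH M).
Proof. apply: subsp_and; [exact: XO_subsp | exact: homog_subsp]. Qed.

Lemma XO_M p q : XO p -> XO q -> XO (p * q).
Proof.
move=> [p1 p2 p3] [q1 q2 q3]; split=> [|i|j]; rewrite dvM ?p1 ?p2 ?p3 ?q1 ?q2 ?q3;
  by rewrite mul0r mulr0 addr0.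
Qed.

Lemma XO_zX i j : XO (zv C (X i j)).
Proof. by split=> *; rewrite dv_z xpair_eqE ?andbF. Qed.

Lemma XH_zX i j : XH 1 (zv C (X i j)).
Proof. by split; [exact: XO_zX | rewrite dhomogX /= mdeg1]. Qed.

Lemma XH_trz : XH 1 trz.
Proof.
rewrite /trz; elim/big_rec: _ => [|i p _ Hp]; first exact: (XH_subsp 1).1.
by apply: subspD => //; [exact: XH_subsp | exact: XH_zX].
Qed.

Lemma XH_M M N p q : XH M p -> XH N q -> XH (M + N) (p * q).
Proof. by move=> [Xp Mp] [Xq Nq]; split; [exact: XO_M | exact: dhomogM]. Qed.

Lemma XH_trM M p : XH M p -> XH M.+1 (trz * p).
Proof. by move=> Xp; rewrite -add1n; apply: XH_M => //; exact: XH_trz. Qed.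

Lemma Th_trz : Th trz = qq.
Proof. by rewrite /trz der_sum; apply: eq_bigr => i _; rewrite der_z. Qed.

Lemma der_qq (g : var -> P) : (forall i, g (Vv i) = 0) -> (forall i, g (Ww i) = 0) ->
  der g qq = 0.
Proof.
move=> gv gw; rewrite /qq der_sum big1 // => i _.
by rewrite derM !der_z gv gw mul0r mulr0 addr0.
Qed.

Lemma Th_qq : Th qq = 0. Proof. exact: der_qq. Qed.

(** [Th] applied twice to [trz] gives 0, so two terms of the Leibniz formula survive. *)
Lemma iter_Th_tr N p : iter N.+1 Th (trz * p)
  = trz * iter N.+1 Th p + N.+1%:R *: (qq * iter N Th p).
Proof.
elim: N => [|N IH]; first by rewrite /= derM Th_trz scale1r addrC.
rewrite iterS IH derD derZ !derM Th_trz Th_qq mul0r add0r -iterS.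
by rewrite -[N.+2%:R]natr1 scalerDl scale1r -addrA addrC -addrA.
Qed.

(** Pseudo-division: modulo q, a factor c turns the variable t into - q', so after multiplication by
    a power of c the variable t can be eliminated from d. *)
Lemma elim_var t (c q q' : P) : c * zv C t = q - q' -> dv t q' = 0 -> dv t c = 0 ->
  forall d, exists r g f, c ^+ r * d = q * g + f /\ dv t f = 0.
Proof.
move=> ct q'0 c0; have cX r : dv t (c ^+ r) = 0.
  by elim: r => [|r IH]; rewrite ?expr0 ?dv1 // exprS dvM c0 IH mul0r mulr0 addr0.
apply: poly_ind_zv => [a|s|d d'|d d'].
- by exists 0%N, 0, a%:MP; rewrite mul1r mulr0 add0r dvC.
- have [->|st] := eqVneq s t.
    by exists 1%N, 1, (- q'); rewrite expr1 mulr1 ct linearN /= q'0 oppr0.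
  exists 0%N, 0, (zv C s); rewrite mul1r mulr0 add0r dv_z.
  by rewrite eq_sym (negPf st).
- move=> [r [g [f [E f0]]]] [r' [g' [f' [E' f0']]]].
  exists (r + r')%N, (c ^+ r' * g + c ^+ r * g'), (c ^+ r' * f + c ^+ r * f').
  split; last by rewrite linearD /= !dvM !cX f0 f0' !mul0r !mulr0 !addr0.
  rewrite exprD mulrDr -mulrA [c ^+ r' * d]mulrC mulrA E -mulrA E'.
  by ring.
- move=> [r [g [f [E f0]]]] [r' [g' [f' [E' f0']]]].
  exists (r + r')%N, (g * (q * g' + f') + f * g'), (f * f').
  split; last by rewrite dvM f0 f0' mul0r mulr0 addr0.
  by rewrite exprD mulrACA E E'; ring.
Qed.

Notation v0 := (Vv ord0 : var).
Notation w0 := (Ww ord0 : var).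
Notation wl := (Ww ord_max : var).

Definition qq' : P := \sum_(i | i != ord0) zv C (Vv i) * zv C (Ww i).

Lemma qqE : qq = zv C v0 * zv C w0 + qq'.
Proof. by rewrite /qq (bigD1 ord0). Qed.

Lemma ev_qq z : ev z qq = \sum_i z (Vv i) * z (Ww i).
Proof. by rewrite ev_sum; apply: eq_bigr => i _; rewrite evM !ev_z. Qed.

Lemma qq'_indep t : t.1 \in [:: Some ord0; None] -> t.2 \in [:: Some ord0; None] ->
  dv t qq' = 0.
Proof.
move=> t1 t2; rewrite linear_sum big1 //= => i i0.
rewrite dvM !dv_z; have -> : (t == Vv i) = false.
  by apply: contraNF i0 => /eqP E; move: t1; rewrite E !inE orbF.
have -> : (t == Ww i) = false.
  by apply: contraNF i0 => /eqP E; move: t2; rewrite E !inE orbF.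
by rewrite mul0r mulr0 addr0.
Qed.

Lemma qq'_neq0 : qq' != 0.
Proof.
pose z : var -> C := fun t => ((t == Vv ord_max) || (t == wl))%:R.
suff : ev z qq' != 0 by apply: contraNneq => ->; rewrite ev0.
rewrite ev_sum (bigD1 ord_max) //= big1 => [|i /andP[_ im]].
  by rewrite evM !ev_z /z !eqxx /= ?orbT mulr1 addr0 oner_neq0.
rewrite evM !ev_z /z !xpair_eqE /=.
by rewrite (_ : (Some i == Some ord_max) = (i == ord_max)) // (negPf im) mul0r.
Qed.

Lemma zv_neq0 t : zv C t != 0.
Proof.
suff : ev (fun=> 1) (zv C t) != 0 by apply: contraNneq => ->; rewrite ev0.
by rewrite ev_z oner_neq0.
Qed.

Lemma qq_neq0 : qq != 0.
Proof.
apply: contraNneq qq'_neq0 => q0; apply/eqP/ev_eq0 => z.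
rewrite (@ev_indep _ _ z (fun t => if t == w0 then 0 else z t) w0) => [||t /negPf->] //.
  have := ev0 (fun t => if t == w0 then 0 else z t); rewrite -q0 qqE evD evM !ev_z eqxx.
  by rewrite mulr0 add0r.
exact: qq'_indep.
Qed.

(** The equation v_0 w_0 = qq - qq' eliminates w_0. The remainder f is zero, because any values of
    the other variables with v_0 nonzero extend to a point of the quadric. The powers of v_0 are
    then cancelled, [qq'] being a nonzero polynomial without v_0. *)
Lemma qq_dvd d :
  (forall z, z v0 != 0 -> z wl != 0 -> \sum_i z (Vv i) * z (Ww i) = 0 -> ev z d = 0) ->
  exists d1, d = qq * d1.
Proof.
move=> d0.
have [r [g [f [E f0]]]] : exists r g f, zv C v0 ^+ r * d = qq * g + f /\ dv w0 f = 0.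
  apply: (@elim_var w0 (zv C v0) qq qq' _ _ _ d).
  - by rewrite qqE addrK.
  - exact: qq'_indep.
  - by rewrite dv_z.
have fE : f = 0.
  have /eqP : zv C v0 * zv C wl * f = 0.
    apply: ev_eq0 => z; rewrite !evM !ev_z.
    have [->|zv0] := eqVneq (z v0) 0; first by rewrite !mul0r.
    have [->|zwl] := eqVneq (z wl) 0; first by rewrite mulr0 mul0r.
    (* The value of w_0 that puts the point on the quadric. The last entry of w keeps its nonzero
       value, since n >= 2 makes it distinct from w_0. *)
    pose z' t := if t == w0 then - ev z qq' / z v0 else z t.
    have fz : ev z f = ev z' f by apply: (ev_indep f0) => t /negPf tw; rewrite /z' tw.
    have qz : ev z' qq' = ev z qq'.
      by apply: (@ev_indep _ _ _ _ w0); [exact: qq'_indep | move=> t /negPf tw; rewrite /z' tw].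
    have qz0 : ev z' qq = 0.
      by rewrite qqE evD evM !ev_z /z' eqxx /= mulrC divfK // -/z' qz addNr.
    have : ev z' (zv C v0 ^+ r * d) = 0.
      by rewrite evM d0 ?mulr0 // -ev_qq.
    by rewrite E evD evM qz0 mul0r add0r fz => ->; rewrite mulr0.
  by rewrite !mulf_eq0 !(negPf (zv_neq0 _)) /= => /eqP.
move: E; rewrite fE addr0; elim: r g => [|r IH] g; first by rewrite mul1r => ->; exists g.
move=> E.
have [s [g' [g0 [Eg g00]]]] : exists s g' g0, 1 ^+ s * g = zv C v0 * g' + g0 /\ dv v0 g0 = 0.
  (* With c = 1 and q' = 0 this is plain division by v_0. *)
  apply: (@elim_var v0 1 (zv C v0) 0 _ _ _ g).
  - by rewrite mul1r subr0.
  - exact: linear0.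
  - exact: dv1.
rewrite expr1n mul1r in Eg.
have g0E : g0 = 0.
  have /eqP : qq' * g0 = 0.
    apply: ev_eq0 => z; pose z' t := if t == v0 then 0 else z t.
    have -> : ev z (qq' * g0) = ev z' (qq' * g0).
      apply: (@ev_indep _ _ _ _ v0).
        by rewrite dvM g00 qq'_indep // mul0r mulr0 addr0.
      by move=> t /negPf tv; rewrite /z' tv.
    have zv0 : z' v0 = 0 by rewrite /z' eqxx.
    have := congr1 (ev z') E.
    rewrite Eg qqE exprS !(evM, evD) !ev_z zv0 !mul0r !add0r => <-.
    by [].
  by rewrite mulf_eq0 (negPf qq'_neq0) => /eqP.
apply: (IH g'); apply: (mulfI (zv_neq0 v0)).
by rewrite mulrA -exprS E Eg g0E addr0 mulrCA.
Qed.

Lemma qq_wdeg (S : pred var) k :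
  (forall i, S (Vv i) + S (Ww i) = k)%N -> wdeg S k qq.
Proof.
move=> Sk; rewrite /wdeg /qq der_sum scaler_sumr; apply: eq_bigr => i _.
rewrite derM !der_z !eulgE -scalerAl -scalerAr -scalerDl -natrD.
by rewrite Sk.
Qed.

Lemma wdeg_qqK (S : pred var) k l d :
  wdeg S k qq -> wdeg S (k + l) (qq * d) -> wdeg S l d.
Proof.
move=> qk; rewrite /wdeg derM qk natrD scalerDl -scalerAl => /addrI.
by rewrite scalerAr => /(mulfI qq_neq0).
Qed.

Lemma Dn_qqK N d : Dn N.+1 (qq * d) -> Dn N d.
Proof.
have K (g : var -> P) : (forall i, g (Vv i) = 0) -> (forall i, g (Ww i) = 0) ->
    der g (qq * d) = 0 -> der g d = 0.
  move=> gv gw; rewrite derM der_qq // mul0r add0r => /eqP.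
  by rewrite mulf_eq0 (negPf qq_neq0) => /eqP.
move=> [d0 da db dv dw]; split=> [|j|i||].
- by move: d0; rewrite !dvE; apply: K => i.
- by apply: K (da j).
- by apply: K (db i).
- by apply: (@wdeg_qqK _ 1) => //; apply: qq_wdeg.
- by apply: (@wdeg_qqK _ 1) => //; apply: qq_wdeg.
Qed.

(* The condition below says that p has degree less than N along every
   rank one direction c = v w in the hyperplane of traceless matrices. *)
Definition nilcond N p := forall c : 'M[C]_n, (exists (v w : 'I_n -> C),
    [/\ forall i j, c i j = v i * w j, v ord0 = 1, w ord_max = 1
      & \sum_i v i * w i = 0]) -> iter N (der (cg c)) p = 0.

Lemma ev_trz z : ev z trz = \sum_i z (X i i).
Proof. by rewrite ev_sum; apply: eq_bigr => i _; rewrite ev_z. Qed.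

Lemma der_trz (c : 'M[C]_n) : der (cg c) trz = (\tr c)%:MP.
Proof.
rewrite /trz der_sum /mxtrace raddf_sum; apply: eq_bigr => i _.
by rewrite der_z.
Qed.

Lemma iter_cg_trz (c : 'M[C]_n) N p : \tr c = 0 ->
  iter N (der (cg c)) (trz * p) = trz * iter N (der (cg c)) p.
Proof.
move=> c0; elim: N => //= N ->.
by rewrite derM der_trz c0 mpolyC0 mul0r add0r.
Qed.

(** Rescaling makes v_0 and the last entry of w equal to 1, as [nilcond] asks. The flow of [ag] then
    moves x to a traceless matrix without changing the value. There the term [trz * E] contributes
    nothing, and p contributes 0 by hypothesis. *)
Lemma descent_vanish N F p E z : XO F -> iter N.+1 Th F = 0 ->
  F = p + trz * E -> nilcond N p ->
  z v0 != 0 -> z wl != 0 -> \sum_i z (Vv i) * z (Ww i) = 0 ->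
  ev z (iter N Th F) = 0.
Proof.
move=> FX FN FE pN zv0 zwl zvw.
have [_ da _ dv dw] := Th_Dn FX FN; set d := iter N Th F in da dv dw *.
have := ev_scale z (z v0)^-1 dv.
have := ev_scale (fun t => if vS t then (z v0)^-1 * z t else z t) (z wl)^-1 dw.
set z1 := fun t => if wS t then _ else _.
suff -> : ev z1 d = 0.
  move=> /esym/eqP; rewrite mulf_eq0 expf_eq0 invr_eq0 (negPf zwl) andbF /= => /eqP ->.
  by move=> /esym/eqP; rewrite mulf_eq0 expf_eq0 invr_eq0 (negPf zv0) andbF /= => /eqP.
have z1v i : z1 (Vv i) = (z v0)^-1 * z (Vv i) by [].
have z1w i : z1 (Ww i) = (z wl)^-1 * z (Ww i) by [].
have z1vw : \sum_i z1 (Vv i) * z1 (Ww i) = 0.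
  under eq_bigr => i _ do rewrite z1v z1w mulrACA.
  by rewrite -mulr_sumr zvw mulr0.
have {z1v} v1 : z1 v0 = 1 by rewrite z1v mulVf.
have {z1w} w1 : z1 wl = 1 by rewrite z1w mulVf.
clearbody z1; clear z zv0 zwl zvw; rename z1 into z.
(* Adding - tr x times v to column 0 changes the trace by - tr x, because v_0 = 1. *)
rewrite -(@ev_ag _ _ (fun j => if j == ord0 then - ev z trz else 0)) //.
set z' := fun t => _.
pose c : 'M[C]_n := \matrix_(i, j) (z (Vv i) * z (Ww j)).
have c0 : \tr c = 0 by rewrite /mxtrace -[RHS]z1vw; apply: eq_bigr => i _; rewrite mxE.
rewrite /d (@ev_iterTh _ _ z' c); last by move=> i j; rewrite mxE.
rewrite FE iter_derD pN; last first.
  by exists (fun i => z (Vv i)), (fun i => z (Ww i)); split=> // i j; rewrite mxE.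
rewrite iter_cg_trz // add0r evM ev_trz.
rewrite (eq_bigr (fun i => z (X i i) + (if i == ord0 then - ev z trz else 0))) => [|i _].
  by rewrite big_split -ev_trz /= -big_mkcond big_pred1_eq /= subrr mul0r.
rewrite /z' /=; case: eqP => [->|_]; last by rewrite mul0r.
by rewrite v1 mulr1.
Qed.

(** By [descent_vanish] and [qq_dvd] the top power of [Th] on F is [qq] times some d1. This d1
    solves [Dn N], so it is [iter N Th G] for some G. Since [iter N.+1 Th (trz * G)] is N.+1 times
    [qq * iter N Th G], the constant c makes the two cancel. *)
Lemma descent_step M N p F E : XH M.+1 p -> nilcond N.+1 p ->
  HH N.+2 M.+1 F -> XH M E -> F = p + trz * E ->
  exists F' E', [/\ HH N.+1 M.+1 F', XH M E' & F' = p + trz * E'].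
Proof.
move=> Xp pN [FX FM FN] XE FE.
have [d1 dE] := qq_dvd (fun z => descent_vanish FX FN FE pN (z := z)).
have Dd := Th_Dn FX FN; rewrite dE in Dd.
have dM := Th_homog N.+1 FM; rewrite dE in dM.
have d1M : d1 \is (M + N).-homog.
  apply/wdegT_homog/(@wdeg_qqK _ 2); first exact: qq_wdeg.
  by move/wdegT_homog: dM; rewrite (_ : (M.+1 + N.+1 = 2 + (M + N))%N) //; lia.
have [G BG GE] := Dn_generated (Dn_qqK Dd) d1M.
have [GX GM GN] : HH N.+1 M G.
  by apply: gspan_HH; apply: gspan_mono BG => lam _ [-> ->].
pose c : C := - N.+1%:R^-1.
have XG : XH M G by [].
exists (c *: (trz * G) + F), (c *: G + E); split.
- have [XG' MG'] := XH_trM XG; split; first exact: (XO_subsp C _).2.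
    by rewrite rpredD ?rpredZ.
  rewrite iter_derP iter_Th_tr GN mulr0 add0r dE GE scalerA /c.
  by rewrite mulNr mulVf ?pnatr_eq0 // scaleN1r addNr.
- exact: (XH_subsp M).2.
- by rewrite FE mulrDr -scalerAr addrCA addrA addrAC -addrA addrCA.
Qed.

Lemma descent M K p : XH M.+1 p -> (forall N, (K < N)%N -> nilcond N p) ->
  exists F E, [/\ HH K.+1 M.+1 F, XH M E & F = p + trz * E].
Proof.
move=> Xp pN.
suff H N : (K <= N)%N -> (exists F E, [/\ HH N.+1 M.+1 F, XH M E & F = p + trz * E]) ->
    exists F E, [/\ HH K.+1 M.+1 F, XH M E & F = p + trz * E].
  apply: (H (maxn K M.+1)); first exact: leq_maxl.
  exists p, 0; split; [|exact: (XH_subsp M).1|by rewrite mulr0 addr0].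
  split; [by case: Xp|by case: Xp|].
  apply: (@iterTh_le _ _ M.+2); first by rewrite ltnS leq_maxr.
  by apply: Th_nil; case: Xp.
elim: N => [|N IH]; first by rewrite leqn0 => /eqP->.
rewrite leq_eqVlt => /orP[/eqP->//|KN] [F [E [FH EH FE]]]; apply: IH => //.
exact: (descent_step Xp (pN _ KN) FH EH FE).
Qed.

End Descent.

Lemma subsp_bigsum (F : fieldType) (M : lmodType F) (W : M -> Prop) (I : Type)
    (r : seq I) (Q : pred I) (G : I -> M) :
  subsp W -> (forall i, Q i -> W (G i)) -> W (\sum_(i <- r | Q i) G i).
Proof.
move=> [W0 WP] WG; elim/big_rec: _ => // i x Qi Wx.
by rewrite -[G i]scale1r; apply: WP => //; exact: WG.
Qed.

(** * S(sl) inside the polynomials in the matrix entries *)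

Section Iota.
Variables (C : numClosedFieldType) (m : nat).
Notation n := m.+2.
Notation var := (var n).
Notation P := {mpoly C[#|var|]}.
Notation sln := (sl C n).
Notation d := (\dim {:sln}).
Notation bas := (vbasis {:sln}).
Notation S := {mpoly C[d]}.
Implicit Types (p q : P) (s : S) (a b i j : 'I_n) (t : var) (x y e : 'M[C]_n).
Notation trz := (@trz C m).
Notation XH := (@XH C m).

(** Elements of gl become linear forms in x, so that the adjoint action is [Dg], the diagonal of the
    left and right actions. *)
Definition ell y : P := \sum_i \sum_j y i j *: zv C (X i j).

Lemma ell_linear : linear ell.
Proof.
move=> c x y; rewrite /ell scaler_sumr -big_split; apply: eq_bigr => i _.
rewrite scaler_sumr -big_split; apply: eq_bigr => j _ /=.
by rewrite !mxE scalerDl scalerA.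
Qed.
HB.instance Definition _ := GRing.isLinear.Build C 'M[C]_n P _ ell ell_linear.

Lemma ell_delta i j : ell (delta_mx i j) = zv C (X i j).
Proof.
rewrite /ell (bigD1 i) //= (bigD1 j) //= mxE !eqxx scale1r.
rewrite !big1 ?addr0 // => [k /negPf ki|k /negPf kj]; last first.
  by rewrite mxE kj andbF scale0r.
by apply: big1 => l _; rewrite mxE ki scale0r.
Qed.

Lemma ell1 : ell 1%:M = trz.
Proof.
apply: eq_bigr => i _; rewrite (bigD1 i) //= mxE eqxx scale1r big1 ?addr0 //.
by move=> j ji; rewrite mxE eq_sym (negPf ji) scale0r.
Qed.

Lemma XH_ell y : XH 1 (ell y).
Proof.
rewrite /ell; elim/big_rec: _ => [|i p _ Hp]; first exact: (XH_subsp C m 1).1.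
apply: subspD => //; first exact: XH_subsp.
by apply: subsp_sum; [exact: XH_subsp | move=> j; exact: XH_zX].
Qed.

Lemma der_ell (g : var -> P) y : der g (ell y) = \sum_i \sum_j y i j *: g (X i j).
Proof.
rewrite der_sum; apply: eq_bigr => i _; rewrite der_sum; apply: eq_bigr => j _.
by rewrite derZ der_z.
Qed.

Definition Dg x t : P := Lg x t + Rg x t.

Lemma DgE x p : der (Dg x) p = der (Lg x) p + der (Rg x) p.
Proof. by rewrite /der -big_split; apply: eq_bigr => t _; rewrite mulrDl. Qed.

Lemma L_ell x y : der (Lg x) (ell y) = ell (x *m y).
Proof.
rewrite der_ell exchange_big [RHS]exchange_big; apply: eq_bigr => j _ /=.
under eq_bigr => i _ do rewrite Lg_some scaler_sumr.
rewrite exchange_big; apply: eq_bigr => i _ /=; rewrite mxE scaler_suml.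
by apply: eq_bigr => k _; rewrite scalerA mulrC.
Qed.

Lemma R_ell x y : der (Rg x) (ell y) = - ell (y *m x).
Proof.
rewrite der_ell /ell -sumrN; apply: eq_bigr => i _ /=.
under eq_bigr => j _ do rewrite Rg_some scalerN scaler_sumr.
rewrite sumrN exchange_big; congr (- _); apply: eq_bigr => j _ /=.
by rewrite mxE scaler_suml; apply: eq_bigr => k _; rewrite scalerA.
Qed.

Lemma D_ell x y : der (Dg x) (ell y) = ell (mxbracket x y).
Proof. by rewrite DgE L_ell R_ell /mxbracket linearB. Qed.

Lemma D_trz x : der (Dg x) trz = 0.
Proof. by rewrite -ell1 D_ell /mxbracket mulmx1 mul1mx subrr linear0. Qed.

Lemma cg_ell (c : 'M[C]_n) y : der (cg c) (ell y) = (\sum_i \sum_j y i j * c i j)%:MP.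
Proof.
rewrite der_ell raddf_sum; apply: eq_bigr => i _; rewrite raddf_sum.
by apply: eq_bigr => j _ /=; rewrite mpolyCM mul_mpolyC.
Qed.

Lemma fis_ell e p q :
  fis (ell e * p) q = fis p (der (cg (map_mx Num.conj e)) q).
Proof.
rewrite /ell mulr_suml fis_suml /der var_sum fisDr [X in _ = X + _](_ : _ = 0).
  rewrite add0r fis_sumr; apply: eq_bigr => i _.
  rewrite mulr_suml fis_suml mul0r add0r fis_sumr; apply: eq_bigr => j _.
  by rewrite -scalerAl fisZl fis_zv mul_mpolyC fisZr mxE conjCK.
by rewrite mul0r add0r big1 ?fis0r // => j _; rewrite mul0r.
Qed.

Definition iota s : P := mmap (@mpolyC _ C) (fun k => ell (vsval bas`_k)) s.

Lemma iotaC c : iota c%:MP = c%:MP. Proof. exact: mmapC. Qed.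
Lemma iotaX k : iota 'X_k = ell (vsval bas`_k).
Proof. by rewrite /iota mmapX mmap1U. Qed.
Lemma iotaM s s' : iota (s * s') = iota s * iota s'.
Proof. exact: (rmorphM (mmap _ _)). Qed.
Lemma iotaD s s' : iota (s + s') = iota s + iota s'.
Proof. exact: (raddfD (mmap _ _)). Qed.
Lemma iotaB s s' : iota (s - s') = iota s - iota s'.
Proof. exact: (raddfB (mmap _ _)). Qed.
Lemma iotaZ c s : iota (c *: s) = c *: iota s.
Proof. by rewrite -mul_mpolyC iotaM iotaC mul_mpolyC. Qed.
Lemma iota_sum (I : Type) (r : seq I) (Q : pred I) (F : I -> S) :
  iota (\sum_(k <- r | Q k) F k) = \sum_(k <- r | Q k) iota (F k).
Proof. exact: (raddf_sum (mmap _ _)). Qed.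
Lemma iota0 : iota 0 = 0. Proof. exact: (raddf0 (mmap _ _)). Qed.
Lemma iotaXn s k : iota (s ^+ k) = iota s ^+ k.
Proof. exact: (rmorphXn (mmap _ _)). Qed.

Lemma iota_sym_inj (v : sln) : iota (sym_inj v) = ell (vsval v).
Proof.
rewrite {2}(coord_vbasis (memvf v)) /sym_inj iota_sum !linear_sum.
by apply: eq_bigr => k _; rewrite iotaZ iotaX !linearZ.
Qed.

Lemma iota_der (g : var -> P) s :
  der g (iota s) = \sum_k iota s^`M(k) * der g (ell (vsval bas`_k)).
Proof.
rewrite /iota (@mmap_chain _ _ _ (@mpolyC _ C) _ (der g)) //.
  by move=> p q; exact: derM.
by move=> c; exact: derC.
Qed.

Lemma iota_sym_fun (x : sln) s :
  iota (sym_fun (adjoint_action sln) x s) = der (Dg (vsval x)) (iota s).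
Proof.
rewrite iota_der /sym_fun iota_sum; apply: eq_bigr => k _.
rewrite iotaM iota_sym_inj mulrC D_ell; congr (_ * ell _).
exact: sl_bracketE.
Qed.

Lemma XO_iota s : XO (iota s).
Proof.
elim/mpoly_ring_ind: s => [c|k|s s' Hs Hs'|s s' Hs Hs'].
- by rewrite iotaC; split=> *; rewrite dvC.
- by rewrite iotaX; case: (XH_ell (vsval bas`_k)).
- by rewrite iotaD; apply: subspD => //; exact: XO_subsp.
- by rewrite iotaM; exact: XO_M.
Qed.

Lemma iota_homog M s : s \is M.-homog -> XH M (iota s).
Proof.
move=> /dhomogP sM; split; first exact: XO_iota.
rewrite /iota /mmap big_seq; apply: rpred_sum => mm /sM /= <-.
rewrite mul_mpolyC rpredZ // /mmap1 mdegE.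
elim/big_rec2: _ => [|k p N _ IH]; first exact: dhomog1.
apply: dhomogM => //; rewrite -[X in X.-homog]mul1n; apply: dhomogMn.
by case: (XH_ell (vsval bas`_k)).
Qed.

(** A left inverse of [iota], which proves its injectivity: x_ab goes to the image of E_ab under a
    projection onto sl. *)
Definition kap p : S := mmap (@mpolyC _ C) (fun k => match enum_val k : var with
  | (Some a, Some b) => sym_inj (vsproj (sl_space C n) (delta_mx a b) : sln)
  | _ => 0 end) p.

Lemma kap_ell (v : sln) : kap (ell (vsval v)) = sym_inj v.
Proof.
have -> : v = vsproj (sl_space C n) (vsval v) by rewrite vsvalK.
rewrite {1}vsvalK [in RHS](matrix_sum_delta (vsval v)) /ell /kap raddf_sum.
rewrite !linear_sum; apply: eq_bigr => i _; rewrite raddf_sum !linear_sum.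
apply: eq_bigr => j _; rewrite !linearZ /= mmapZ mul_mpolyC; congr (_ *: _).
by rewrite /zv mmapX mmap1U enum_rankK.
Qed.

Lemma sym_inj_bas (k : 'I_d) : sym_inj bas`_k = 'X_k.
Proof.
rewrite /sym_inj (bigD1 k) //= coord_free ?eqxx ?scale1r; last first.
  exact: (basis_free (vbasisP _)).
rewrite big1 ?addr0 // => l lk; rewrite coord_free 1?eq_sym ?(negPf lk) ?scale0r //.
exact: (basis_free (vbasisP _)).
Qed.

Lemma iotaK : cancel iota kap.
Proof.
elim/mpoly_ring_ind=> [c|k|s s' Hs Hs'|s s' Hs Hs'].
- by rewrite iotaC /kap mmapC.
- by rewrite iotaX kap_ell sym_inj_bas.
- by rewrite iotaD /kap raddfD /= -!/(kap _) Hs Hs'.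
- by rewrite iotaM /kap rmorphM /= -!/(kap _) Hs Hs'.
Qed.

(** Multiplication by [trz] is adjoint to differentiation along the identity matrix, which kills
    every linear form with traceless coefficients. *)
Lemma orth_trz_iota p s : fis (trz * p) (iota s) = 0.
Proof.
rewrite -ell1 fis_ell iota_der big1 ?fis0r // => k _; rewrite cg_ell.
have : \tr (vsval bas`_k) == 0 by rewrite -mem_sl subvsP.
move=> /eqP tr0; rewrite [X in X%:MP](_ : _ = 0) ?mpolyC0 ?mulr0 //.
rewrite -[RHS]tr0; apply: eq_bigr => i _; rewrite (bigD1 i) //= !mxE eqxx.
rewrite conjC1 mulr1 big1 ?addr0 // => j ji.
by rewrite !mxE eq_sym (negPf ji) conjC0 mulr0.
Qed.

Lemma mxtrace_delta a b : \tr (delta_mx a b : 'M[C]_n) = (a == b)%:R.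
Proof.
rewrite /mxtrace (bigD1 a) //= mxE eqxx big1 ?addr0 // => i /negPf ia.
by rewrite mxE ia.
Qed.

Lemma zX_decomp a b : exists (v : sln) (c : C),
  zv C (X a b) = iota (sym_inj v) + c *: trz.
Proof.
pose c : C := (a == b)%:R / n%:R; pose y : 'M[C]_n := delta_mx a b - c *: 1%:M.
have ysl : y \in sl_space C n.
  rewrite mem_sl raddfB /= linearZ /= mxtrace1 mxtrace_delta /c.
  by rewrite divfK ?subrr // pnatr_eq0.
exists (vsproj _ y), c; rewrite iota_sym_inj vsprojK // linearB linearZ /= ell1 ell_delta.
by rewrite subrK.
Qed.

(** Splitting of a form into a part from S(sl) and a multiple of [trz]. In degree 0, where [M.-1] is
    again 0, the third clause excludes a nonzero q. *)
Definition decomp M p := exists s q,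
  [/\ s \is M.-homog, XH M.-1 q, M = 0%N -> q = 0 & p = iota s + trz * q].

Lemma decomp_subsp M : subsp (decomp M).
Proof.
split=> [|c _ _ [s [q [sM qM q0 ->]]] [s' [q' [sM' qM' q0' ->]]]].
  by exists 0, 0; split; rewrite ?rpred0 ?iota0 ?mulr0 ?addr0 //; exact: (XH_subsp _ _ _).1.
exists (c *: s + s'), (c *: q + q'); split.
- by rewrite rpredD ?rpredZ.
- exact: (XH_subsp _ _ _).2.
- by move=> M0; rewrite q0 // q0' // scaler0 addr0.
by rewrite iotaD iotaZ scalerDr mulrDr -scalerAr addrACA.
Qed.

Lemma euler M p : p \is M.-homog -> XO p ->
  M%:R *: p = \sum_i \sum_j zv C (X i j) * dv (X i j) p.
Proof.
move=> /wdegT_homog pM [p0 pv pw]; rewrite -pM /der var_sum.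
rewrite p0 mulr0 add0r [X in X + _]big1 ?add0r => [|j _]; last by rewrite pw mulr0.
by apply: eq_bigr => i _; rewrite pv mulr0 add0r.
Qed.

Lemma XH_dvX M i j p : XH M.+1 p -> XH M (dv (X i j) p).
Proof.
move=> [[p0 pv pw] pM]; split.
  by split=> [|k|k]; rewrite /dv mderiv_comm -!/(dv _ _) ?p0 ?pv ?pw linear0.
apply/dhomogP => mm; rewrite mcoeff_msupp mcoeff_deriv => h.
have : (mm + U_(enum_rank (X i j)))%MM \in msupp p.
  by rewrite mcoeff_msupp; apply: contra h => /eqP->; rewrite mul0rn.
by move/dhomogP: pM => h' /h' /=; rewrite mdegD mdeg1 addn1 => -[].
Qed.

(** Induction on the degree through Euler's formula: p is a combination of products of x_ij with
    partial derivatives of p, and x_ij splits by [zX_decomp]. *)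
Lemma XH_decomp M p : XH M p -> decomp M p.
Proof.
elim: M p => [|M IH] p Xp.
  have [Xp0 p0] := Xp; exists (p@_0%MM)%:MP, 0.
  split; [by rewrite -alg_mpolyC rpredZ // dhomog1|exact: (XH_subsp _ _ _).1|by []|].
  rewrite mulr0 addr0 iotaC; apply: msize1_polyC.
  exact: homog_msize p0.
have [XO_p pM] := Xp.
have -> : p = M.+1%:R^-1 *: (M.+1%:R *: p) by rewrite scalerA mulVf ?pnatr_eq0 // scale1r.
have sD := decomp_subsp M.+1; have [d0 dP] := sD.
rewrite (euler pM XO_p) -[_ *: _]addr0; apply: dP => //.
apply: subsp_bigsum => // i _; apply: subsp_bigsum => // j _.
have [s [q [sM qM q0 E]]] := IH _ (XH_dvX i j Xp).
have [v [c zE]] := zX_decomp i j.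
exists (sym_inj v * s), (c *: iota s + zv C (X i j) * q); split=> //.
- by apply: (dhomogM (d := 1)); [exact: sym_inj_homog|].
- apply: (XH_subsp _ _ _).2; first exact: iota_homog.
  case: (M) q0 qM => [-> // _|M' _ qM']; first by rewrite mulr0; exact: (XH_subsp _ _ _).1.
  by apply: (@XH_M _ _ 1); [exact: XH_zX|].
by rewrite iotaM E zE -!mul_mpolyC; ring.
Qed.

End Iota.

(* The curve (A + s B + s^2 E)^K is an integral curve of D, hence its
   coefficients are obtained from A^K by iterating D. *)
Lemma curve_mem (F : numFieldType) N (D : {linear {mpoly F[N]} -> {mpoly F[N]}})
    (W : {mpoly F[N]} -> Prop) (A B E : {mpoly F[N]}) K :
  (forall p q, D (p * q) = D p * q + p * D q) ->
  subsp W -> (forall p, W p -> W (D p)) ->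
  D A = B -> D B = E *+ 2 -> D E = 0 -> W (A ^+ K) -> W ((A + B + E) ^+ K).
Proof.
move=> DM sW WD DA DB DE WA.
(* The equation dp/ds = D p, coefficient by coefficient. *)
pose Q (p : {poly {mpoly F[N]}}) := forall i, p`_i.+1 *+ i.+1 = D p`_i.
have D1 : D 1 = 0.
  by have /eqP := DM 1 1; rewrite !mulr1 mul1r -subr_eq0 opprD addNKr oppr_eq0 => /eqP.
have Q1 : Q 1 by move=> [|i]; rewrite !coefC /= mul0rn ?linear0 ?D1.
have QM p q : Q p -> Q q -> Q (p * q).
  move=> Qp Qq i; rewrite -coef_deriv derivM coefD !coefM linear_sum -big_split.
  apply: eq_bigr => j _ /=.
  by rewrite !coef_deriv Qp Qq DM.
pose c : {poly {mpoly F[N]}} := A%:P + B%:P * 'X + E%:P * 'X^2.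
have cE : c = \poly_(i < 3) (nth 0 [:: A; B; E] i).
  apply/polyP => i; rewrite /c !coefD coefC coefMX coefC coefMXn coefC coef_poly.
  by case: i => [|[|[|i]]] /=; rewrite ?addr0 ?add0r ?subnn //= ?addr0 ?add0r.
have Qc : Q c.
  move=> i; rewrite cE !coef_poly.
  by case: i => [|[|[|i]]] /=; rewrite ?mul0rn ?linear0 ?DA ?DB ?DE.
have QcK k : Q (c ^+ k) by elim: k => [|k IH]; rewrite ?expr0 // exprS; exact: QM.
have c1 : (c ^+ K).[1] = (A + B + E) ^+ K.
  by rewrite horner_exp /c !(hornerD, hornerM, hornerC, hornerX, hornerXn) !mulr1.
rewrite -c1 horner_coef; apply: subsp_bigsum => // i _; rewrite expr1n mulr1.
elim: {i}(i : nat) => [|i IH].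
  rewrite -horner_coef0 horner_exp /c !(hornerD, hornerM, hornerC, hornerX, hornerXn).
  by rewrite !mulr0 !addr0.
have -> : (c ^+ K)`_i.+1 = i.+1%:R^-1 *: D (c ^+ K)`_i + 0.
  by rewrite addr0 -(QcK K) -[X in _ *: X]scaler_nat scalerA mulVf ?pnatr_eq0 // scale1r.
by apply: sW.2; [exact: WD | exact: sW.1].
Qed.

(** * Rank one nilpotents in the orbit of [e_theta] *)

Section Orbit.
Variables (C : numClosedFieldType) (m : nat).
Notation n := m.+2.
Notation sln := (sl C n).
Notation sact := (sym_action (adjoint_action sln)).

Lemma submodule_subsp (L : lieAlgebra C) (M : lmodType C) (rho : lie_action L M)
  (N : submodule rho) : subsp (fun v => v \in sub_mem N).
Proof. by split=> [|a u v uN vN]; rewrite ?rpred0 // rpredD ?rpredZ. Qed.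

(** When x x = 0, the exponential of s x is 1 + s x, and conjugation by it sends e to e + s [x, e] -
    s^2 x e x. This is a quadratic curve, to which [curve_mem] applies. *)
Lemma conj_mem (N : submodule sact) K (x e : sln) (e' : 'M[C]_n) :
  vsval x *m vsval x = 0 ->
  (1%:M + vsval x) *m vsval e *m (1%:M - vsval x) = e' ->
  sym_inj e ^+ K \in sub_mem N ->
  sym_inj (vsproj (sl_space C n) e' : sln) ^+ K \in sub_mem N.
Proof.
move=> xx ee; set X := vsval x in xx ee; set Y := vsval e in ee.
pose f : sln := vsproj (sl_space C n) (- (X *m Y *m X)).
have fE : vsval f = - (X *m Y *m X).
  rewrite vsprojK // mem_sl raddfN /= mxtrace_mulC mulmxA xx mul0mx raddf0 oppr0.
  by rewrite eqxx.
have -> : vsproj (sl_space C n) e' = e + bracket x e + f :> sln.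
  apply: (can_inj (@vsvalK _ _ _)); rewrite !linearD /= fE sl_bracketE.
  have -> : vsval (vsproj (sl_space C n) e') = e'.
    rewrite vsprojK // -ee mem_sl mxtrace_mulC mulmxA.
    rewrite (_ : _ *m (1%:M + X) = 1%:M) ?mul1mx -?mem_sl ?subvsP //.
    by rewrite mulmxBl mul1mx mulmxDr mulmx1 xx addr0 addrK.
  rewrite -ee /mxbracket mulmxDl mul1mx mulmxBr mulmx1 mulmxDl.
  by rewrite opprD !addrA.
rewrite !linearD.
have DM p q : sact x (p * q) = sact x p * q + p * sact x q.
  exact: (@sym_funM _ _ _ (adjoint_action sln) x).
apply: (curve_mem DM (submodule_subsp N)).
- by move=> p pN; apply: sub_act.
- exact: sym_fun_inj.
- rewrite [LHS]sym_fun_inj -linearMn; congr sym_inj.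
  apply: (can_inj (@vsvalK _ _ _)); rewrite linearMn /= fE sl_bracketE /mxbracket.
  rewrite sl_bracketE /mxbracket mulmxBr mulmxBl !mulmxA xx mul0mx sub0r.
  rewrite -[Y *m X *m X]mulmxA xx mulmx0 subr0 mulNrn mulr2n opprD.
  by [].
- rewrite [LHS]sym_fun_inj (_ : adjoint_action sln x f = 0) ?linear0 //.
  apply: (can_inj (@vsvalK _ _ _)); rewrite linear0 sl_bracketE /mxbracket fE.
  rewrite -/X mulmxN mulNmx opprK !mulmxA.
  by rewrite -[X *m Y *m X *m X]mulmxA xx mulmx0 !mul0mx oppr0 addr0.
Qed.

(** Two conjugations suffice. The first, by x supported in the last row, changes the row factor of
    E_1n into w'. The second, by y supported in the first column, changes the column factor into v
    and restores the first entry of w, because \sum v_i w_i = 0 says that w' pairs with v to -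
    w_0. *)
Lemma orbit_mem (N : submodule sact) K (v w : 'I_n -> C) :
  v ord0 = 1 -> w ord_max = 1 -> \sum_i v i * w i = 0 ->
  sym_inj (e_theta C n) ^+ K \in sub_mem N ->
  sym_inj (vsproj (sl_space C n) (\matrix_(i, j) (v i * w j)) : sln) ^+ K \in sub_mem N.
Proof.
move=> v0 w1 vw thN.
(* The first entry is left to the second conjugation: including it in x would spoil
   [x *m c0 = 0]. *)
pose w' j : C := if j == ord0 then 0 else w j.
pose cv : 'cV[C]_n := \col_i v i; pose rw : 'rV[C]_n := \row_j w j.
pose rw' : 'rV[C]_n := \row_j w' j.
pose c0 : 'cV[C]_n := delta_mx ord0 0; pose r1 : 'rV[C]_n := delta_mx 0 ord_max.
pose x : 'M[C]_n := \matrix_(i, j)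
  (if (i == ord_max) && ((j != ord0) && (j != ord_max)) then - w j else 0).
pose y : 'M[C]_n := \matrix_(i, j) (if (j == ord0) && (i != ord0) then v i else 0).
have om : (ord_max : 'I_n) != ord0 by [].
have xx : x *m x = 0.
  apply/matrixP => i j; rewrite !mxE big1 // => k _; rewrite !mxE.
  have [->|] := eqVneq k ord_max; first by rewrite !andbF mul0r.
  by rewrite mulr0.
have yy : y *m y = 0.
  apply/matrixP => i j; rewrite !mxE big1 // => k _; rewrite !mxE.
  have [->|] := eqVneq k ord0; first by rewrite andbF mulr0.
  by rewrite mul0r.
have xsl : x \in sl_space C n.
  rewrite mem_sl /mxtrace big1 // => i _; rewrite mxE.
  by case: eqP => // _; rewrite andbF.
have ysl : y \in sl_space C n.
  rewrite mem_sl /mxtrace big1 // => i _; rewrite mxE.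
  by case: eqP.
have thE : vsval (e_theta C n) = c0 *m r1.
  rewrite e_thetaE //; apply/matrixP => i j; rewrite !mxE big_ord1 !mxE.
  by rewrite !eqxx andbT /= -natrM mulnb.
have xc : x *m c0 = 0.
  apply/matrixP => i j; rewrite !mxE big1 // => k _; rewrite !mxE.
  have [->|] := eqVneq k ord0; first by rewrite andbF mul0r.
  by rewrite mulr0.
have rx : r1 *m (1%:M - x) = rw'.
  rewrite mulmxBr mulmx1; apply/rowP => j; rewrite !mxE eqxx /=.
  rewrite (bigD1 ord_max) //= big1 => [|k /negPf km]; last by rewrite !mxE km mul0r.
  rewrite !mxE !eqxx mul1r addr0 /= /w'.
  have [->|j0] := eqVneq j ord0; first by rewrite subr0.
  have [->|jm] := eqVneq j ord_max; first by rewrite subr0 w1.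
  by rewrite /= opprK add0r.
have yc : (1%:M + y) *m c0 = cv.
  rewrite mulmxDl mul1mx; apply/colP => i; rewrite !mxE andbT.
  rewrite (bigD1 ord0) //= big1 => [|k /negPf km]; last by rewrite !mxE km mulr0.
  rewrite !mxE !eqxx mulr1 addr0 /=.
  by have [->|i0] := eqVneq i ord0; rewrite ?addr0 ?add0r ?v0.
have ry : rw' *m (1%:M - y) = rw.
  rewrite mulmxBr mulmx1; apply/rowP => j; rewrite !mxE.
  have [->|j0] := eqVneq j ord0.
    move: vw; rewrite (bigD1 ord0) //= v0 mul1r => /eqP; rewrite addr_eq0 => /eqP ->.
    rewrite /w' eqxx sub0r; congr (- _); rewrite (bigD1 ord0) //= !mxE eqxx mul0r add0r.
    by apply: eq_bigr => k k0; rewrite !mxE /w' k0 ?eqxx (negPf k0) mulrC.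
  rewrite big1 => [|k _]; first by rewrite subr0 /w' (negPf j0).
  by rewrite !mxE (negPf j0) mulr0.
have e1 : sym_inj (vsproj (sl_space C n) (c0 *m rw') : sln) ^+ K \in sub_mem N.
  apply: (@conj_mem N K (vsproj (sl_space C n) x : sln) _ _ _ _ thN).
    by rewrite vsprojK.
  by rewrite vsprojK // thE mulmxA mulmxDl mul1mx xc addr0 -mulmxA rx.
have tr1 : c0 *m rw' \in sl_space C n.
  rewrite mem_sl /mxtrace big1 // => i _; rewrite !mxE big_ord1 !mxE andbT /w'.
  by case: eqP => _; rewrite ?mulr0 ?mul0r.
apply: (@conj_mem N K (vsproj (sl_space C n) y : sln) _ _ _ _ e1).
  by rewrite vsprojK.
rewrite !vsprojK // mulmxA yc -mulmxA ry.
by apply/matrixP => i j; rewrite !mxE big_ord1 !mxE.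
Qed.

End Orbit.

(** Isomorphisms below are described by relations. A linear relation that is total and single-valued
    at 0 is single-valued everywhere, and choice makes it a map. *)
Lemma linear_of_graph (F : fieldType) (M N : lmodType F) (G : M -> N -> Prop) :
  (forall a u v p q, G u p -> G v q -> G (a *: u + v) (a *: p + q)) ->
  (forall u, exists p, G u p) -> (forall p, G 0 p -> p = 0) ->
  exists f : {linear M -> N}, forall u p, G u p <-> f u = p.
Proof.
move=> GP Gt G0; have [f fP] := choice Gt.
have Gu u p p' : G u p -> G u p' -> p = p'.
  move=> Gp Gp'; have := GP (-1) _ _ _ _ Gp Gp'.
  rewrite !scaleN1r addNr => /G0 /eqP; rewrite addrC subr_eq0 => /eqP ->.
  by [].
have flin : linear f by move=> a u v; apply: Gu (fP _) _; apply: GP.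
pose g : {linear M -> N} := HB.pack f (GRing.isLinear.Build F M N _ f flin).
by exists g => u p; split=> [h|<-]; [exact: Gu (fP u) h | exact: fP].
Qed.

(** * Modules realized by polynomials *)

Section Realize.
Variables (F : fieldType) (L : lieAlgebra F) (Q : lmodType F) (D : L -> Q -> Q).
Implicit Types (M N : lieModule L) (W : Q -> Prop).

(** M is isomorphic to W with the operators D. Modules realized by the same W are isomorphic, so the
    theorem turns into an equality of spaces of polynomials. *)
Definition realizes M W := exists f : {linear M -> Q}, [/\ injective f,
  forall x u, f (mod_act M x u) = D x (f u) & forall p, W p <-> exists u, f u = p].

Lemma realizes_graph M W (G : M -> Q -> Prop) :
  (forall a u v p q, G u p -> G v q -> G (a *: u + v) (a *: p + q)) ->
  (forall u, exists p, G u p) -> (forall p, G 0 p -> p = 0) ->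
  (forall u, G u 0 -> u = 0) ->
  (forall x u p, G u p -> G (mod_act M x u) (D x p)) ->
  (forall p, W p <-> exists u, G u p) -> realizes M W.
Proof.
move=> GP Gt G0 Gi GD GW; have [f fP] := linear_of_graph GP Gt G0.
exists f; split=> [u v uv|x u|p].
- by apply/eqP; rewrite -subr_eq0; apply/eqP/Gi/fP; rewrite linearB uv subrr.
- by apply/fP/GD/fP.
by split=> [/GW[u /fP up]|[u /fP up]]; [exists u | apply/GW; exists u].
Qed.

Lemma realizes_iso M N W : realizes M W -> realizes N W -> lie_iso M N.
Proof.
move=> [f [fi fD fW]] [g [gi gD gW]].
have [h hP] : exists h : {linear M -> N}, forall u v, f u = g v <-> h u = v.
  apply: linear_of_graph => [a u v p q up vq|u|p].
  - by rewrite !linearP up vq.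
  - have /gW[v vu] : W (f u) by apply/fW; exists u.
    by exists v.
  by rewrite linear0 => p0; apply: gi; rewrite linear0.
have [h' hP'] : exists h : {linear N -> M}, forall v u, g v = f u <-> h v = u.
  apply: linear_of_graph => [a u v p q up vq|u|p].
  - by rewrite !linearP up vq.
  - have /fW[v vu] : W (g u) by apply/gW; exists u.
    by exists v.
  by rewrite linear0 => p0; apply: fi; rewrite linear0.
exists h; split.
  by exists h' => [u|v]; [apply/hP'/esym/hP | apply/hP/esym/hP'].
by move=> x u; apply/hP; rewrite fD gD; congr (D x _); apply/hP.
Qed.

Lemma realizes_ext M W W' : (forall p, W p <-> W' p) -> realizes M W -> realizes M W'.
Proof.
by move=> WW [f [fi fD fW]]; exists f; split=> // p; rewrite -WW.
Qed.

Lemma realizes_sub M W : realizes M W -> subsp W.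
Proof.
move=> [f [_ _ fW]]; split; first by apply/fW; exists 0; rewrite linear0.
move=> a _ _ /fW[u <-] /fW[v <-]; apply/fW; exists (a *: u + v).
by rewrite linearP.
Qed.

Lemma realizes_dsum M N W W' : (forall x, linear (D x)) ->
  (forall p, W p -> W' p -> p = 0) ->
  realizes M W -> realizes N W' ->
  realizes (dsum M N) (fun p => exists q r, [/\ W q, W' r & p = q + r]).
Proof.
move=> Dlin WW [f [fi fD fW]] [g [gi gD gW]].
have D_add x p q : D x (p + q) = D x p + D x q.
  by have := Dlin x 1 p q; rewrite !scale1r.
apply: (@realizes_graph (dsum M N) _ (fun (u : (M * N)%type) p => p = f u.1 + g u.2)).
- move=> a u v p q -> ->; rewrite /= !linearP scalerDr.
  by rewrite addrACA.
- by move=> u; exists (f u.1 + g u.2).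
- by move=> p ->; rewrite !linear0 addr0.
- move=> [u v] /= /esym/eqP; rewrite addr_eq0 => /eqP E.
  have Wu : W (f u) by apply/fW; exists u.
  have gv : W' (g v) by apply/gW; exists v.
  have W'u : W' (f u).
    by rewrite E; apply/gW; exists (- v); rewrite linearN.
  have u0 : u = 0 by apply: fi; rewrite linear0; exact: WW.
  have v0 : v = 0.
    by apply: gi; rewrite linear0; apply/eqP; rewrite -oppr_eq0 -E u0 linear0.
  by rewrite u0 v0.
- by move=> x [u v] p /= ->; rewrite fD gD D_add.
move=> p; split=> [[q [r [/fW[u <-] /gW[v <-] ->]]]|[[u v] ->]].
  by exists (u, v).
by exists (f u), (g v); split=> //; [apply/fW; exists u | apply/gW; exists v].
Qed.

Lemma realizes_zero : (forall x, D x 0 = 0) ->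
  realizes (zero_module L) (fun p => p = 0).
Proof.
move=> D0; apply: (@realizes_graph (zero_module L) _ (fun _ p => p = 0)).
- by move=> a u v p q -> ->; rewrite scaler0 addr0.
- by move=> u; exists 0.
- by [].
- by move=> u _; apply/rowP => -[].
- by move=> x u p ->.
by move=> p; split=> [->|[u ->]] //; exists 0.
Qed.

End Realize.

(** * The homogeneous parts of the C2-algebra as spaces of polynomials *)

Section C2.
Variables (C : numClosedFieldType) (m : nat).
Notation n := m.+2.
Notation var := (var n).
Notation P := {mpoly C[#|var|]}.
Notation sln := (sl C n).
Notation S := {mpoly C[\dim {:sln}]}.
Notation sact := (sym_action (adjoint_action sln)).
Notation trz := (@trz C m).
Notation XH := (@XH C m).
Implicit Types (p q F E : P) (s f : S) (x : sln).

Lemma fis_D (x : 'M[C]_n) p q :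
  fis (der (Dg x) p) q = fis p (der (Dg (mxadj x)) q).
Proof. by rewrite !DgE fisDl fisDr fis_L fis_R. Qed.

Lemma HH_D K M (x : 'M[C]_n) p : HH K M p -> HH K M (der (Dg x) p).
Proof.
move=> Hp; rewrite DgE; apply: subspD; [exact: HH_subsp|exact: HH_L|exact: HH_R].
Qed.

Lemma XH_D M (x : 'M[C]_n) p : XH M p -> XH M (der (Dg x) p).
Proof.
move=> [Xp Mp]; rewrite DgE; apply: subspD; first exact: XH_subsp.
  by split; [exact: XO_L | exact: homog_L].
by split; [exact: XO_R | exact: homog_R].
Qed.

Lemma iter_cg_fis (e : 'M[C]_n) K p q :
  fis (ell e ^+ K * p) q = fis p (iter K (der (cg (map_mx Num.conj e))) q).
Proof.
elim: K p q => [|K IH] p q; first by rewrite expr0 mul1r.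
by rewrite exprSr -mulrA IH fis_ell -iterS.
Qed.

Lemma XO_cg (c : 'M[C]_n) p : XO p -> XO (der (cg c) p).
Proof.
move=> [p0 pv pw].
have H t : dv t p = 0 -> dv t (der (cg c) p) = 0.
  move=> pt; rewrite dvE (@der_commute _ _ _ (cg c)) -?dvE ?pt ?der0 //.
  by move=> -[[i|] [j|]]; rewrite /= ?derC ?der_nat ?der0.
by split=> [|i|j]; apply: H.
Qed.

Lemma ev_XO z z' p : XO p -> (forall i j, z (X i j) = z' (X i j)) -> ev z p = ev z' p.
Proof.
move=> [p0 pv pw] zz.
pose c t := if t is (Some i, Some j) then 0 else z' t - z t.
rewrite -[LHS](@ev_flow _ _ z c (fun t => (c t)%:MP)).
- apply: eq_ev => -[[i|] [j|]]; rewrite /c ?addr0 ?[z _ + _]addrC ?subrK //.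
  exact: zz.
- by move=> w t; rewrite evC.
rewrite /der big1 // => t _; elim/varP: t => [i j|i|j|]; rewrite ?p0 ?pv ?pw ?mulr0 //.
by rewrite mpolyC0 mul0r.
Qed.

(** As F does not involve v and w, these can be given the values of the factors of c, and
    [ev_iterTh] applies at every x. *)
Lemma Th_cg K (c : 'M[C]_n) (v w : 'I_n -> C) F : XO F -> iter K Th F = 0 ->
  (forall i j, c i j = v i * w j) -> iter K (der (cg c)) F = 0.
Proof.
move=> XF FK cvw; apply: ev_eq0 => z.
pose z' : var -> C := fun t => match t with
  | (Some i, None) => v i | (None, Some j) => w j | _ => z t end.
rewrite (@ev_XO z z'); first by rewrite -ev_iterTh // FK ev0.
  by elim: K {FK} => //= K IH; exact: XO_cg.
by [].
Qed.

Lemma mxadj_sl (x : sln) : mxadj (vsval x) \in sl_space C n.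
Proof.
have E : \tr (mxadj (vsval x)) = (\tr (vsval x))^*.
  by rewrite /mxtrace rmorph_sum; apply: eq_bigr => i _; rewrite !mxE.
have : \tr (vsval x) == 0 by rewrite -mem_sl subvsP.
by rewrite mem_sl E => /eqP ->; rewrite conjC0.
Qed.

Lemma theta_conj : map_mx Num.conj (vsval (e_theta C n)) = vsval (e_theta C n).
Proof.
by rewrite e_thetaE //; apply/matrixP => i j; rewrite !mxE conjC_nat.
Qed.

(** Induction on the word. For the empty word, multiplication by the power of e_theta is adjoint to
    the derivative of order k + 1 along the rank one matrix E_1n, which kills F; the remaining term
    is a multiple of [trz], orthogonal to S(sl). A letter x is moved by the Leibniz rule onto the
    whole product, and by adjunction onto F, whose conditions are stable under sl. *)
Lemma orth_word k M F q s f (wd : seq sln) :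
  HH k.+1 M F -> F = iota s + trz * q ->
  fis (iota (f * foldr sact (sym_inj (e_theta C n) ^+ k.+1) wd)) (iota s) = 0.
Proof.
elim: wd f s F q => [|x wd IH] f s F q HF FE /=.
  rewrite mulrC iotaM iotaXn iota_sym_inj iter_cg_fis theta_conj.
  have -> : iota s = F - trz * q by rewrite FE addrK.
  rewrite -[F - _]addrC -scaleN1r iter_derP.
  have [XF _ FK] := HF.
  rewrite (@Th_cg _ _ (fun i => (i == ord0)%:R) (fun i => (i == ord_max)%:R) _ XF FK).
    rewrite addr0 fisZr iter_cg_trz ?[X in _ * X](fis_sym0 (orth_trz_iota _ _)) ?mulr0 //.
    by apply/eqP; rewrite -mem_sl subvsP.
  by move=> i j; rewrite e_thetaE // mxE -natrM mulnb.
set u := foldr _ _ _ in IH *.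
have -> : f * sact x u = sact x (f * u) - sact x f * u.
  by rewrite [sact x (f * u)]sym_funM addrC addKr.
rewrite -[X in iota X]addrC -scaleN1r iotaD iotaZ fisDl fisZl (IH _ _ _ _ HF FE).
rewrite mulr0 add0r [iota _]iota_sym_fun fis_D.
pose x' : sln := vsproj _ (mxadj (vsval x)).
have x'E : vsval x' = mxadj (vsval x) by rewrite vsprojK // mxadj_sl.
rewrite -x'E -iota_sym_fun; apply: (IH _ _ (der (Dg (vsval x')) F) (der (Dg (vsval x')) q)).
  exact: HH_D.
by rewrite FE derD derM D_trz mul0r add0r iota_sym_fun.
Qed.

Lemma C2_ideal_orth k M F q s s' : s' \in sub_mem (C2_ideal C n k) ->
  HH k.+1 M F -> F = iota s + trz * q -> fis (iota s') (iota s) = 0.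
Proof.
move=> /asboolP[l lV ->] HF FE; rewrite iota_sum fis_suml big_seq big1 // => c cl.
have /asboolP[l' ->] := lV c cl; rewrite mulr_sumr iota_sum fis_suml big1 // => c' _.
by rewrite -scalerAr iotaZ fisZl (orth_word _ _ HF FE) mulr0.
Qed.

(** If the first power N of [Th] that kills q exceeded K, then [iter N Th (trz * q)] would be N
    times [qq] times the nonzero polynomial [iter N.-1 Th q]. This yields the uniqueness of the
    correction F. *)
Lemma trz_HH K q M : XH M q -> iter K.+1 Th (trz * q) = 0 -> iter K Th q = 0.
Proof.
move=> [Xq qM] tq.
have exN : exists N, iter N Th q == 0 by exists M.+1; rewrite Th_nil.
case: (ex_minnP exN) => N /eqP N0 Nmin; have [NK|] := leqP N K; first exact: iterTh_le N0.
case: N N0 Nmin => // N N0 Nmin; rewrite ltnS => KN.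
have := iter_Th_tr N q; rewrite N0 mulr0 add0r (iterTh_le _ tq) // => /esym/eqP.
rewrite scaler_eq0 pnatr_eq0 mulf_eq0 (negPf (qq_neq0 _ _)) /= => /Nmin.
by rewrite ltnn.
Qed.

Lemma iota_cg (c : 'M[C]_n) s M : s \is M.-homog ->
  exists2 s', s' \is M.-1.-homog & der (cg c) (iota s) = iota s' /\ (M = 0%N -> s' = 0).
Proof.
move=> sM; pose k i : C := \sum_a \sum_b (vsval (vbasis {:sln})`_i) a b * c a b.
exists (\sum_(i < \dim {:sln}) k i *: s^`M(i)).
  apply: rpred_sum => i _; apply: rpredZ.
  apply/dhomogP => mm; rewrite mcoeff_msupp mcoeff_deriv => h.
  have : (mm + U_(i))%MM \in msupp s.
    by rewrite mcoeff_msupp; apply: contra h => /eqP->; rewrite mul0rn.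
  by move/dhomogP: sM => h' /h' /=; rewrite mdegD mdeg1 addn1 => <-.
split.
  rewrite iota_der iota_sum; apply: eq_bigr => i _.
  by rewrite cg_ell iotaZ mulrC mul_mpolyC.
move=> M0; rewrite big1 // => i _.
have -> : s = (s@_0%MM)%:MP.
  by apply: msize1_polyC; have := homog_msize sM; rewrite M0.
by rewrite mderivC scaler0.
Qed.

Lemma iter_iota_cg (c : 'M[C]_n) K s M : s \is M.-homog ->
  exists s', [/\ s' \is (M - K).-homog, iter K (der (cg c)) (iota s) = iota s'
    & (M < K)%N -> s' = 0].
Proof.
move=> sM; elim: K => [|K [s1 [s1M s1E s10]]]; first by exists s; rewrite subn0.
have [s2 s2M [s2E s20]] := iota_cg c s1M.
exists s2; split; [by rewrite subnS | by rewrite iterS s1E |].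
rewrite ltnS leq_eqVlt => /orP[/eqP MK|/s10 s1z]; first by apply: s20; rewrite MK subnn.
have : iota s2 = 0 by rewrite -s2E s1z iota0 der0.
by move/(congr1 (@kap C m)); rewrite iotaK /kap raddf0.
Qed.

End C2.

Section C2Realize.
Variables (C : numClosedFieldType) (m : nat).
Notation n := m.+2.
Notation var := (var n).
Notation P := {mpoly C[#|var|]}.
Notation sln := (sl C n).
Notation S := {mpoly C[\dim {:sln}]}.
Notation sact := (sym_action (adjoint_action sln)).
Notation trz := (@trz C m).
Notation XH := (@XH C m).
Implicit Types (p q F E : P) (s f : S) (x : sln).

Definition Dsl x p : P := der (Dg (vsval x)) p.

(* trW K 0 is empty, not 0. *)
Definition trW K M p := exists2 q, trz * q = p & exists2 M', M = M'.+1 & HH K M' q.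

Lemma trW_subsp K M : subsp (trW K M.+1).
Proof.
split=> [|a _ _ [q <- [_ [<-] Hq]] [q' <- [_ [<-] Hq']]].
  by exists 0; [rewrite mulr0 | exists M => //; exact: (HH_subsp _ _ _ _).1].
exists (a *: q + q'); first by rewrite mulrDr -scalerAr.
by exists M => //; exact: (HH_subsp _ _ _ _).2.
Qed.

Lemma trW_HH K M p : trW K M p -> HH K.+1 M p.
Proof.
move=> [q <- [M' -> [Xq qM qK]]]; have [] := @XH_trM C m M' q (conj Xq qM).
by split=> //; rewrite iter_Th_tr (iterTh_le _ qK) // qK !mulr0 scaler0 addr0.
Qed.

Definition C2space k M F := HH k.+1 M F /\ orth (trW k M) F.

(** The derivative of s of order k + 1 along c is again some [iota s']. Its square norm is the
    product of e^(k+1) s' with s, where e is the conjugate of c; by [orbit_mem] the power e^(k+1)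
    lies in V_{k+1}, so the norm is 0. *)
Lemma nilcond_iota k M s N : s \is M.-homog -> (k < N)%N ->
  orth (fun p => exists2 s', s' \in sub_mem (C2_ideal C n k) /\ s' \is M.-homog &
    iota s' = p) (iota s) -> nilcond N (iota s).
Proof.
move=> sM kN so c [v [w [cvw v0 w1 vw]]].
suff K0 : iter k.+1 (der (cg c)) (iota s) = 0.
  by rewrite -(subnK kN) iterD K0 iter_der0.
have [s' [s'M s'E s'0]] := iter_iota_cg c k.+1 sM.
have [Mk|kM] := ltnP M k.+1; first by rewrite s'E s'0 // iota0.
pose e : 'M[C]_n := \matrix_(i, j) ((v i)^* * (w j)^*).
have ec : map_mx Num.conj e = c.
  by apply/matrixP => i j; rewrite !mxE rmorphM /= !conjCK cvw.
have esl : e \in sl_space C n.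
  rewrite mem_sl /mxtrace (eq_bigr (fun i => (v i * w i)^*)) => [|i _].
    by rewrite -rmorph_sum vw rmorph0.
  by rewrite mxE rmorphM.
have eV : sym_inj (vsproj (sl_space C n) e : sln) ^+ k.+1 \in sub_mem (V_submodule C n k).
  apply: orbit_mem; rewrite ?v0 ?w1 ?conjC1 //.
    transitivity ((\sum_i v i * w i)^*); last by rewrite vw conjC0.
    by rewrite rmorph_sum; apply: eq_bigr => i _; rewrite rmorphM.
  by apply/asboolP; exists [:: (1, [::])]; rewrite big_seq1 scale1r.
apply: fis_eq0; rewrite {1}s'E -ec -iter_cg_fis.
rewrite -[e](vsprojK esl) -(iota_sym_inj (vsproj _ e : sln)) -iotaXn -iotaM.
apply: so; exists (sym_inj (vsproj (sl_space C n) e : sln) ^+ k.+1 * s') => //.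
split.
  apply/asboolP; exists [:: (s', sym_inj (vsproj (sl_space C n) e : sln) ^+ k.+1)].
    by move=> c'; rewrite inE => /eqP ->.
  by rewrite big_seq1 mulrC.
rewrite -(subnKC kM) -[X in (X + _)%N]mul1n; apply: dhomogM => //.
by apply: dhomogMn; exact: sym_inj_homog.
Qed.

(** [descent] provides some F, from which the projection to [trW] is removed. Degree 0 is separate,
    since [trW k 0] is empty and hence not a subspace. *)
Lemma C2_lift k M s : s \is M.-homog ->
  orth (fun p => exists2 s', s' \in sub_mem (C2_ideal C n k) /\ s' \is M.-homog &
    iota s' = p) (iota s) ->
  exists F q, [/\ C2space k M F, XH M.-1 q, M = 0%N -> q = 0 & F = iota s + trz * q].
Proof.
move=> sM so; case: M sM so => [|M] sM so.
  exists (iota s), 0; split=> //; [split|exact: (XH_subsp _ _ _).1|].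
  - have [Xs Ms] := iota_homog sM; split=> //; apply: (@iterTh_le _ _ 1) => //.
    exact: Th_nil Ms.
  - by move=> p [q _ [M' //]].
  by rewrite mulr0 addr0.
have [F [E [HF XE FE]]] := descent (iota_homog sM) (fun N kN => nilcond_iota sM kN so).
have WM p : trW k M.+1 p -> p \is M.+1.-homog by move=> /trW_HH[].
have [w Ww Fw] := orth_proj (trW_subsp k M) WM F.
have [q qE [_ [<-] [Xq qM _]]] := Ww.
exists (F - w), (E - q); split=> //.
- split=> //; rewrite addrC -scaleN1r; apply: (HH_subsp _ _ _ _).2 => //; exact: trW_HH.
- by rewrite addrC -scaleN1r; apply: (XH_subsp _ _ _).2.
by rewrite FE -qE mulrBr addrA.
Qed.

Lemma orth_D (W : P -> Prop) x p : (forall y : 'M[C]_n, forall p, W p -> W (der (Dg y) p)) ->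
  orth W p -> orth W (Dsl x p).
Proof.
move=> WD Wp r Wr; rewrite /Dsl -fis_conj fis_D fis_conj.
by apply: Wp; exact: WD.
Qed.

Lemma trW_D K M (x : 'M[C]_n) p : trW K M p -> trW K M (der (Dg x) p).
Proof.
move=> [q <- [M' -> Hq]]; exists (der (Dg x) q).
  by rewrite derM D_trz mul0r add0r.
by exists M' => //; exact: HH_D.
Qed.

(** The class of s corresponds to F when F - iota s is a multiple of [trz]. A representative
    orthogonal to the ideal lifts by [C2_lift]; F is unique thanks to [C2_ideal_orth] and [trz_HH];
    every F occurs by [XH_decomp]. *)
Lemma C2_realizes k M : realizes Dsl (C2_part C n k M) (C2space k M).
Proof.
set N := C2_ideal C n k.
apply: (@realizes_graph _ _ _ _ (C2_part C n k M) _ (fun (u : sub_sort (degree_submodule N M)) F =>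
  C2space k M F /\ exists s q, [/\ s \is M.-homog, XH M.-1 q, M = 0%N -> q = 0,
    sub_val u = quot_pi N s & F = iota s + trz * q])).
- move=> a u v F F' [[HF oF] [s [q [sM Xq q0 us FE]]]] [[HF' oF'] [s' [q' [sM' Xq' q0' us' FE']]]].
  split; first by split; [exact: (HH_subsp _ _ _ _).2 | exact: (orth_subsp _).2].
  exists (a *: s + s'), (a *: q + q'); split.
  + by rewrite rpredD ?rpredZ.
  + exact: (XH_subsp _ _ _).2.
  + by move=> M0; rewrite q0 // q0' // scaler0 addr0.
  + by rewrite [RHS]linearP /= -us -us'.
  + by rewrite FE FE' iotaD iotaZ scalerDr mulrDr -scalerAr addrACA.
- case=> u uM; have /asboolP[s0 s0M us0] := uM.
  pose W p := exists2 s', s' \in sub_mem N /\ s' \is M.-homog & iota s' = p.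
  have sW : subsp W.
    split=> [|a _ _ [s [sN sM] <-] [s' [sN' sM'] <-]].
      by exists 0; [rewrite !rpred0 | exact: iota0].
    by exists (a *: s + s'); [rewrite !rpredD ?rpredZ | rewrite iotaD iotaZ].
  have WM p : W p -> p \is M.-homog by move=> [s' [_ /iota_homog[_ h]] <-].
  have [_ [s1 [s1N s1M] <-] os] := orth_proj sW WM (iota s0).
  have [||F [q [CF Xq q0 FE]]] := @C2_lift k M (s0 - s1).
  + by rewrite rpredB.
  + by rewrite iotaB.
  exists F; split=> //; exists (s0 - s1), q; split=> //; first by rewrite rpredB.
  by rewrite /= us0; apply/quot_piP; rewrite opprB addrC subrK.
- move=> F [[HF oF] [s [q [sM Xq q0 us FE]]]].
  (* A representative of the zero class lies in the ideal, so [iota s] is orthogonal to itself. What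
     remains of F is a multiple of [trz], which lies in [trW] and is orthogonal to it. *)
  have sN : s \in sub_mem N.
    have E : quot_pi N s = quot_pi N 0 by rewrite -us linear0.
    by have /quot_piP := E; rewrite subr0.
  have s0 : iota s = 0 by apply: fis_eq0; exact: (C2_ideal_orth sN HF FE).
  rewrite s0 add0r in FE.
  have [qz|qn] := eqVneq q 0; first by rewrite FE qz mulr0.
  case: M q0 Xq HF oF {s us sM sN s0} => [|M] q0 Xq HF oF.
    by rewrite q0 ?eqxx in qn.
  apply: fis_eq0; apply: oF; exists q => //; exists M => //.
  have [Xq' qM] := Xq; split=> //; apply: (trz_HH Xq); rewrite -FE.
  by case: HF.
- move=> u [_ [s [q [sM Xq q0 us /esym FE]]]].
  (* Here [iota s] is a multiple of [trz], hence orthogonal to itself. *)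
  have s0 : iota s = 0.
    apply: fis_eq0; have /eqP := FE; rewrite addr_eq0 => /eqP E.
    by rewrite {1}E fisNl orth_trz_iota oppr0.
  have sz : s = 0 by rewrite -[s](@iotaK C m) s0 /kap raddf0.
  by apply: val_inj; rewrite /= us sz linear0.
- move=> x u F [[HF oF] [s [q [sM Xq q0 us FE]]]]; split.
    split; first exact: HH_D.
    by apply: orth_D => // y p; exact: trW_D.
  exists (sact x s), (Dsl x q); split.
  + exact: sym_fun_homog.
  + exact: XH_D.
  + by move=> /q0 ->; rewrite /Dsl der0.
  + by rewrite /= us; exact: quot_funE.
  by rewrite FE /Dsl derD derM D_trz mul0r add0r [X in _ = X + _]iota_sym_fun.
move=> F; split=> [CF|[u [CF _]]] //.
have [HF oF] := CF; have [XF FM _] := HF.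
have [s [q [sM Xq q0 FE]]] := XH_decomp (conj XF FM).
have uM : quot_pi N s \in sub_mem (degree_submodule N M).
  by apply/asboolP; exists s.
by exists (SubElt uM); split=> //; exists s, q; split.
Qed.

End C2Realize.

(** * Highest weight modules *)

Lemma subsp_vspace (F : fieldType) (V : vectType F) (W : V -> Prop) :
  subsp W -> exists U : {vspace V}, forall v, v \in U <-> W v.
Proof.
move=> [W0 WP].
pose Q k := `[< exists U : {vspace V}, (forall v, v \in U -> W v) /\ \dim U = k >].
have Q0 : exists k, Q k.
  exists 0%N; apply/asboolP; exists 0%VS; split; last exact: dimv0.
  by move=> v; rewrite memv0 => /eqP->.
have Qb k : Q k -> (k <= \dim {:V})%N.
  by move=> /asboolP[U [_ <-]]; apply: dimvS; exact: subvf.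
case: (ex_maxnP Q0 Qb) => k /asboolP[U [UW Uk]] kmax; exists U => v; split=> [/UW//|Wv].
apply: contraT => vU; suff /kmax : Q k.+1 by rewrite ltnn.
apply/asboolP; exists (U + <[v]>)%VS; split.
  move=> _ /memv_addP[u uU [_ /vlineP[a ->] ->]].
  by rewrite addrC; apply: WP => //; exact: UW.
have vn0 : v != 0 by apply: contraNneq vU => ->; exact: mem0v.
rewrite dimv_disjoint_sum ?dim_vline ?vn0 ?addn1 ?Uk //.
apply/eqP; rewrite -subv0; apply/subvP => u /memv_capP[uU /vlineP[a E]].
rewrite {u}E in uU *; have [->|a0] := eqVneq a 0; first by rewrite scale0r mem0v.
by have := memvZ a^-1 uU; rewrite scalerA mulVf // scale1r (negPf vU).
Qed.

(* Highest weight vectors: L is spanned by the e i, those with low i being the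
   lowering operators. *)
Section Triangular.
Variables (C : numFieldType) (L : lieAlgebra C) (I : finType) (e : I -> L).
Variable low : pred I.
Hypothesis e_span : forall x, exists k : I -> C, x = \sum_i k i *: e i.
Variables (M : lmodType C) (rho : lie_action L M) (m0 : M).
Hypothesis m0_hw : forall i, ~~ low i -> exists c, rho (e i) m0 = c *: m0.

Definition gen (v : M) := forall W : M -> Prop, subsp W ->
  (forall i v, W v -> W (rho (e i) v)) -> W m0 -> W v.

Lemma gen_subsp : subsp gen.
Proof.
split=> [W [W0 _] //|a u w gu gw W sW We Wm].
by apply: sW.2; [exact: gu | exact: gw].
Qed.

Lemma gen_act i v : gen v -> gen (rho (e i) v).
Proof. by move=> gv W sW We Wm; apply: (We); exact: gv. Qed.

Lemma gen_m0 : gen m0.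
Proof. by []. Qed.

(** A filtration by the number of lowering operators applied to [m0]. It shows every generated
    vector as a multiple of [m0] plus images of lowering operators, in place of the
    Poincare-Birkhoff-Witt theorem. *)
Fixpoint lvl r (v : M) : Prop :=
  if r is r'.+1 then exists (c : C) (s : I -> M), (forall k, lvl r' (s k)) /\
    v = c *: m0 + \sum_(k | low k) rho (e k) (s k)
  else exists c, v = c *: m0.

Lemma lvl_subsp r : subsp (lvl r).
Proof.
elim: r => [|r IH]; split=> [|a u v].
- by exists 0; rewrite scale0r.
- by move=> [c ->] [c' ->]; exists (a * c + c'); rewrite scalerDl scalerA.
- exists 0, (fun=> 0); split; first by move=> _; exact: IH.1.
  by rewrite scale0r big1 ?addr0 // => k _; rewrite linear0.
move=> [c [s [sr ->]]] [c' [s' [sr' ->]]].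
exists (a * c + c'), (fun k => a *: s k + s' k); split.
  by move=> k; exact: (IH.2 _ _ _ (sr k) (sr' k)).
rewrite scalerDr scalerDl scalerA addrACA; congr (_ + _).
by rewrite scaler_sumr -big_split; apply: eq_bigr => k _; rewrite linearP.
Qed.

Lemma lvlS r v : lvl r v -> lvl r.+1 v.
Proof.
elim: r v => [|r IH] v.
  move=> [c ->]; exists c, (fun=> 0); split; first by move=> _; exists 0; rewrite scale0r.
  by rewrite big1 ?addr0 // => k _; rewrite linear0.
move=> [c [s [sr ->]]]; exists c, s; split=> // k; exact: IH (sr k).
Qed.

Lemma lvl_low r k v : low k -> lvl r v -> lvl r.+1 (rho (e k) v).
Proof.
move=> lk rv; exists 0, (fun k' => if k' == k then v else 0); split.
  by move=> k'; case: ifP => // _; exact: (lvl_subsp r).1.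
rewrite scale0r add0r (bigD1 k) //= eqxx big1 ?addr0 // => k' /andP[_ /negPf->].
by rewrite linear0.
Qed.

Lemma act_suml (k : I -> C) v : rho (\sum_i k i *: e i) v = \sum_i k i *: rho (e i) v.
Proof.
have R0 : rho 0 v = 0.
  have := act_linl rho v (-1) 0 0; rewrite scaler0 addr0 => E.
  by rewrite {1}E scaleN1r addNr.
elim/big_rec2: _ => // i x y _ <-.
by rewrite (act_linl rho v (k i)).
Qed.

Lemma lvl_m0 r : lvl r m0.
Proof. by elim: r => [|r /lvlS//]; exists 1; rewrite scale1r. Qed.

(** Induction on the level: e_i passes the outermost lowering operator up to a bracket, and the
    bracket, expanded in the e_l, acts on a vector of smaller level. *)
Lemma lvl_high r i v : ~~ low i -> lvl r v -> lvl r (rho (e i) v).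
Proof.
elim: r i v => [|r IH] i v li; have [c' E] := m0_hw li.
  by move=> [c ->]; exists (c * c'); rewrite linearZ /= E scalerA.
move=> [c [s [sr ->]]]; rewrite linearP linear_sum /= E scalerA.
apply: (lvl_subsp r.+1).2; first exact: lvl_m0.
apply: subsp_bigsum => [|k lk]; first exact: lvl_subsp.
have [f fE] := e_span (bracket (e i) (e k)).
have -> : rho (e i) (rho (e k) (s k))
    = 1 *: rho (e k) (rho (e i) (s k)) + \sum_l f l *: rho (e l) (s k).
  by rewrite -act_suml -fE act_bracket scale1r addrC subrK.
apply: (lvl_subsp r.+1).2; first by apply: lvl_low => //; exact: IH li (sr k).
apply: subsp_bigsum => [|l _]; first exact: lvl_subsp.
rewrite -[_ *: _]addr0; apply: (lvl_subsp r.+1).2; last exact: (lvl_subsp r.+1).1.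
have [ll|ll] := boolP (low l); first exact: lvl_low ll (sr k).
by apply: lvlS; exact: IH ll (sr k).
Qed.

Lemma lvl_le r r' v : (r <= r')%N -> lvl r v -> lvl r' v.
Proof. by move=> /subnK <-; elim: (r' - r)%N => //= k IH /IH /lvlS. Qed.

Lemma gen_lvl v : gen v -> exists r, lvl r v.
Proof.
move=> /(_ (fun v => exists r, lvl r v)); apply; last by exists 0%N; exact: lvl_m0.
  split=> [|a u w [r ru] [r' rw]]; first by exists 0%N; exact: (lvl_subsp 0).1.
  exists (maxn r r'); apply: (lvl_subsp _).2.
    exact: lvl_le (leq_maxl _ _) ru.
  exact: lvl_le (leq_maxr _ _) rw.
move=> i w [r rw]; exists r.+1.
by have [li|li] := boolP (low i); [exact: lvl_low li rw | apply: lvlS; exact: lvl_high li rw].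
Qed.

Lemma hw_functional (kap : M -> C) : (forall u v, kap (u + v) = kap u + kap v) ->
  (forall a u, kap (a *: u) = a * kap u) ->
  (forall i v, low i -> kap (rho (e i) v) = 0) -> kap m0 = 0 ->
  forall v, gen v -> kap v = 0.
Proof.
move=> kD kZ klow k0 v /gen_lvl[[|r]].
  by move=> [c ->]; rewrite kZ k0 mulr0.
move=> [c [s [_ ->]]]; rewrite kD kZ k0 mulr0 add0r.
elim/big_rec: _ => [|i x li IH]; first by rewrite -(scale0r m0) kZ mul0r.
by rewrite kD klow // add0r.
Qed.

Variables (h : L) (c0 : C) (dg : I -> nat).
Hypothesis h_m0 : rho h m0 = c0 *: m0.
Hypothesis dg_gt0 : forall i, low i -> (0 < dg i)%N.
Hypothesis h_low : forall i, low i -> bracket h (e i) = - (dg i)%:R *: e i.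

(** Sums of eigenvectors of h with eigenvalues strictly below c0, each paired with its distance to
    c0. *)
Definition lower v := exists l : seq (nat * M),
  (forall y, y \in l -> (0 < y.1)%N /\ rho h y.2 = (c0 - y.1%:R) *: y.2) /\
  v = \sum_(y <- l) y.2.

Lemma lower_subsp : subsp lower.
Proof.
split=> [|a _ _ [l [lP ->]] [l' [lP' ->]]]; first by exists [::]; rewrite big_nil.
exists ([seq (y.1, a *: y.2) | y <- l] ++ l'); split.
  move=> y; rewrite mem_cat => /orP[/mapP[y' /lP[y0 E] ->]|/lP'//] /=.
  by split=> //; rewrite linearZ /= E !scalerA mulrC.
by rewrite big_cat big_map scaler_sumr.
Qed.

Lemma lower_act i d v : low i -> rho h v = (c0 - d%:R) *: v ->
  lower (rho (e i) v).
Proof.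
move=> li hv; exists [:: ((d + dg i)%N, rho (e i) v)]; split; last by rewrite big_seq1.
move=> y; rewrite inE => /eqP -> /=; rewrite addn_gt0 dg_gt0 // orbT; split=> //.
apply/eqP; rewrite -[rho h _](subrK (rho (e i) (rho h v))) -act_bracket h_low //.
rewrite hv linearZ /=; have := act_linl rho v (- (dg i)%:R) (e i) 0.
rewrite addr0 => ->; have -> : rho 0 v = 0.
  by have := act_suml (fun=> 0) v; rewrite !big1 // => j _; rewrite scale0r.
rewrite addr0 -scalerDl; apply/eqP; congr (_ *: _).
by rewrite natrD opprD addrC addrA.
Qed.

Lemma lvl_lower r v : lvl r v -> exists c, lower (v - c *: m0).
Proof.
elim: r v => [|r IH] v.
  by move=> [c ->]; exists c; rewrite subrr; exact: lower_subsp.1.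
move=> [c [s [sr ->]]]; exists c; rewrite addrAC subrr add0r.
apply: subsp_bigsum => [|k lk]; first exact: lower_subsp.
have [c' [l [lP lE]]] := IH _ (sr k).
have -> : s k = c' *: m0 + \sum_(y <- l) y.2 by rewrite -lE addrC subrK.
rewrite linearP linear_sum /=; apply: lower_subsp.2.
  by apply: (@lower_act _ 0%N) => //; rewrite subr0.
rewrite big_seq; apply: subsp_bigsum => [|y yl]; first exact: lower_subsp.
by have [_ E] := lP _ yl; exact: lower_act E.
Qed.

(** Independence of eigenvectors: applying h - (c0 - d) to an expression of x removes a summand of
    eigenvalue c0 - d and multiplies x by the nonzero number d. *)
Lemma lower_m0 : lower m0 -> m0 = 0.
Proof.
move=> [l [lP lE]].
suff H (x : M) : rho h x = c0 *: x -> x = \sum_(y <- l) y.2 -> x = 0 by exact: H.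
have [k lk] : exists k, size l = k by exists (size l).
elim: k l lk lP x {lE} => [|k IH] [|y l] //=; try by move=> _ _ x _ ->; rewrite big_nil.
move=> [lk] lP x hx xE.
have [y0 hy] := lP _ (mem_head _ _).
have d0 : y.1%:R != 0 :> C by rewrite pnatr_eq0 -lt0n.
pose f (w : nat * M) := (y.1%:R - w.1%:R) / y.1%:R : C.
apply: (IH [seq (w.1, f w *: w.2) | w <- l]) => //; first by rewrite size_map.
  move=> _ /mapP[w wl ->] /=.
  have [w0 hw] := lP w (@mem_behead _ (y :: l) w wl); split=> //.
  by rewrite linearZ /= hw !scalerA mulrC.
rewrite big_map /=; apply: (scalerI d0); rewrite scaler_sumr.
have E : rho h x - (c0 - y.1%:R) *: x = y.1%:R *: x.
  by rewrite hx -scalerBl opprB addrC subrK.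
rewrite -E xE big_cons linearD scalerDr /= hy opprD addrACA subrr add0r.
rewrite linear_sum /= !scaler_sumr -sumrB big_seq [RHS]big_seq.
apply: eq_bigr => w wl; have [_ hw] := lP w (@mem_behead _ (y :: l) w wl).
rewrite hw -scalerBl scalerA /f mulrC divfK //; congr (_ *: _).
by rewrite opprB addrC addrA subrK addrC.
Qed.

Lemma hw_notin (s : I -> M) : (forall k, gen (s k)) ->
  m0 = \sum_(k | low k) rho (e k) (s k) -> m0 = 0.
Proof.
move=> sg E; apply: lower_m0; rewrite [X in lower X]E.
apply: subsp_bigsum => [|k lk]; first exact: lower_subsp.
have [r /lvl_lower[c' [l [lP lE]]]] := gen_lvl (sg k).
have -> : s k = c' *: m0 + \sum_(y <- l) y.2 by rewrite -lE addrC subrK.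
rewrite linearP linear_sum /=; apply: lower_subsp.2.
  by apply: (@lower_act _ 0%N) => //; rewrite subr0.
rewrite big_seq; apply: subsp_bigsum => [|y yl]; first exact: lower_subsp.
by have [_ hy] := lP _ yl; exact: lower_act hy.
Qed.

End Triangular.

Lemma sep_functional (F : fieldType) (V : vectType F) (U : {vspace V}) v : v \notin U ->
  exists f : 'Hom(V, F^o), f v = 1 /\ forall u, u \in U -> f u = 0.
Proof.
move=> vU; pose w := v - projv U v.
have w0 : w != 0 by apply: contraNneq vU => /eqP; rewrite subr_eq0 => /eqP ->; exact: memv_proj.
have [i ci] : exists i, coord (vbasis {:V}) i w != 0.
  apply/existsP; apply: contraNT w0 => /existsPn h; apply/eqP.
  rewrite (coord_vbasis (memvf w)) big1 // => i _.
  by move/negPn/eqP: (h i) => ->; rewrite scale0r.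
pose f u : F^o := coord (vbasis {:V}) i (u - projv U u) / coord (vbasis {:V}) i w.
have flin : linear f.
  move=> a u u'; rewrite /f linearP opprD addrACA -scalerBr linearP mulrDl.
  by rewrite -mulrA.
pose g : {linear V -> F^o} := HB.pack f (GRing.isLinear.Build F V F^o _ f flin).
exists (linfun g); split=> [|u uU]; rewrite lfunE /= /f ?mulfV //.
by rewrite projv_id // subrr linear0 mul0r.
Qed.

Section TensorModule.
Variables (C : numClosedFieldType) (m : nat).
Notation n := m.+2.
Notation var := (var n).
Notation P := {mpoly C[#|var|]}.
Notation gln := (gl C n).
Implicit Types (a b i j : 'I_n).

Definition g2_bracket (x y : 'M[C]_n * 'M[C]_n) : 'M[C]_n * 'M[C]_n :=
  (mxbracket x.1 y.1, mxbracket x.2 y.2).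

Definition g2 : lieAlgebra C.
Proof.
refine (@LieAlgebra C ('M[C]_n * 'M[C]_n)%type g2_bracket _ _ _ _)
  => [y a u v|x a u v|x|x y z]; rewrite /g2_bracket /=.
- by rewrite !mxbracket_linl.
- by rewrite !mxbracket_linr.
- by rewrite !mxbracketxx.
by congr (_, _); exact: mxbracket_jacobi.
Defined.

Definition actP : lie_action g2 P.
Proof.
refine (@LieAction C g2 P (fun x p => der (Lg x.1) p + der (Rg x.2) p) _ _ _)
  => [p a x y|x a p q|x y p] /=.
- by rewrite L_linear R_linear scalerDr addrACA.
- by rewrite !derD !derZ scalerDr addrACA.
- rewrite L_bracket R_bracket !derD !(LR_comm _ _ p) opprD.
  set A := der _ (der _ p); set B := der _ (der _ p).
  by set D := der _ (der _ p); set E := der _ (der _ p); ring.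
Defined.

Section Hw.
Variables (V : vectType C) (rho : lie_action gln V) (lam : {ffun 'I_n -> nat}).
Hypothesis irr : irreducible rho.
Variable v : V.
Hypothesis vn0 : v != 0.
Hypothesis v_raise : forall a b, (a < b)%N -> rho (delta_mx a b) v = 0.
Hypothesis v_wt : forall a, rho (delta_mx a a) v = (lam a)%:R *: v.

Definition e1 (k : 'I_n * 'I_n) : gln := delta_mx k.1 k.2.
Definition low1 (k : 'I_n * 'I_n) := (k.2 < k.1)%N.

Lemma e1_span (x : gln) : exists k : 'I_n * 'I_n -> C, x = \sum_l k l *: e1 l.
Proof.
exists (fun k => (x : 'M[C]_n) k.1 k.2); rewrite [LHS]matrix_sum_delta.
by rewrite pair_bigA.
Qed.

Lemma v_hw k : ~~ low1 k -> exists c, rho (e1 k) v = c *: v.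
Proof.
case: k => a b; rewrite /low1 /e1 /= -leqNgt leq_eqVlt => /orP[/eqP/val_inj->|ab].
  by exists (lam b)%:R.
by exists 0; rewrite v_raise // scale0r.
Qed.

Lemma stable_span (L : lieAlgebra C) (I : finType) (e : I -> L) (M : lmodType C)
    (r : lie_action L M) (W : M -> Prop) :
  (forall x, exists k : I -> C, x = \sum_(l : I) k l *: e l) -> subsp W ->
  (forall (l : I) u, W u -> W (r (e l) u)) -> forall x u, W u -> W (r x u).
Proof.
move=> es sW We x u Wu; have [k ->] := es x; rewrite act_suml.
apply: subsp_bigsum => // l _; rewrite -[_ *: _]addr0.
by apply: sW.2; [exact: We | exact: sW.1].
Qed.

Lemma irr_dich (W : V -> Prop) : subsp W -> (forall k u, W u -> W (rho (e1 k) u)) ->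
  (forall u, W u -> u = 0) \/ (forall u, W u).
Proof.
move=> sW We; have Wx := stable_span e1_span sW We.
have cl : submod_closed (fun u => `[< W u >]).
  split=> [|a u w]; first by apply/asboolP; exact: sW.1.
  by move=> /asboolP Wu /asboolP Ww; apply/asboolP; exact: sW.2.
have act x u : u \in (fun u => `[< W u >]) -> rho x u \in (fun u => `[< W u >]).
  by move=> /asboolP Wu; apply/asboolP; exact: Wx.
have [_ /(_ (Submodule cl act)) [h|h]] := irr; [left|right] => u.
  by move=> Wu; apply: h; apply/asboolP.
by have /asboolP := h u.
Qed.

Lemma gen_all u : gen e1 rho v u.
Proof.
have [h|//] := irr_dich (gen_subsp e1 rho v) (fun k => @gen_act _ _ _ e1 _ rho v k).
by case/eqP: vn0; apply: h; exact: gen_m0.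
Qed.

Lemma bracket_diag a b c : mxbracket (delta_mx a a) (delta_mx b c)
  = ((a == b)%:R - (c == a)%:R) *: delta_mx b c :> 'M[C]_n.
Proof.
rewrite /mxbracket !mul_delta_mx_cond scalerBl !scaler_nat.
by case: (a =P b) => [<-|_]; case: (c =P a) => [->|_] //=; rewrite ?mulr0n.
Qed.

(** Up to a scalar matrix, the half sum of the positive coroots. Its bracket with E_ab is (b - a)
    E_ab, so lowering operators decrease its eigenvalues. *)
Definition rhomx : 'M[C]_n := diag_mx (\row_(a < n) - (a : nat)%:R).

Lemma bracket_rhomx a b :
  mxbracket rhomx (delta_mx a b) = ((b : nat)%:R - (a : nat)%:R) *: delta_mx a b :> 'M[C]_n.
Proof.
rewrite /mxbracket mul_diag_mx mul_mx_diag; apply/matrixP => i j; rewrite !mxE.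
have [->|_] := eqVneq i a; have [->|_] := eqVneq j b;
  rewrite /= ?mulr1 ?mul1r ?mulr0 ?mul0r ?subrr //.
by rewrite opprK addrC.
Qed.

Lemma rhomx_v : rho rhomx v = (- \sum_(a < n) (a : nat)%:R * (lam a)%:R) *: v.
Proof.
have -> : rhomx = \sum_(a < n) (- (a : nat)%:R) *: (delta_mx a a : gln).
  by rewrite /rhomx diag_mx_sum_delta; apply: eq_bigr => a _; rewrite mxE.
rewrite (@act_suml _ gln _ (fun a => delta_mx a a : gln)) -sumrN scaler_suml.
by apply: eq_bigr => a _; rewrite v_wt scalerA mulNr.
Qed.

(** By [hw_notin], v is not in the sum of the images of the lowering operators. A functional that is
    1 at v and vanishes on these images is a lowest weight vector of the dual; [hw_functional] gives
    its weight. *)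
Lemma covector : exists vs : 'Hom(V, C^o), [/\ vs v = 1,
  forall a b u, (b < a)%N -> vs (rho (delta_mx a b) u) = 0 &
  forall a u, vs (rho (delta_mx a a) u) = (lam a)%:R * vs u].
Proof.
pose U : {vspace V} := (\sum_(k | low1 k) (linfun (rho (e1 k)) @: {:V})%VS)%VS.
have vU : v \notin U.
  apply/negP => /memv_sumP[us usU vE].
  have uE k : exists w, low1 k -> us k = rho (e1 k) w.
    have [lk|nlk] := boolP (low1 k); last by exists 0.
    by have /memv_imgP[w _ ->] := usU k lk; exists w => _; rewrite lfunE.
  have [s sE] := choice uE.
  case/eqP: vn0; apply: (@hw_notin _ gln _ e1 low1 e1_span _ rho v v_hw rhomx
    (- \sum_(a < n) (a : nat)%:R * (lam a)%:R) (fun k => k.1 - k.2)%N rhomx_v _ _ s).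
  - by move=> k; rewrite /low1 subn_gt0.
  - move=> k lk; transitivity ((((k.2 : nat)%:R - (k.1 : nat)%:R) *: e1 k) : gln).
      exact: bracket_rhomx.
    by rewrite natrB 1?ltnW // opprB.
  - by move=> k; exact: gen_all.
  by rewrite vE; apply: eq_bigr => k lk; rewrite sE.
have [vs [vs1 vsU]] := sep_functional vU.
have vsl k u : low1 k -> vs (rho (e1 k) u) = 0.
  move=> lk; apply/vsU/(subvP (sumv_sup k lk (subvv _))).
  by rewrite -[rho _ u](lfunE (rho (e1 k))) memv_img ?memvf.
have vsZ c u : vs (c *: u) = c * vs u by rewrite linearZ.
exists vs; split=> // [a b u ba|a u]; first exact: (vsl (a, b)).
apply/eqP; rewrite -subr_eq0; apply/eqP.
apply: (@hw_functional _ gln _ e1 low1 e1_span _ rho v v_hw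
  (fun u => vs (rho (delta_mx a a) u) - (lam a)%:R * vs u)) (gen_all u).
- by move=> u1 u2; rewrite !linearD /= mulrDr opprD addrACA.
- by move=> c u1; rewrite linearZ /= !vsZ mulrBr mulrCA.
- move=> k u1 lk; rewrite vsl // mulr0 subr0.
  have bE : @bracket _ gln (delta_mx a a) (e1 k) =
    ((a == k.1)%:R - (k.2 == a)%:R) *: e1 k + 0 by rewrite addr0; exact: bracket_diag.
  have := act_bracket rho (delta_mx a a) (e1 k) u1.
  rewrite bE act_linl => /(congr1 vs); rewrite linearB linearD /= vsZ !vsl // mulr0 add0r subr0 => <-.
  have := act_suml e1 rho (fun=> 0) u1.
  by rewrite !big1 => [->||]; rewrite ?linear0 // => l _; rewrite scale0r.
by rewrite v_wt vsZ vs1 mulr1 subrr.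
Qed.

End Hw.
End TensorModule.

(** * V (x) V^* as the module generated by [Delta] *)

Lemma annihilator_full (F : fieldType) (V : vectType F) (U : {vspace 'Hom(V, F^o)}) :
  (forall w, (forall h, h \in U -> h w = 0) -> w = 0) -> forall f, f \in U.
Proof.
move=> ann f; apply: contraT => /sep_functional[g [gf gU]].
pose b := vbasis {:V}; pose ci i : 'Hom(V, F^o) := linfun (coord b i : V -> F^o).
pose w := \sum_i g (ci i) *: b`_i.
have gE h : g h = h w.
  have hE : h = \sum_(i < \dim {:V}) h b`_i *: ci i.
    apply/lfunP => u; rewrite {1}(coord_vbasis (memvf u)) linear_sum sum_lfunE.
    by apply: eq_bigr => i _; rewrite linearZ scale_lfunE lfunE; exact: mulrC.
  rewrite {1}hE !linear_sum; apply: eq_bigr => i _; rewrite !linearZ.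
  exact: mulrC.
have w0 : w = 0 by apply: ann => h /gU; rewrite gE.
by move: gf; rewrite gE w0 linear0 => /eqP; rewrite eq_sym oner_eq0.
Qed.

Section Pairing.
Variables (F : fieldType) (V : vectType F).
Notation H := 'Hom(V, F^o).
Notation bV := (vbasis {:V}).
Notation bW := (vbasis {:H}).
Notation T := (tensor_sort V H).

(* V (x) V^* as endomorphisms of V. *)
Definition tapp (t : T) (u : V) : V := \sum_(i < \dim {:V}) \sum_(j < \dim {:H}) (t i j * (bW`_j : H) u) *: bV`_i.

Lemma tapp_linl u : linear (tapp^~ u).
Proof.
move=> a s t; rewrite /tapp scaler_sumr -big_split; apply: eq_bigr => i _ /=.
rewrite scaler_sumr -big_split; apply: eq_bigr => j _ /=.
by rewrite !mxE scalerA -scalerDl mulrDl mulrA.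
Qed.

Lemma tapp_linr t : linear (tapp t).
Proof.
move=> a u v; rewrite /tapp scaler_sumr -big_split; apply: eq_bigr => i _ /=.
rewrite scaler_sumr -big_split; apply: eq_bigr => j _ /=.
by rewrite linearP /= scalerA -scalerDl mulrDr mulrCA.
Qed.

Lemma tapp_tensor p (w : H) u : tapp (tensor p w) u = w u *: p.
Proof.
rewrite {2}(coord_vbasis (memvf p)) scaler_sumr; apply: eq_bigr => i _.
rewrite -scaler_suml scalerA; congr (_ *: _).
rewrite {2}(coord_vbasis (memvf w)) sum_lfunE mulr_suml; apply: eq_bigr => j _.
rewrite scale_lfunE /tensor mxE big_ord1 mxE -!passmx.coord_rVof.
by rewrite -mulrA mulrC.
Qed.

Lemma tensor_expand (t : T) : t = \sum_(i < \dim {:V}) \sum_(j < \dim {:H}) t i j *: tensor bV`_i (bW`_j : H).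
Proof.
rewrite [LHS]matrix_sum_delta; apply: eq_bigr => i _; apply: eq_bigr => j _.
rewrite /tensor (passmx.rVofE (vbasisP _)) (passmx.rVofE (vbasisP {:H})).
by rewrite trmx_delta mul_delta_mx.
Qed.

Lemma tapp_inj t : (forall u, tapp t u = 0) -> t = 0.
Proof.
move=> t0; apply/matrixP => i j; rewrite mxE.
have z : \sum_(j < \dim {:H}) t i j *: (bW`_j : H) = 0.
  apply/lfunP => u; rewrite sum_lfunE zero_lfunE.
  have := t0 u; rewrite /tapp; under eq_bigr do rewrite -scaler_suml.
  move/(congr1 (coord bV i)); rewrite linear0 coord_sum_free ?(basis_free (vbasisP _)) //.
  by move=> z; rewrite -[RHS]z; apply: eq_bigr => k _; rewrite scale_lfunE.
move/(congr1 (coord bW j)): z; rewrite linear0.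
by rewrite coord_sum_free ?(basis_free (vbasisP _)).
Qed.

Lemma tensor_linl (w : H) : linear (fun p : V => tensor p w).
Proof. by move=> a p q; rewrite /tensor passmx.rVof_linear linearP /= mulmxDl scalemxAl. Qed.

Lemma tensor_linr (v : V) : linear (fun w : H => tensor v w).
Proof. by move=> a p q; rewrite /tensor passmx.rVof_linear mulmxDr scalemxAr. Qed.

End Pairing.

Lemma linear_fun0 (F : pzRingType) (M N : lmodType F) (f : M -> N) : linear f -> f 0 = 0.
Proof. by move=> fl; have := fl (-1) 0 0; rewrite !scaleN1r addr0 oppr0 addNr. Qed.

Lemma act0 (F : fieldType) (L : lieAlgebra F) (M : lmodType F) (r : lie_action L M) u :
  r 0 u = 0.
Proof. exact: (linear_fun0 (act_linl r u)). Qed.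

Section TensorRealize.
Variables (C : numClosedFieldType) (m : nat).
Notation n := m.+2.
Notation var := (var n).
Notation P := {mpoly C[#|var|]}.
Notation gln := (gl C n).
Notation g2 := (g2 C m).
Notation actP := (actP C m).
Implicit Types (a b i j : 'I_n).
Variables (V : vectType C) (rho : lie_action gln V) (lam : {ffun 'I_n -> nat}).
Hypothesis lamP : is_partition lam.
Notation H := 'Hom(V, C^o).
Notation T := (tensor_sort V H).

(** The two factors of gl x gl act separately on V and on V^*; restricted to the diagonal sl, this
    is [tensor_dual]. *)
Definition pull1 : lie_action g2 V.
Proof.
refine (@LieAction C g2 V (fun x => rho x.1) _ _ _) => [u a x y|x|x y u].
- exact: (act_linl rho u a x.1 y.1).
- exact: act_linr.
- exact: (act_bracket rho x.1 y.1).
Defined.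

Definition pull2 : lie_action g2 V.
Proof.
refine (@LieAction C g2 V (fun x => rho x.2) _ _ _) => [u a x y|x|x y u].
- exact: (act_linl rho u a x.2 y.2).
- exact: act_linr.
- exact: (act_bracket rho x.2 y.2).
Defined.

Definition tau : lie_action g2 T := tensor_action pull1 (dual_action pull2).

Lemma tau_tensor (x : g2) v w :
  tau x (tensor v w) = tensor (rho x.1 v) w + tensor v (dual_fun pull2 x w).
Proof. exact: (tensor_funE pull1 (dual_action pull2)). Qed.

Lemma tau_diag (x : sl C n) t :
  mod_act (tensor_dual rho) x t = tau (vsval x, vsval x) t.
Proof.
by rewrite /= /tensor_fun; congr (_^T *m _ + _ *m _).
Qed.

Lemma tapp_tau (x : g2) t u :
  tapp (tau x t) u = rho x.1 (tapp t u) - tapp t (rho x.2 u).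
Proof.
have LR s : linear (fun t : T => tapp t s) by exact: tapp_linl.
have E (K : T -> V) : linear K ->
    K t = \sum_(i < \dim {:V}) \sum_(j < \dim {:H}) t i j *: K (tensor (vbasis {:V})`_i (vbasis {:H})`_j).
  move=> Klin; pose k : {linear T -> V} := HB.pack K (GRing.isLinear.Build C T V _ K Klin).
  rewrite {1}[t]tensor_expand -[K _]/(k _) linear_sum; apply: eq_bigr => i _.
  by rewrite linear_sum; apply: eq_bigr => j _; rewrite linearZ.
rewrite (E (fun t => tapp (tau x t) u)); last first.
  by move=> a s s'; rewrite linearP LR.
rewrite (E (fun t => rho x.1 (tapp t u) - tapp t (rho x.2 u))); last first.
  move=> a s s'; rewrite !LR linearP /=; rewrite scalerBr opprD; exact: addrACA.
apply: eq_bigr => i _; apply: eq_bigr => j _; congr (_ *: _).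
rewrite tau_tensor -[X in tapp (X + _)]scale1r LR scale1r !tapp_tensor linearZ /=.
by rewrite dual_funE scaleNr.
Qed.

Section Hw.
Hypothesis irr : irreducible rho.
Variable v : V.
Hypothesis vn0 : v != 0.
Hypothesis v_raise : forall a b, (a < b)%N -> rho (delta_mx a b) v = 0.
Hypothesis v_wt : forall a, rho (delta_mx a a) v = (lam a)%:R *: v.
Variable vs : H.
Hypothesis vs1 : vs v = 1.
Hypothesis vs_low : forall a b u, (b < a)%N -> vs (rho (delta_mx a b) u) = 0.
Hypothesis vs_wt : forall a u, vs (rho (delta_mx a a) u) = (lam a)%:R * vs u.

Definition e2 (k : ('I_n * 'I_n) + ('I_n * 'I_n)) : g2 :=
  match k with inl k => (e1 C k, 0) | inr k => (0, e1 C k) end.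
(** The order is reversed on the second factor, where [vs] is a lowest weight vector and [Delta] is
    singular for lower triangular matrices. *)
Definition low2 (k : ('I_n * 'I_n) + ('I_n * 'I_n)) : bool :=
  match k with inl k => (k.2 < k.1)%N | inr k => (k.1 < k.2)%N end.

Lemma e2_span (x : g2) : exists k, x = \sum_l k l *: e2 l.
Proof.
have [k1 E1] := e1_span (C := C) x.1; have [k2 E2] := e1_span (C := C) x.2.
exists (fun l => match l with inl l => k1 l | inr l => k2 l end).
rewrite big_sumType /= [LHS]surjective_pairing {1}E1 {1}E2.
transitivity ((\sum_l k1 l *: e1 C l, 0) + (0, \sum_l k2 l *: e1 C l) : g2).
  by congr (_, _); rewrite ?addr0 ?add0r.
congr (_ + _).
  elim/big_rec2: _ => //= l y z _ <-.
  by congr (_, _); rewrite /= ?scaler0 ?addr0.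
elim/big_rec2: _ => //= l y z _ <-.
by congr (_, _); rewrite /= ?scaler0 ?addr0.
Qed.

Definition pairM : lieModule g2 := dsum (LieModule tau) (LieModule actP).
Definition pact : lie_action g2 (T * P)%type := mod_act pairM.
Definition hw0 : (T * P)%type := (tensor v vs, Delta C lam).
(* The graph of the isomorphism of V (x) V^* with M_lam. *)
Definition Gam (t : T) (p : P) := gen e2 pact hw0 (t, p).

Lemma tau_l a b s w : tau (e2 (inl (a, b))) (tensor s w) = tensor (rho (delta_mx a b) s) w.
Proof.
rewrite tau_tensor (_ : dual_fun _ _ _ = 0) ?(linear_fun0 (@tensor_linr _ _ s)) ?addr0 //.
by apply/lfunP => u; rewrite dual_funE zero_lfunE /= act0 linear0 oppr0.
Qed.

Lemma tau_r a b s w : tau (e2 (inr (a, b))) (tensor s w)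
  = tensor s (dual_action rho (delta_mx a b) w).
Proof.
rewrite tau_tensor /= act0 (linear_fun0 (@tensor_linl _ _ w)) add0r.
by congr tensor.
Qed.

Lemma actP_l a b p : actP (e2 (inl (a, b))) p = der (Lg (delta_mx a b)) p.
Proof.
rewrite /= (linear_fun0 (f := fun y : 'M[C]_n => der (Rg y) p)) ?addr0 // => c x y.
exact: R_linear.
Qed.

Lemma actP_r a b p : actP (e2 (inr (a, b))) p = der (Rg (delta_mx a b)) p.
Proof.
rewrite /= (linear_fun0 (f := fun y : 'M[C]_n => der (Lg y) p)) ?add0r // => c x y.
exact: L_linear.
Qed.

Lemma pactE x (q : T * P) : pact x q = (tau x q.1, actP x q.2).
Proof. by []. Qed.

Lemma hw0_hw k : ~~ low2 k -> exists c, pact (e2 k) hw0 = c *: hw0.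
Proof.
have [sL sR] := @sing_Delta C m.+1 lam; have [wL wR] := wt_Delta C lamP.
case: k => -[a b]; rewrite [low2 _]/= -leqNgt leq_eqVlt => /orP[/eqP/val_inj E|ab].
- exists (lam a)%:R; rewrite pactE tau_l actP_l -E v_wt -rSE wL.
  by congr (_, _); rewrite -[_ *: v]addr0 tensor_linl (linear_fun0 (@tensor_linl _ _ vs)) addr0.
- exists 0; rewrite scale0r pactE tau_l actP_l sL // v_raise //.
  by rewrite (linear_fun0 (@tensor_linl _ _ vs)).
- exists (- (lam a)%:R); rewrite pactE tau_r actP_r E -[der _ _]opprK -cSE wR -scaleNr.
  congr (_, _); rewrite -[RHS]addr0 -[in RHS](linear_fun0 (@tensor_linr _ _ v)) -tensor_linr.
  congr tensor; apply/lfunP => u; rewrite addr0 dual_funE vs_wt scale_lfunE.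
  by rewrite -mulNr.
- exists 0; rewrite scale0r pactE tau_r actP_r sR //.
  rewrite (_ : dual_action rho _ vs = 0) ?(linear_fun0 (@tensor_linr _ _ v)) //.
  by apply/lfunP => u; rewrite dual_funE vs_low // oppr0 zero_lfunE.
Qed.

Notation D := (Delta C lam : P).
Notation gl1 := (gspan (fun l => l = lam)).

Lemma Gam_P c t p t' p' : Gam t p -> Gam t' p' -> Gam (c *: t + t') (c *: p + p').
Proof. exact: (gen_subsp e2 pact hw0).2. Qed.

Lemma Gam0 : Gam 0 0.
Proof. exact: (gen_subsp e2 pact hw0).1. Qed.

Lemma Gam_act x t p : Gam t p -> Gam (tau x t) (actP x p).
Proof.
move=> G; have := @stable_span C g2 _ e2 _ pact (gen e2 pact hw0) e2_span.
move=> /(_ (gen_subsp e2 pact hw0) (fun k => @gen_act _ _ _ e2 _ pact hw0 k) x _ G).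
exact.
Qed.

Lemma Gam_L a b t p : Gam t p -> Gam (tau (e2 (inl (a, b))) t) (der (Lg (delta_mx a b)) p).
Proof. by move=> /(Gam_act (e2 (inl (a, b)))); rewrite actP_l. Qed.

Lemma Gam_R a b t p : Gam t p -> Gam (tau (e2 (inr (a, b))) t) (der (Rg (delta_mx a b)) p).
Proof. by move=> /(Gam_act (e2 (inr (a, b)))); rewrite actP_r. Qed.

(** Both sides are functionals of the pair (t, p) whose difference vanishes on the images of the
    lowering operators, and they agree at the generating pair. *)
Lemma Gam_kap t p : Gam t p -> vs (tapp t v) * fis D D = fis p D.
Proof.
move=> G; apply/eqP; rewrite -subr_eq0; apply/eqP; have [sL sR] := @sing_Delta C m.+1 lam.
apply: (@hw_functional _ g2 _ e2 low2 e2_span _ pact hw0 hw0_hw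
  (fun q => vs (tapp q.1 v) * fis D D - fis q.2 D) _ _ _ _ (t, p) G).
- move=> [s q] [s' q'] /=; rewrite -[s]scale1r tapp_linl !scale1r linearD mulrDl fisDl opprD.
  exact: addrACA.
- move=> c [s q] /=; rewrite -[_ *: s]addr0 tapp_linl (linear_fun0 (tapp_linl v)) addr0.
  by rewrite linearZ /= fisZl mulrBr mulrA.
- move=> k [s q]; pose K k := vs (tapp (tau (e2 k) s) v) * fis D D - fis (actP (e2 k) q) D.
  rewrite -[LHS]/(K k); case: k => -[a b] ab; rewrite /K.
    rewrite actP_l tapp_tau [(_).1]/= [(_).2]/= linearB /= vs_low // act0.
    rewrite (linear_fun0 (tapp_linr s)) linear0 subr0 mul0r fis_L mxadj_delta sL //.
    by rewrite fis0r subr0.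
  rewrite actP_r tapp_tau [(_).1]/= [(_).2]/= act0 v_raise // (linear_fun0 (tapp_linr s)).
  by rewrite subrr linear0 mul0r fis_R mxadj_delta sR // fis0r subr0.
by rewrite /= tapp_tensor vs1 scale1r vs1 mul1r subrr.
Qed.

Lemma Gam_gspan t p : Gam t p -> gl1 p.
Proof.
have sg := @gspan_subsp C m.+1 (fun l => l = lam).
have [gL gR] := @gspan_gstable C m.+1 (fun l => l = lam).
move=> G; refine (G (fun q => gl1 q.2) _ _ _) => /=.
- by split=> [|c q q' Hq Hq']; [exact: (sg.1) | exact: (sg.2 c q.2 q'.2 Hq Hq')].
- case=> -[a b] q Hq.
    have h : gl1 (actP (e2 (inl (a, b))) q.2) by rewrite actP_l; exact: gL.
    exact: h.
  have h : gl1 (actP (e2 (inr (a, b))) q.2) by rewrite actP_r; exact: gR.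
  exact: h.
exact: gspan_Delta.
Qed.

Lemma gspan_Gam p : gl1 p -> exists t, Gam t p.
Proof.
move=> G; refine (G (fun q => exists t, Gam t q) _ _ _).
- split=> [|c q q' [t Ht] [t' Ht']]; first by exists 0; exact: Gam0.
  by exists (c *: t + t'); exact: Gam_P.
- split=> a b q [t Ht].
    by exists (tau (e2 (inl (a, b))) t); exact: Gam_L.
  by exists (tau (e2 (inr (a, b))) t); exact: Gam_R.
by move=> l _ ->; exists (tensor v vs); exact: gen_m0.
Qed.

(** The polynomials related to 0 form a stable subspace, orthogonal to [Delta C lam] by [Gam_kap].
    It is then orthogonal to everything that [Delta C lam] generates, itself included. *)
Lemma Gam_fun p : Gam 0 p -> p = 0.
Proof.
move=> G; pose B q := Gam 0 q; apply: fis_eq0.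
have oB : orth B p; last exact: oB.
have sB : subsp B.
  split=> [|c q q' Hq Hq']; first exact: Gam0.
  by have := Gam_P c Hq Hq'; rewrite scaler0 addr0.
have gB : gstable B.
  by split=> a b q; [move=> /(Gam_L a b) | move=> /(Gam_R a b)]; rewrite linear0.
have := Gam_gspan G; apply; [exact: orth_subsp | exact: orth_gstable |].
move=> l _ -> q /Gam_kap; rewrite (linear_fun0 (tapp_linl v)) linear0 mul0r.
by [].
Qed.

Lemma fisDD : fis D D != 0.
Proof. by apply: contraNneq (Delta_neq0 C lam) => /fis_eq0 ->. Qed.

(** Let A be the stable space of tensors related to 0, seen as endomorphisms of V. By [Gam_kap], vs
    (s v) = 0 for s in A. Irreducibility, through the right action, extends this from v to all u.
    For fixed u the vectors s u then form a stable subspace without v, hence zero. *)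
Lemma Gam_inj t : Gam t 0 -> t = 0.
Proof.
move=> G; pose A s := Gam s 0.
have A_l a b s : A s -> A (tau (e2 (inl (a, b))) s).
  by rewrite /A => /(Gam_L a b); rewrite der0.
have A_r a b s : A s -> A (tau (e2 (inr (a, b))) s).
  by rewrite /A => /(Gam_R a b); rewrite der0.
have AP c s s' : A s -> A s' -> A (c *: s + s').
  by move=> As As'; have := Gam_P c As As'; rewrite scaler0 addr0.
have vs0 u s : A s -> vs (tapp s u) = 0.
  pose W u := forall s, A s -> vs (tapp s u) = 0.
  have sW : subsp W.
    split=> [s' _|c u1 u2 W1 W2 s' As']; first by rewrite (linear_fun0 (tapp_linr _)) linear0.
    by rewrite tapp_linr linearP /= W1 // W2 // scaler0 addr0.
  have [|h|h] := irr_dich irr sW; last by exact: h.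
  + move=> [a b] u1 Wu s' As'; have := Wu _ (A_r a b _ As').
    rewrite tapp_tau /= act0 add0r linearN => /eqP; rewrite oppr_eq0 => /eqP.
    by [].
  case/eqP: vn0; apply: h => s' As'; apply/eqP.
  have /eqP := Gam_kap As'; rewrite [fis 0 _](fis_sym0 (fis0r _)) mulf_eq0.
  by rewrite (negPf fisDD) orbF.
apply: tapp_inj => u.
pose W w := exists2 s, A s & tapp s u = w.
have sW : subsp W.
  split=> [|c _ _ [s As <-] [s' As' <-]].
    by exists 0; [exact: Gam0 | rewrite (linear_fun0 (tapp_linl u))].
  by exists (c *: s + s'); [exact: AP | rewrite tapp_linl].
have [|h|h] := irr_dich irr sW; first 1 last.
- by apply: h; exists t.
- have [s As sE] := h v; have := vs0 u s As; rewrite sE vs1.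
  by move/eqP; rewrite oner_eq0.
move=> [a b] _ [s As <-]; exists (tau (e2 (inl (a, b))) s); first exact: A_l.
by rewrite tapp_tau /= act0 (linear_fun0 (tapp_linr s)) subr0.
Qed.

(** Irreducibility gives all tensors u (x) vs. For fixed u, the common zeros of the functionals w
    with u (x) w in the domain form a stable subspace, without v since [vs] is among these w; so it
    is zero and all w occur. *)
Lemma Gam_total t : exists p, Gam t p.
Proof.
pose A s := exists p, Gam s p.
have sA : subsp A.
  split=> [|c s s' [p Hp] [p' Hp']]; first by exists 0; exact: Gam0.
  by exists (c *: p + p'); exact: Gam_P.
have A_act x s : A s -> A (tau x s) by move=> [p /(Gam_act x) Hp]; exists (actP x p).
have A1 u : A (tensor u vs).
  pose W u := A (tensor u vs).
  have sW : subsp W.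
    split=> [|c u1 u2 W1 W2]; first by rewrite /W (linear_fun0 (@tensor_linl _ _ vs)); exact: sA.1.
    by rewrite /W tensor_linl; exact: sA.2.
  have [|h|h] := irr_dich irr sW; last by exact: h.
  + by move=> [a b] u1 /(A_act (e2 (inl (a, b)))); rewrite tau_l.
  by case/eqP: vn0; apply: h; exists D; exact: gen_m0.
have A2 u w : A (tensor u w).
  have [|U UP] := @subsp_vspace _ _ (fun w => A (tensor u w)).
    split=> [|c u1 u2 W1 W2]; first by rewrite (linear_fun0 (@tensor_linr _ _ u)); exact: sA.1.
    by rewrite tensor_linr; exact: sA.2.
  apply/UP; apply: annihilator_full => {}w {}wU.
  pose W w := forall h, h \in U -> h w = 0.
  have sW : subsp W.
    split=> [h _|c u1 u2 W1 W2 h hU]; first by rewrite linear0.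
    by rewrite linearP /= W1 // W2 // scaler0 addr0.
  have [|h|h] := irr_dich irr sW; [|exact: h|].
    move=> [a b] u1 Wu h hU; have : dual_action rho (delta_mx a b) h \in U.
      by apply/UP; rewrite -tau_r; apply: A_act; apply/UP.
    by move=> /Wu; rewrite dual_funE => /eqP; rewrite oppr_eq0 => /eqP.
  have vsU : vs \in U by apply/UP.
  by have := h v vs vsU; rewrite vs1 => /eqP; rewrite oner_eq0.
rewrite [t]tensor_expand; apply: (subsp_bigsum (W := A)) => // i _; apply: (subsp_bigsum (W := A)) => // j _.
by rewrite -[_ *: _]addr0; apply: sA.2 => //; exact: sA.1.
Qed.

Lemma Gam_realizes : realizes (@Dsl C m) (tensor_dual rho) gl1.
Proof.
apply: (@realizes_graph _ _ _ _ (tensor_dual rho) _ Gam).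
- by move=> c u v' p q; exact: Gam_P.
- exact: Gam_total.
- exact: Gam_fun.
- exact: Gam_inj.
- by move=> x u p /(Gam_act (vsval x, vsval x)); rewrite tau_diag /Dsl DgE.
by move=> p; split=> [/gspan_Gam//|[t]]; exact: Gam_gspan.
Qed.

End Hw.

Lemma tensor_dual_realizes : irreducible_highest_weight rho lam ->
  realizes (@Dsl C m) (tensor_dual rho) (gspan (fun l => l = lam)).
Proof.
move=> [irr [v [vn0 v_raise v_wt]]].
have [vs [vs1 vs_low vs_wt]] := covector irr vn0 v_raise v_wt.
exact: (Gam_realizes irr vn0 v_raise v_wt vs1).
Qed.

End TensorRealize.

(** * Comparison of the three modules *)

Section Assembly.
Variables (C : numClosedFieldType) (m : nat).
Notation n := m.+2.
Notation var := (var n).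
Notation P := {mpoly C[#|var|]}.
Notation gln := (gl C n).
Notation actP := (actP C m).
Notation trz := (@trz C m).
Notation Dsl := (@Dsl C m).
Notation e2 := (@e2 C m).
Implicit Types (p q : P) (lam mu l : {ffun 'I_n -> nat}) (B : {ffun 'I_n -> nat} -> Prop).

Lemma Delta_hw mu (k : ('I_n * 'I_n) + ('I_n * 'I_n)) : is_partition mu -> ~~ low2 k ->
  exists c, actP (e2 k) (Delta C mu) = c *: (Delta C mu : P).
Proof.
move=> muP; have [sL sR] := @sing_Delta C m.+1 mu; have [wL wR] := wt_Delta C muP.
case: k => -[a b]; rewrite [low2 _]/= -leqNgt leq_eqVlt => /orP[/eqP/val_inj E|ab].
- by exists (mu a)%:R; rewrite actP_l -E -rSE wL.
- by exists 0; rewrite scale0r actP_l sL.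
- by exists (- (mu a)%:R); rewrite actP_r E -[der _ _]opprK -cSE wR -scaleNr.
- by exists 0; rewrite scale0r actP_r sR.
Qed.

Lemma gspan1_gen mu p : gspan (fun l => l = mu) p -> gen e2 actP (Delta C mu) p.
Proof.
apply; first exact: gen_subsp.
- split=> a b q Hq.
    by rewrite -actP_l; exact: gen_act Hq.
  by rewrite -actP_r; exact: gen_act Hq.
by move=> l _ ->; exact: gen_m0.
Qed.

Lemma fis_Delta lam mu : is_partition lam -> is_partition mu -> lam != mu ->
  fis (Delta C mu) (Delta C lam) = 0.
Proof.
move=> lamP muP lm; have [a alm] : exists a, mu a != lam a.
  apply/existsP; apply: contraNT lm => /existsPn h; apply/eqP/ffunP => a.
  by apply/esym/eqP; move/negPn: (h a).
have := fis_L (delta_mx a a) (Delta C mu) (Delta C lam); rewrite mxadj_delta -!rSE.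
rewrite (wt_Delta C muP).1 (wt_Delta C lamP).1 fisZl fisZr conjC_nat => /eqP.
rewrite -subr_eq0 -mulrBl mulf_eq0 subr_eq0 eqr_nat (negPf alm) => /eqP.
by [].
Qed.

(** The product with [Delta C lam] kills the images of the lowering operators by adjunction, and it
    vanishes at the generator [Delta C mu] because the weights differ. *)
Lemma gspan_Delta_orth lam mu p : is_partition lam -> is_partition mu -> lam != mu ->
  gspan (fun l => l = mu) p -> fis p (Delta C lam) = 0.
Proof.
move=> lamP muP lm /gspan1_gen; have [sL sR] := @sing_Delta C m.+1 lam.
apply: (@hw_functional _ (g2 C m) _ e2 (@low2 m) (@e2_span C m) _ actP _ _
  (fun q => fis q (Delta C lam))).
- by move=> k; exact: Delta_hw.
- by move=> q q'; rewrite fisDl.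
- by move=> c q; rewrite fisZl.
- case=> -[a b] q ab.
    by rewrite actP_l fis_L mxadj_delta sL // fis0r.
  by rewrite actP_r fis_R mxadj_delta sR // fis0r.
exact: fis_Delta.
Qed.

Lemma gspan_orth B mu p : is_partition mu -> ~ B mu -> gspan (fun l => l = mu) p ->
  orth (gspan B) p.
Proof.
move=> muP nB Hp q Hq; apply: fis_sym0.
suff oq : orth (gspan (fun l => l = mu)) q by exact: oq.
apply: Hq; [exact: orth_subsp | apply: orth_gstable; exact: gspan_gstable|].
move=> lam lamP Bl r Hr; apply: gspan_Delta_orth Hr => //.
by apply/eqP => E; apply: nB; rewrite -E.
Qed.

Lemma gspan_union B B' p : gspan (fun l => B l \/ B' l) p <->
  exists q r, [/\ gspan B q, gspan B' r & p = q + r].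
Proof.
split=> [|[q [r [Hq Hr ->]]]]; last first.
  by apply: (subspD (@gspan_subsp C m.+1 _)); [apply: gspan_mono Hq => l _; left
    | apply: gspan_mono Hr => l _; right].
have sB := @gspan_subsp C m.+1 B; have sB' := @gspan_subsp C m.+1 B'.
have [gL gR] := @gspan_gstable C m.+1 B; have [gL' gR'] := @gspan_gstable C m.+1 B'.
move=> Hp; refine (Hp (fun p => exists q r, [/\ gspan B q, gspan B' r & p = q + r]) _ _ _).
- split=> [|c _ _ [q [r [Hq Hr ->]]] [q' [r' [Hq' Hr' ->]]]].
    by exists 0, 0; split; [exact: (sB.1) | exact: (sB'.1) | rewrite addr0].
  exists (c *: q + q'), (c *: r + r'); split; [exact: (sB.2 c q q') | exact: (sB'.2 c r r') |].
  by rewrite scalerDr addrACA.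
- split=> a b _ [q [r [Hq Hr ->]]].
    by exists (der (Lg (delta_mx a b)) q), (der (Lg (delta_mx a b)) r); split; [exact: gL | exact: gL' | exact: derD].
  by exists (der (Rg (delta_mx a b)) q), (der (Rg (delta_mx a b)) r); split; [exact: gR | exact: gR' | exact: derD].
move=> lam lamP [Bl|Bl].
  by exists (Delta C lam), 0; split; [exact: gspan_Delta | exact: sB'.1 | rewrite addr0].
by exists 0, (Delta C lam); split; [exact: sB.1 | exact: gspan_Delta | rewrite add0r].
Qed.

Lemma gspan_none B p : (forall l, is_partition l -> ~ B l) -> gspan B p -> p = 0.
Proof.
move=> nB Hp; refine (Hp (fun p => p = 0) _ _ _) => [||l lP /(nB l lP)] //.
  by split=> // c _ _ -> ->; rewrite scaler0 addr0.
by split=> a b _ ->; exact: der0.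
Qed.

Lemma Dsl_linear x : linear (Dsl x).
Proof. by move=> c p q; rewrite /Dsl derD derZ. Qed.

Variables (V : {ffun 'I_n -> nat} -> vectType C) (rho : forall lam, lie_action gln (V lam)).
Hypothesis rhoP : forall lam, is_partition lam -> irreducible_highest_weight (rho lam) lam.

(** The w j are distinct partitions, so the summands are orthogonal and their sum is direct. *)
Lemma big_realizes (J : eqType) (w : J -> {ffun 'I_n -> nat}) (r : seq J) (Q : pred J) :
  injective w -> uniq r -> (forall j, Q j -> is_partition (w j)) ->
  realizes Dsl (\big[@dsum C (sl C n) / zero_module (sl C n)]_(j <- r | Q j) tensor_dual (rho (w j)))
    (gspan (fun l => exists2 j, j \in r & Q j /\ w j = l)).
Proof.
move=> wI + QP; elim: r => [_|j r IH /= /andP[jr ur]].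
  rewrite big_nil; apply: realizes_ext (realizes_zero _) => [p|x]; last exact: der0.
  split=> [->|]; first exact: (@gspan_subsp C m.+1 _).1.
  by apply: gspan_none => l _ [].
rewrite big_cons; case: ifP => Qj; last first.
  apply: realizes_ext (IH ur) => p; split; apply: gspan_mono => l _ [i ir [Qi <-]].
    by exists i; rewrite ?inE ?ir ?orbT.
  move: ir; rewrite inE => /orP[/eqP E|ir]; last by exists i.
  by rewrite E Qj in Qi.
have jP := QP j Qj; have RT := tensor_dual_realizes jP (rhoP jP).
have RI p : gspan (fun l => l = w j) p ->
    gspan (fun l => exists2 j, j \in r & Q j /\ w j = l) p -> p = 0.
  move=> Hp Hp'; apply: fis_eq0; refine (gspan_orth jP _ Hp Hp') => -[i ir [_ /wI E]].
  by rewrite -E ir in jr.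
apply: realizes_ext (realizes_dsum Dsl_linear RI RT (IH ur)) => p.
split=> [/gspan_union|Hp]; last apply/gspan_union.
  apply: gspan_mono => l _ [->|[i ir [Qi <-]]]; first by exists j; rewrite ?mem_head.
  by exists i; rewrite ?inE ?ir ?orbT.
apply: gspan_mono Hp => l _ [i ir [Qi <-]].
move: ir; rewrite inE => /orP[/eqP->|ir]; first by left.
by right; exists i.
Qed.

Lemma big_HH K M :
  (forall p, gspan (fun l => exists2 j : {ffun 'I_n -> 'I_K}, j \in index_enum _ &
    (is_partition (weight j) && (\sum_i j i == M)%N) /\ weight j = l) p <-> HH K M p).
Proof.
move=> p; split=> [Hp|/HH_gspan Hp].
  apply: gspan_HH; apply: gspan_mono Hp => l _ [j _ [/andP[_ /eqP <-] <-]].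
  rewrite ffunE ltn_ord; split=> //; apply: eq_bigr => i _; exact: ffunE.
apply: gspan_mono Hp => l lP [lK lM]; case: K lK => // K lK.
have lt i : (l i < K.+1)%N.
  by apply: leq_ltn_trans lK; move/forallP: lP => /(_ ord0)/forallP/(_ i).
have E : weight [ffun i => Ordinal (lt i)] = l by apply/ffunP => i; rewrite !ffunE.
exists [ffun i => Ordinal (lt i)]; first exact: mem_index_enum.
by split=> //; rewrite E lP -lM; apply/eqP/eq_bigr => i _; rewrite ffunE.
Qed.

Lemma trz_neq0 : trz != 0.
Proof.
apply/eqP => /(congr1 (ev (fun=> 1))) /eqP; rewrite ev_trz ev0 sumr_const card_ord.
by rewrite pnatr_eq0.
Qed.

(** [trz] is invariant under the diagonal action and is not a zero divisor. Multiplication by it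
    moves the summands of degree m - 1 into degree m. *)
Lemma realizes_mul (N : lieModule (sl C n)) (W : P -> Prop) : realizes Dsl N W ->
  realizes Dsl N (fun p => exists2 q, W q & trz * q = p).
Proof.
move=> [f [fi fD fW]]; apply: (@realizes_graph _ _ _ _ _ _ (fun u p => p = trz * f u)).
- by move=> c u v p q -> ->; rewrite linearP mulrDr scalerAr.
- by move=> u; exists (trz * f u).
- by move=> p ->; rewrite linear0 mulr0.
- move=> u /esym/eqP; rewrite mulf_eq0 (negPf trz_neq0) => /eqP fu.
  by apply: fi; rewrite fu linear0.
- by move=> x u p ->; rewrite fD /Dsl derM D_trz mul0r add0r.
move=> p; split=> [[_ /fW[u <-] <-]|[u ->]]; first by exists u.
by exists (f u) => //; apply/fW; exists u.
Qed.

Lemma weight_inj K : injective (@weight n K).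
Proof.
by move=> j j' /ffunP E; apply/ffunP => i; apply/val_inj; have := E i; rewrite !ffunE.
Qed.

Lemma C2_iso k M :
  lie_iso
    (dsum (C2_part C n k M)
       (\big[@dsum C (sl C n) / zero_module (sl C n)]_(
          lam : {ffun 'I_n -> 'I_k} |
          is_partition (weight lam) && ((\sum_i lam i).+1 == M)%N)
          tensor_dual (rho (weight lam))))
    (\big[@dsum C (sl C n) / zero_module (sl C n)]_(
       lam : {ffun 'I_n -> 'I_k.+1} |
       is_partition (weight lam) && (\sum_i lam i == M)%N)
       tensor_dual (rho (weight lam))).
Proof.
have R1 := @big_realizes _ _ _ (fun j => is_partition (weight j) && (\sum_i j i == M)%N)
  (@weight_inj k.+1) (index_enum_uniq _) (fun j => @proj1 _ _ \o andP).
have {}R1 := realizes_ext (@big_HH k.+1 M) R1.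
have R2 := @big_realizes _ _ _ (fun j => is_partition (weight j) && ((\sum_i j i).+1 == M)%N)
  (@weight_inj k) (index_enum_uniq _) (fun j => @proj1 _ _ \o andP).
have {}R2 := realizes_mul R2.
set W := fun p : P => _ in R2.
(* In degree 0 the second sum is empty and W is zero, whereas [trW k 0] has no elements; hence the
   alternative p = 0. *)
have WE p : W p <-> p = 0 \/ trW k M p.
  case: M @W {R1 R2} => [|M] W; last first.
    split=> [[q Hq qp]|[->|[q <- [_ [<-] /big_HH Hq]]]]; last by exists q.
      by right; exists q => //; exists M => //; exact/big_HH.
    by exists 0; [exact: (@gspan_subsp C m.+1 _).1 | rewrite mulr0].
  split=> [[q Hq <-]|[->|[q _ [M' //]]]].
    by left; rewrite (gspan_none _ Hq) ?mulr0 // => l _ [j _ [/andP[_]]].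
  by exists 0; [exact: (@gspan_subsp C m.+1 _).1 | rewrite mulr0].
have sW := realizes_sub R2.
have WH p : W p -> HH k.+1 M p.
  by move=> /WE[->|/trW_HH//]; exact: (HH_subsp _ _ _ _).1.
have CW p : C2space k M p <-> HH k.+1 M p /\ orth W p.
  split=> -[Hp op]; split=> // q Hq; last by apply/op/WE; right.
  by case/WE: Hq => [->|/op//]; exact: (fis_sym0 (fis0r _)).
have CI p : C2space k M p -> W p -> p = 0 by move=> /CW[_ op] /op; exact: fis_eq0.
apply: realizes_iso R1.
apply: realizes_ext (realizes_dsum Dsl_linear CI (@C2_realizes C m k M) R2) => p.
split=> [[q [r [/CW[Hq _] /WH Hr ->]]]|Hp].
  by apply: subspD => //; exact: HH_subsp.
have WM q : W q -> q \is M.-homog by move=> /WH[].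
have [w Ww ow] := orth_proj sW WM p.
exists (p - w), w; split=> //; last by rewrite subrK.
apply/CW; split=> //; rewrite addrC -scaleN1r; apply: (HH_subsp _ _ _ _).2 => //.
exact: WH.
Qed.

End Assembly.

Local Open Scope complex_scope.

Theorem corollary2p8 (R : realType) (n k m : nat) (n_ge2 : (2 <= n)%N)
  (V : {ffun 'I_n -> nat} -> vectType R[i])
  (rho : forall lam, lie_action (gl R[i] n) (V lam))
  (rhoP : forall lam, is_partition lam ->
     irreducible_highest_weight (rho lam) lam) :
  lie_iso
    (dsum (C2_part R[i] n k m)
       (\big[@dsum R[i] (sl R[i] n) / zero_module (sl R[i] n)]_(
          lam : {ffun 'I_n -> 'I_k} |
          is_partition (weight lam) && ((\sum_i lam i).+1 == m)%N)
          tensor_dual (rho (weight lam))))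
    (\big[@dsum R[i] (sl R[i] n) / zero_module (sl R[i] n)]_(
       lam : {ffun 'I_n -> 'I_k.+1} |
       is_partition (weight lam) && (\sum_i lam i == m)%N)
       tensor_dual (rho (weight lam))).
Proof.
by case: n n_ge2 V rho rhoP => [|[|n]] // _ V rho rhoP; exact: C2_iso.
Qed.
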